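(* Let $\mathcal{T}_h$ be an arbitrary partition of $I=(0,T)$, let $u$ be the exact solution of the initial value problem $u''(t)=f(t,u(t),u'(t))$, $t\in[0,T]$, $u(0)=u_0$, $u'(0)=u_1$, and let $U\in S^{\mathbf r,2}(\mathcal T_h)$ be its $C^1$-CPG solution. Assume that $f(t,u,u')$ is sufficiently smooth with respect to the variables $t$, $u$ and $u'$ on $\bar I\times\mathbb R\times\mathbb R$. Assume further that $u\in W^{s+1,\infty}(I)$ with $s\ge\frac32$. Then, for $k_n$ sufficiently small and $r_n\ge3$, we have $$\|u-U\|^2_{L^\infty(I)}\le C\,\frac{k^4\log(\overline r)}{\underline r^3}\max_{1\le n\le N}\left\{\frac{k_n^{2\min\{r_n,s\}-2}}{r_n^{2s-2}}\|u\|^2_{W^{s+1,\infty}(I_n)}\right\},$$ where $\overline r=\max_{1\le n\le N}\{r_n\}$, $\underline r=\min_{1\le n\le N}\{r_n\}$, and the constant $C>0$ is independent of $k_n$ and $r_n$. In particular, if $\mathcal T_h$ is a quasi-uniform partition (there exists a constant $C_q\ge1$ such that $1\le k/k_n\le C_q$, $1\le n\le N$) and $r_n\equiv r$, then $$\|u-U\|_{L^\infty(I)}\le C(\log r)^{\frac12}\frac{k^{\min\{r,s\}+1}}{r^{s+1/2}}\|u\|_{W^{s+1,\infty}(I)},$$ where the constant $C>0$ is independent of $k$ and $r$.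
   Context: Problem: $T>0$, $I=(0,T)$, $u_0,u_1\in\mathbb R$, and $f:\bar I\times\mathbb R\times\mathbb R\to\mathbb R$ is continuous for $t\in\bar I$ and satisfies the uniform Lipschitz condition $|f(t,u_1,v_1)-f(t,u_2,v_2)|\le L(|u_1-u_2|+|v_1-v_2|)$ for all $u_i,v_i\in\mathbb R$ and $t\in\bar I$, with $L>0$ independent of $t$. Discretization: a partition $\mathcal T_h=\{I_n\}_{n=1}^N$ of $I$ consists of subintervals $I_n=(t_{n-1},t_n)$, $0=t_0<t_1<\dots<t_N=T$; $k_n=t_n-t_{n-1}$, $k=\max_{1\le n\le N}k_n$. Each $I_n$ is assigned an integer degree $r_n\ge2$; $\mathbf r=\{r_n\}_{n=1}^N$. $P_m(I_n)$ is the space of polynomials of degree at most $m$ on $I_n$. Set $S^{\mathbf r,2}(\mathcal T_h)=\{v\in H^2(I): v|_{I_n}\in P_{r_n}(I_n),1\le n\le N\}$ and $S^{\mathbf r-2,0}(\mathcal T_h)=\{v\in L^2(I): v|_{I_n}\in P_{r_n-2}(I_n),1\le n\le N\}$. The $C^1$-CPG solution is $U\in S^{\mathbf r,2}(\mathcal T_h)$ with $U(0)=u_0$, $U'(0)=u_1$ and $\sum_{n=1}^N\int_{I_n}U''\varphi\,dt=\sum_{n=1}^N\int_{I_n}f(t,U,U')\varphi\,dt$ for all $\varphi\in S^{\mathbf r-2,0}(\mathcal T_h)$. Conventions: fractional-order spaces $W^{s,p}$ are defined by the usual $K$-method of interpolation. ''For $k_n$ sufficiently small'' means: whenever $\max_n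 k_n\le k_0$ for some threshold $k_0>0$ not depending on the partition or on the degrees. $C$ denotes a generic positive constant independent of the discretization parameters (time steps and degrees); it may take different values in different places, and $C_q$ is regarded as fixed over the quasi-uniform partitions considered. *)

(* Defs.v *)
From HB Require Import structures.
From mathcomp Require Import all_boot all_order all_algebra.
From mathcomp Require Import all_classical all_reals all_analysis.

Set Implicit Arguments.
Unset Strict Implicit.
Unset Printing Implicit Defensive.

Import Order.TTheory GRing.Theory Num.Theory.
Import numFieldNormedType.Exports.

Local Open Scope classical_set_scope.
Local Open Scope ring_scope.

(* Elements of L^p(J) and W^{s,p}(J) are represented by functions R -> R of
   which only the values on J, up to a null set, matter. *)

Definition test_function (R : realType) (J : set R) (phi : R -> R) : Prop :=
  (forall n x, derivable (derive1n n phi) x 1) /\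
  exists K : set R, [/\ compact K, K `<=` J & forall x, ~ K x -> phi x = 0].

Definition weak_derivative (R : realType) (J : set R) (j : nat)
    (v g : R -> R) : Prop :=
  [/\ locally_integrable J v, locally_integrable J g &
    forall phi, test_function J phi ->
      \int[lebesgue_measure]_(x in J) (v x * derive1n j phi x) =
      (-1) ^+ j * \int[lebesgue_measure]_(x in J) (g x * phi x)].

Definition in_Lp (R : realType) (J : set R) (p : \bar R) (v : R -> R) : Prop :=
  v \_ J \in Lfun (@lebesgue_measure R) p.

(* g 0, ..., g m are the weak derivatives of v, all in L^p(J);
   in particular g 0 = v a.e. on J. *)
Definition weak_derivatives_Lp (R : realType) (J : set R) (m : nat) (p : \bar R)
    (v : R -> R) (g : nat -> R -> R) : Prop :=
  forall j, (j <= m)%N -> weak_derivative J j v (g j) /\ in_Lp J p (g j).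

Definition in_W (R : realType) (J : set R) (m : nat) (p : \bar R)
    (v : R -> R) : Prop :=
  exists g, weak_derivatives_Lp J m p v g.

Definition Linf_norm (R : realType) (J : set R) (v : R -> R) : \bar R :=
  ('N[lebesgue_measure]_(+oo) [EFin \o (v \_ J)])%E.

(* Norm of W^{m,oo}(J), m an integer: max_(j <= m) ||v^(j)||_{L^oo(J)}.
   Weak derivatives being unique a.e., the infimum is over a set with at most
   one element; it is +oo when v is not in W^{m,oo}(J). *)
Definition Wint_norm (R : realType) (J : set R) (m : nat) (v : R -> R)
    : \bar R :=
  ereal_inf
    [set (\big[maxe/0]_(j < m.+1) Linf_norm J (g j))%E
       | g in [set g | weak_derivatives_Lp J m +oo%E v g]].

(* Peetre's K-functional of the couple (W^{m,oo}(J), W^{m+1,oo}(J)). *)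
Definition K_functional (R : realType) (J : set R) (m : nat) (v : R -> R)
    (tau : R) : \bar R :=
  ereal_inf
    [set z | exists v0 v1 : R -> R,
       {ae lebesgue_measure, forall x, J x -> v x = v0 x + v1 x} /\
       z = (Wint_norm J m v0 + tau%:E * Wint_norm J m.+1 v1)%E].

(* Norm of W^{sigma,oo}(J), sigma >= 0 real: the usual norm when sigma is an
   integer, otherwise that of the real interpolation space
   (W^{m,oo}, W^{m+1,oo})_{theta,oo} with m = floor sigma,
   theta = sigma - m. *)
Definition W_norm (R : realType) (J : set R) (sigma : R) (v : R -> R)
    : \bar R :=
  let m := Num.truncn sigma in
  let theta := sigma - m%:R in
  if theta == 0 then Wint_norm J m v
  else ereal_sup
    [set ((tau `^ (- theta))%:E * K_functional J m v tau)%E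
       | tau in [set tau : R | 0 < tau]].

Definition in_Winf (R : realType) (J : set R) (sigma : R) (v : R -> R) : Prop :=
  (W_norm J sigma v < +oo)%E.

(* One-sided at an end point of the interval A. *)
Definition has_derivative_in (R : realType) (A : set R) (g : R -> R) (x l : R)
    : Prop :=
  (g y - g x) / (y - x) @[y --> within A x^'] --> l.

(* f is of class C^m on [0,T] x R x R; D i j l stands for the partial
   derivative of order i in t, j in u and l in u'. *)
Definition class_C (R : realType) (m : nat) (T : R) (f : R -> R -> R -> R)
    : Prop :=
  exists D : nat -> nat -> nat -> R -> R -> R -> R,
    [/\ forall t x y, 0 <= t <= T -> D 0%N 0%N 0%N t x y = f t x y,
        forall i j l, (i + j + l <= m)%N ->
          {within `[0, T] `*` setT `*` setT,
            continuous (fun z : R * R * R => D i j l z.1.1 z.1.2 z.2)} &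
        forall i j l, (i + j + l < m)%N -> forall t x y, 0 <= t <= T ->
          [/\ has_derivative_in `[0, T] (fun a => D i j l a x y) t
                (D i.+1 j l t x y),
              has_derivative_in setT (fun a => D i j l t a y) x
                (D i j.+1 l t x y) &
              has_derivative_in setT (fun a => D i j l t x a) y
                (D i j l.+1 t x y)]].

Definition exact_solution (R : realType) (T : R) (f : R -> R -> R -> R)
    (u0 u1 : R) (u : R -> R) : Prop :=
  exists du : R -> R,
    [/\ forall t, 0 <= t <= T -> has_derivative_in `[0, T] u t (du t),
        forall t, 0 <= t <= T ->
          has_derivative_in `[0, T] du t (f t (u t) (du t)),
        u 0 = u0 & du 0 = u1].

(* Intervals are numbered from 0: t 0 < ... < t N are the nodes and r n is the
   degree on ]t n, t n.+1[ for n < N; other values of t and r are irrelevant. *)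

Definition is_partition (R : realType) (T : R) (N : nat) (t : nat -> R) : Prop :=
  [/\ t 0%N = 0, t N = T & forall n, (n < N)%N -> t n < t n.+1].

Definition subinterval (R : realType) (t : nat -> R) (n : nat) : set R :=
  `]t n, t n.+1[.

Definition step (R : realType) (t : nat -> R) (n : nat) : R := t n.+1 - t n.

Definition max_step (R : realType) (N : nat) (t : nat -> R) : R :=
  \big[Num.max/0]_(n < N) step t n.

Definition max_degree (N : nat) (r : nat -> nat) : nat := \max_(n < N) r n.

Definition min_degree (N : nat) (r : nat -> nat) : nat :=
  \big[minn/max_degree N r]_(n < N) r n.

Definition piecewise_poly (R : realType) (N : nat) (t : nat -> R)
    (d : nat -> nat) (v : R -> R) : Prop :=
  forall n, (n < N)%N -> exists p : {poly R},
    (size p <= (d n).+1)%N /\ forall x, subinterval t n x -> v x = p.[x].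

Definition trial_space (R : realType) (T : R) (N : nat) (t : nat -> R)
    (r : nat -> nat) (v : R -> R) : Prop :=
  in_W `]0, T[ 2 2%:E v /\ piecewise_poly N t r v.

Definition test_space (R : realType) (T : R) (N : nat) (t : nat -> R)
    (r : nat -> nat) (v : R -> R) : Prop :=
  in_Lp `]0, T[ 2%:E v /\ piecewise_poly N t (fun n => r n - 2)%N v.

(* Members of the trial space are only pinned down on the open subintervals, so
   the initial values are those of the C^1 representative, i.e. the limits at
   0 from the right. *)
Definition cpg_solution (R : realType) (T : R) (N : nat) (t : nat -> R)
    (r : nat -> nat) (f : R -> R -> R -> R) (u0 u1 : R) (U : R -> R) : Prop :=
  [/\ trial_space T N t r U,
      U x @[x --> 0^'+] --> u0,
      derive1 U x @[x --> 0^'+] --> u1 &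
      forall phi, test_space T N t r phi ->
        \sum_(n < N) \int[lebesgue_measure]_(x in subinterval t n)
                       (derive1n 2 U x * phi x) =
        \sum_(n < N) \int[lebesgue_measure]_(x in subinterval t n)
                       (f x (U x) (derive1 U x) * phi x)].

(* Main.v *)
Require Import Defs.
From HB Require Import structures.
From mathcomp Require Import all_boot all_order all_algebra.
From mathcomp Require Import all_classical all_reals all_analysis.
From mathcomp Require Import measurable_realfun ess_sup_inf.
From mathcomp Require Import ring lra.

Set Implicit Arguments.
Unset Strict Implicit.
Unset Printing Implicit Defensive.

Import Order.TTheory GRing.Theory Num.Theory.
Import numFieldNormedType.Exports.

Local Open Scope classical_set_scope.
Local Open Scope ring_scope.

(* On an interval of length k and degree r the method says that U'' is the
   L2-projection of f(t, U, U') onto the polynomials of degree r - 2. Write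
   u - U = R + delta, where R'' = rho is the projection error of u'' and R, R'
   vanish at both ends. Duality and the spectral gap of the Legendre operator give
   |R'| <= (k/r) |rho| in L2 and bound sup |R| by (k/r)^(3/2) |rho|. In
   f(t, u, u') - f(t, u - R, u' - R') the leading term is b R' with
   b = df/du'(t, u, u') Lipschitz, so its primitive is again controlled by sup |R|:
   this gains a factor r^(-1/2) over estimating the norm of R'. Then delta solves
   a perturbed initial value problem, and Gronwall over the nodes yields
   |u - U| <= C max_n (k_n/r_n)^(3/2) |rho_n|.
   To bound rho by the norm of u, test against the polynomials orthogonal to those
   of degree r - 2: their iterated primitives vanish at the end points, so weak
   derivatives can be moved onto them, and a splitting u = v0 + v1 close to
   optimal in the K-functional handles the fractional orders. *)

(** * Primitives and integrals of continuous functions *)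

(** The obstacle is the dependence of f on u'. Lipschitz continuity alone bounds the effect of R' on
    delta' by sqrt(k) |R'|, of order sqrt(k) (k/r) |rho|, too large by sqrt(r). Integrating b R' by
    parts replaces R' by R, whose supremum has the right order. The boundary term b R is acceptable
    inside an interval and vanishes at the nodes, so that nodal increments keep a factor k and can
    be summed over any number of intervals. Terms quadratic in R' are harmless: one factor is
    bounded uniformly, the other in L2, and |rho| <= M sqrt(k). The norms of u are infima over weak
    derivatives and splittings, so no approximant of u is constructed: duality asks only for moments
    of u'' against polynomials. The data are extended from [0, T] to the line and integrals are
    differences of primitives, which spares integrability conditions; Lebesgue integrals enter only
    with the definitions of the method and of the norms. The bounds obtained contain no logarithm;
    it is inserted at the end through ln 3 <= ln r. *)

Section Primitive.
Variable R : realType.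
Implicit Types (f g F G : R -> R) (a b c x : R).

Definition contR f := forall x, {for x, continuous f}.

Definition is_prim f F := forall x, is_derive x 1 F (f x).

Lemma is_prim_continuous f F : is_prim f F -> contR F.
Proof.
by move=> H x; apply/differentiable_continuous/derivable1_diffP; case: (H x).
Qed.

Lemma is_prim_le f F a b : a <= b -> is_prim f F ->
  (forall x, a <= x <= b -> 0 <= f x) -> F a <= F b.
Proof.
move=> ab HF f0.
have [c cab cE] := MVT_segment ab (fun x _ => HF x)
  (continuous_subspaceT (is_prim_continuous HF)).
by rewrite -subr_ge0 cE mulr_ge0 ?subr_ge0// f0.
Qed.

Lemma is_primB f g F G : is_prim f F -> is_prim g G ->
  is_prim (fun x => f x - g x) (fun x => F x - G x).
Proof. by move=> HF HG x; apply: is_deriveB. Qed.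

Lemma is_prim_unique f F G a b : is_prim f F -> is_prim f G ->
  F b - F a = G b - G a.
Proof.
wlog ab : a b / a <= b.
  move=> H HF HG; case/orP: (le_total a b) => h; first exact: H.
  by rewrite -opprB (H b a)// opprB.
move=> HF HG.
have H1 := is_prim_le ab (is_primB HF HG).
have H2 := is_prim_le ab (is_primB HG HF).
have {}H1 := H1 (fun x _ => ltac:(by rewrite subrr)).
have {}H2 := H2 (fun x _ => ltac:(by rewrite subrr)).
by lra.
Qed.

Notation mu := (@lebesgue_measure R).

Lemma continuous_itv_integrable f a b : contR f ->
  mu.-integrable `[a, b] (EFin \o f).
Proof.
move=> cf; apply: continuous_compact_integrable; first exact: segment_compact.
exact: continuous_subspaceT.
Qed.

(** The fundamental theorem applies only to the right of the base point of an integral, so the base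
    point of [F x] moves with [x]; subtracting the value at 0 makes the result independent of it. *)
Lemma is_prim_exists f : contR f -> exists F, is_prim f F.
Proof.
move=> cf.
pose G c x := (\int[mu]_(y in `[c, x]) f y)%R.
have GE c d x : c <= d -> d <= x -> G c x = G c d + G d x.
  move=> cd dx; rewrite /G.
  have := @Rintegral_itvB R f (BLeft c) (BRight x) d
    (continuous_itv_integrable c x cf).
  rewrite !bnd_simp => /(_ cd dx) E.
  rewrite -[X in _ + X]Rintegral_itv_obnd_cbnd -?E 1?addrC ?subrK//.
  apply: (integrableS _ _ _ (continuous_itv_integrable d x cf)) => //.
  exact: subset_itv_oc_cc.
pose F x := G (- `|x| - 1) x - G (- `|x| - 1) 0.
have FE c x : c < 0 -> c < x -> F x = G c x - G c 0.
  move=> c0 cx; rewrite /F.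
  have h1 := ler_norm x; have h2 := ler_norm (- x); rewrite normrN in h2.
  have h3 := normr_ge0 x.
  case/orP: (le_total c (- `|x| - 1)) => h.
    rewrite (GE c (- `|x| - 1) x h); last by lra.
    by rewrite (GE c (- `|x| - 1) 0 h); lra.
  rewrite (GE (- `|x| - 1) c x h); last by lra.
  by rewrite (GE (- `|x| - 1) c 0 h); lra.
exists F => x.
pose c := - `|x| - 1.
have cx : c < x by have := ler_norm (- x); rewrite normrN /c; lra.
have c0 : c < 0 by have := normr_ge0 x; rewrite /c; lra.
have x1 : x < x + 1 by rewrite ltrDl.
have [d1 d2] := continuous_FTC1_closed x1 (continuous_itv_integrable c (x + 1) cf) cx (cf x).
apply: (@near_eq_is_derive _ _ _ (fun y => G c y - G c 0)).
  by near=> y; rewrite -FE//; near: y; exact: lt_nbhsr.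
rewrite -[f x]subr0; apply: is_deriveB; rewrite -d2 derive1E.
exact: DeriveDef.
Unshelve. all: by end_near. Qed.

Definition prim f : R -> R := xget (cst 0) [set F | is_prim f F].

(** With a difference of values of a chosen primitive, additivity holds for end points in any order
    and without conditions on [f]. *)
Definition itg a b f : R := prim f b - prim f a.

Lemma primP f : contR f -> is_prim f (prim f).
Proof.
move=> /is_prim_exists[F HF]; rewrite /prim.
by case: xgetP => [G _//|/(_ F)].
Qed.

Lemma itg_prim f F a b : is_prim f F -> itg a b f = F b - F a.
Proof.
move=> HF; apply: (is_prim_unique (f := f)) => //; rewrite /prim.
by case: xgetP => [G _//|/(_ F)].
Qed.

Lemma is_prim_itg f a : contR f -> is_prim f (itg a ^~ f).
Proof.
move=> cf x; rewrite -[f x]subr0; apply: is_deriveB.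
exact: primP.
Qed.

Lemma cont_cst c : contR (fun _ : R => c).
Proof. by move=> x; exact: cvg_cst. Qed.

Lemma cont_id : contR (fun x : R => x).
Proof. by move=> x; exact: cvg_id. Qed.

Lemma contD f g : contR f -> contR g -> contR (fun x => f x + g x).
Proof. by move=> cf cg x; apply: cvgD; [exact: cf|exact: cg]. Qed.

Lemma contN f : contR f -> contR (fun x => - f x).
Proof. by move=> cf x; apply: cvgN; exact: cf. Qed.

Lemma contB f g : contR f -> contR g -> contR (fun x => f x - g x).
Proof. by move=> cf cg; apply: contD => //; exact: contN. Qed.

Lemma contM f g : contR f -> contR g -> contR (fun x => f x * g x).
Proof. by move=> cf cg x; apply: cvgM; [exact: cf|exact: cg]. Qed.

Lemma contX f n : contR f -> contR (fun x => f x ^+ n).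
Proof.
move=> cf; elim: n => [|n IH]; first exact: cont_cst.
by under [X in contR X]funext do rewrite exprS; exact: contM.
Qed.

Lemma cont_norm f : contR f -> contR (fun x => `|f x|).
Proof. by move=> cf x; apply: cvg_norm; exact: cf. Qed.

Lemma cont_horner (p : {poly R}) : contR (fun x => p.[x]).
Proof. exact: continuous_horner. Qed.

Lemma cont_itg f a : contR f -> contR (itg a ^~ f).
Proof. by move=> cf; apply: is_prim_continuous; exact: is_prim_itg. Qed.

Lemma itgD a b f g : contR f -> contR g ->
  itg a b (fun x => f x + g x) = itg a b f + itg a b g.
Proof.
move=> cf cg; rewrite (@itg_prim _ (fun x => prim f x + prim g x)).
  by rewrite /itg; lra.
by move=> x; apply: is_deriveD; exact: primP.
Qed.

Lemma itgB a b f g : contR f -> contR g ->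
  itg a b (fun x => f x - g x) = itg a b f - itg a b g.
Proof.
move=> cf cg; rewrite (@itg_prim _ (fun x => prim f x - prim g x)).
  by rewrite /itg; lra.
by move=> x; apply: is_deriveB; exact: primP.
Qed.

Lemma itgZ a b c f : contR f -> itg a b (fun x => c * f x) = c * itg a b f.
Proof.
move=> cf; rewrite (@itg_prim _ (fun x => c * prim f x)).
  by rewrite /itg; lra.
by move=> x; apply: is_deriveZ; exact: primP.
Qed.

Lemma itg_cst a b c : itg a b (fun _ => c) = c * (b - a).
Proof.
rewrite (@itg_prim _ (fun x => c * x)); first by lra.
move=> x; rewrite -[X in is_derive _ _ _ X]mulr1.
by apply: (@is_deriveZ _ _ _ id); exact: is_derive_id.
Qed.

Lemma itg_split a b c f : itg a c f = itg a b f + itg b c f.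
Proof. by rewrite /itg; lra. Qed.

Lemma itgxx a f : itg a a f = 0.
Proof. by rewrite /itg subrr. Qed.

Lemma itg_ge0 a b f : a <= b -> contR f ->
  (forall x, a <= x <= b -> 0 <= f x) -> 0 <= itg a b f.
Proof.
by move=> ab cf f0; rewrite /itg subr_ge0; apply: (is_prim_le ab (primP cf)).
Qed.

Lemma itg_le a b f g : a <= b -> contR f -> contR g ->
  (forall x, a <= x <= b -> f x <= g x) -> itg a b f <= itg a b g.
Proof.
move=> ab cf cg fg; rewrite -subr_ge0 -itgB//; apply: itg_ge0 => //.
  exact: contB.
by move=> x /fg; rewrite subr_ge0.
Qed.

Lemma eq_itg a b f g : a <= b -> contR f -> contR g ->
  (forall x, a <= x <= b -> f x = g x) -> itg a b f = itg a b g.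
Proof.
by move=> ab cf cg fg; apply/eqP; rewrite eq_le !itg_le// => x /fg ->.
Qed.

Lemma itg_norm a b f : a <= b -> contR f ->
  `|itg a b f| <= itg a b (fun x => `|f x|).
Proof.
move=> ab cf; rewrite ler_norml; apply/andP; split; last first.
  by apply: itg_le => //; [exact: cont_norm|move=> x _; exact: ler_norm].
rewrite -[leRHS]opprK lerN2 -mulN1r -itgZ//; apply: itg_le => //.
- by apply: contM => //; exact: cont_cst.
- exact: cont_norm.
- by move=> x _; rewrite mulN1r -normrN ler_norm.
Qed.

Lemma itg_bound a b f M : a <= b -> contR f ->
  (forall x, a <= x <= b -> `|f x| <= M) -> `|itg a b f| <= M * (b - a).
Proof.
move=> ab cf fM; rewrite -itg_cst; apply: le_trans (itg_norm ab cf) _.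
by apply: itg_le => //; [exact: cont_norm|exact: cont_cst].
Qed.

Lemma itg_ibp a b f g F G : is_prim f F -> is_prim g G ->
  contR f -> contR g ->
  itg a b (fun x => F x * g x) =
  F b * G b - F a * G a - itg a b (fun x => f x * G x).
Proof.
move=> HF HG cf cg.
have cF := is_prim_continuous HF; have cG := is_prim_continuous HG.
suff : itg a b (fun x => F x * g x + f x * G x) = F b * G b - F a * G a.
  by rewrite itgD; [lra|exact: contM..].
rewrite (@itg_prim _ (fun x => F x * G x))// => x.
have := is_deriveM (HF x) (HG x).
by rewrite /GRing.scale/= [f x * _]mulrC.
Qed.

End Primitive.

Arguments cont_cst {R} c.
Arguments cont_horner {R} p.
Arguments cont_itg {R f} a.
Arguments is_prim_itg {R f} a.

Ltac cont1 := match goal with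
  | |- contR (fun x => ?c) => refine (@cont_cst _ c)
  | |- contR (fun x => x) => refine (@cont_id _)
  | |- contR (fun x => horner ?p x) => refine (@cont_horner _ p)
  | |- contR (horner ?p) => refine (@cont_horner _ p)
  | |- contR (fun x => @?f x + @?g x) => refine (@contD _ f g _ _)
  | |- contR (fun x => - @?f x) => refine (@contN _ f _)
  | |- contR (fun x => @?f x * @?g x) => refine (@contM _ f g _ _)
  | |- contR (fun x => GRing.exp (@?f x) ?n) => refine (@contX _ f n _)
  | |- contR (fun x => Num.norm (@?f x)) => refine (@cont_norm _ f _)
  | |- contR (fun x => itg ?a x ?f) => refine (@cont_itg _ f a _)
  | |- contR _ => assumption
  end.
Ltac cont := repeat cont1.

(** * Cauchy-Schwarz inequality and comparison with the Lebesgue integral *)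

Section Integral.
Variable R : realType.
Implicit Types (f g F G : R -> R) (a b c x : R).
Notation mu := (@lebesgue_measure R).

Lemma quadratic_ge0_discr (A B C : R) : 0 <= C ->
  (forall l, 0 <= A + 2 * l * B + l ^+ 2 * C) -> B ^+ 2 <= A * C.
Proof.
move=> C0 H; have A0 : 0 <= A by have := H 0; lra.
have [Cz|Cn0] := eqVneq C 0.
  have [->|B0] := eqVneq B 0; first by rewrite Cz; lra.
  have := H (- (A + 1) / (2 * B)).
  have -> : 2 * (- (A + 1) / (2 * B)) * B = - (A + 1) by field.
  by rewrite Cz; lra.
have := H (- B / C).
have -> : A + 2 * (- B / C) * B + (- B / C) ^+ 2 * C = (A * C - B ^+ 2) / C by field.
by rewrite pmulr_lge0 ?invr_gt0 ?lt0r ?Cn0// subr_ge0.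
Qed.

Lemma cauchy_schwarz_itg a b f g : a <= b -> contR f -> contR g ->
  itg a b (fun x => f x * g x) ^+ 2 <=
  itg a b (fun x => f x ^+ 2) * itg a b (fun x => g x ^+ 2).
Proof.
move=> ab cf cg; apply: quadratic_ge0_discr => [|l].
  by apply: itg_ge0 => //; [cont|move=> *; exact: sqr_ge0].
rewrite -!itgZ; [|cont..].
rewrite -!itgD; [|cont..].
apply: itg_ge0 => //; first by cont.
move=> x _; rewrite (_ : _ + _ = (f x + l * g x) ^+ 2) ?sqr_ge0//; ring.
Qed.

(** Integrals over shorter intervals are squeezed to 0, so the primitive [itg a ^~ f] is constant
    inside and its derivative [f x] vanishes. *)
Lemma itg_eq0 a b f : contR f -> (forall x, a <= x <= b -> 0 <= f x) ->
  itg a b f = 0 -> forall x, a < x < b -> f x = 0.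
Proof.
move=> cf f0 I0 x /andP[ax xb].
have IE y : a < y < b -> itg a y f = 0.
  move=> /andP[ay yb]; move: I0; rewrite (itg_split a y b) => I0.
  have h1 : 0 <= itg a y f.
    by apply: itg_ge0 => //; [exact: ltW|move=> z /andP[? ?]; apply: f0; lra].
  have h2 : 0 <= itg y b f.
    by apply: itg_ge0 => //; [exact: ltW|move=> z /andP[? ?]; apply: f0; lra].
  lra.
have H1 : is_derive x 1 (itg a ^~ f) (f x) by exact: is_prim_itg.
have H2 : is_derive x 1 (itg a ^~ f) (0 : R).
  apply: (@near_eq_is_derive _ _ _ (cst 0)).
  near=> y; rewrite IE//; apply/andP; split; near: y.
    exact: lt_nbhsr.
  exact: lt_nbhsl.
by rewrite -(@derive_val _ _ _ _ _ _ _ H1) (@derive_val _ _ _ _ _ _ _ H2).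
Unshelve. all: by end_near. Qed.

Lemma Rintegral_itg a b f : a <= b -> contR f ->
  (\int[mu]_(x in `]a, b[) f x)%R = itg a b f.
Proof.
rewrite le_eqVlt => /orP[/eqP <-|ab] cf.
  by rewrite set_itv_ge ?bnd_simp ?ltxx// Rintegral_set0 itgxx.
have cP := is_prim_continuous (primP cf).
have I : mu.-integrable `[a, b] (EFin \o f) by exact: continuous_itv_integrable.
rewrite Rintegral_itv_bndo_bndc; last first.
  by apply: integrableS I => //; exact: subset_itv_oo_cc.
rewrite Rintegral_itv_obnd_cbnd; last first.
  by apply: integrableS I => //; exact: subset_itv_oc_cc.
rewrite /Rintegral (@continuous_FTC2 _ f (prim f))//.
- exact: continuous_subspaceT.
- split.
  + by move=> x _; have [] := primP cf x.
  + exact/cvg_at_right_filter/cP.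
  + exact/cvg_at_left_filter/cP.
- by move=> x _; rewrite derive1E; have [_ ->] := primP cf x.
Qed.

End Integral.

(** * Orthogonal polynomials *)

Section Orthogonality.
Variables (R : realType) (a b : R).
Hypothesis ab : a < b.
Implicit Types (f g w e : R -> R) (p q l : {poly R}) (n : nat).

Let leab := ltW ab.

(** The size bound means degree below [n]; on an interval of degree r the method corresponds to [n]
    = r - 1. *)
Definition orth n w := forall q, (size q <= n)%N ->
  itg a b (fun x => w x * q.[x]) = 0.

Lemma orthW m n w : (m <= n)%N -> orth n w -> orth m w.
Proof. by move=> mn H q qm; apply: H; exact: leq_trans mn. Qed.

Lemma itg_sqr_horner_gt0 p : p != 0 -> 0 < itg a b (fun x => p.[x] ^+ 2).
Proof.
move=> p0; rewrite lt_neqAle itg_ge0//; [rewrite andbT|by cont|by move=> *; exact: sqr_ge0].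
apply/negP => /eqP/esym I0.
have H := itg_eq0 (contX (n := 2) (@cont_horner R p)) (fun x _ => sqr_ge0 _) I0.
(* These are [size p] distinct points inside ]a, b[. Were the integral zero, all of them would be
   roots, more than the degree allows. *)
pose s := [seq a + (b - a) * (i.+1%:R / (size p).+1%:R) | i <- iota 0 (size p)].
have := @max_poly_roots _ p s p0.
have -> : all (root p) s.
  apply/allP => y /mapP[i]; rewrite mem_iota add0n => /andP[_ ip] ->.
  apply/rootP/eqP; rewrite -sqrf_eq0; apply/eqP/H.
  have : 0 < i.+1%:R / (size p).+1%:R :> R by rewrite divr_gt0.
  have : i.+1%:R / (size p).+1%:R < 1 :> R by rewrite ltr_pdivrMr// mul1r ltr_nat.
  set t := _ / _ => h2 h1; have d0 : 0 < b - a by rewrite subr_gt0.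
  have h3 := mulr_gt0 d0 h1; have : (b - a) * t < b - a by rewrite gtr_pMr.
  by move: ((b - a) * t) h3 => z; lra.
have -> : uniq s.
  rewrite map_inj_uniq ?iota_uniq// => i j /addrI/mulfI.
  rewrite subr_eq0 gt_eqF// => /(_ isT)/divIf; rewrite pnatr_eq0 => /(_ isT) /eqP.
  by rewrite eqr_nat => /eqP[].
by rewrite size_map size_iota ltnn => /(_ isT isT).
Qed.

Lemma size_sub_lead n l q : (size q <= n.+1)%N -> (size l <= n.+1)%N ->
  l`_n = 1 -> (size (q - q`_n *: l)%R <= n)%N.
Proof.
move=> sq sl l1; apply/leq_sizeP => j; rewrite leq_eqVlt => /orP[/eqP<-|nj].
  by rewrite coefB coefZ l1 mulr1 subrr.
by rewrite coefB coefZ !(nth_default _ (leq_trans _ nj))// mulr0 subr0.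
Qed.

Lemma itg_hornerD w p q : contR w ->
  itg a b (fun x => w x * (p + q).[x]) =
  itg a b (fun x => w x * p.[x]) + itg a b (fun x => w x * q.[x]).
Proof.
move=> cw; rewrite -itgD; [|cont..].
by apply: eq_itg; [|cont..|move=> x _; rewrite hornerD mulrDr].
Qed.

Lemma itg_hornerZ w c q : contR w ->
  itg a b (fun x => w x * (c *: q).[x]) = c * itg a b (fun x => w x * q.[x]).
Proof.
move=> cw; rewrite -itgZ; [|cont..].
by apply: eq_itg; [|cont..|move=> x _; rewrite hornerZ mulrCA].
Qed.

Lemma itg_sqrE w : contR w ->
  itg a b (fun x => w x * w x) = itg a b (fun x => w x ^+ 2).
Proof. by move=> cw; apply: eq_itg; [|cont..|]. Qed.

Lemma itgC f g : contR f -> contR g ->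
  itg a b (fun x => f x * g x) = itg a b (fun x => g x * f x).
Proof. by move=> cf cg; apply: eq_itg; [|cont..|move=> x _; rewrite mulrC]. Qed.

(** Gram-Schmidt by induction: the induction hypothesis, applied to the moments of X^n, yields the
    projection [m] of X^n, and a multiple of [l] = X^n - m corrects the value at [l] without
    disturbing lower degrees. Hence the functional [la] stays general. *)
Lemma poly_riesz n (la : {poly R} -> R) :
  (forall c p q, la (c *: p + q) = c * la p + la q) ->
  exists2 p : {poly R}, (size p <= n)%N &
    forall q, (size q <= n)%N -> itg a b (fun x => p.[x] * q.[x]) = la q.
Proof.
elim: n la => [|n IH] la laL.
  exists 0; rewrite ?size_poly0// => q; rewrite leqn0 size_poly_eq0 => /eqP ->.
  have := laL 1 0 0; rewrite scaler0 addr0 => la0.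
  under [X in itg _ _ X]funext do rewrite horner0 mul0r.
  by rewrite itg_cst; lra.
have [m sm mP] : exists2 m : {poly R}, (size m <= n)%N & forall q, (size q <= n)%N ->
    itg a b (fun x => m.[x] * q.[x]) = itg a b (fun x => 'X^n.[x] * q.[x]).
  by apply: IH => c p q; rewrite itg_hornerD ?itg_hornerZ//; cont.
pose l : {poly R} := 'X^n - m.
have sl : (size l <= n.+1)%N.
  by rewrite (leq_trans (size_polyD _ _))// size_polyN size_polyXn geq_max leqnn leqW.
have l1 : l`_n = 1 by rewrite coefB coefXn eqxx nth_default ?subr0.
have lo : orth n (fun x => l.[x]).
  move=> q sq; rewrite (eq_itg (g := fun x => 'X^n.[x] * q.[x] - m.[x] * q.[x]) leab).
  - by rewrite itgB ?mP ?subrr//; cont.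
  - by cont.
  - by cont.
  - by move=> x _; rewrite -mulrBl -hornerN -hornerD.
have ll : 0 < itg a b (fun x => l.[x] ^+ 2).
  apply: itg_sqr_horner_gt0; apply/eqP => l0; move: l1; rewrite l0 coef0.
  by move/esym/eqP; rewrite oner_eq0.
have [p0 sp0 p0P] := IH la laL.
pose p := p0 + ((la l - itg a b (fun x => p0.[x] * l.[x])) / itg a b (fun x => l.[x] ^+ 2)) *: l.
exists p => [|q sq].
  rewrite (leq_trans (size_polyD _ _))// geq_max leqW//=.
  exact: leq_trans (size_scale_leq _ _) sl.
have sq1 := size_sub_lead sq sl l1.
set q1 := q - _ in sq1; have -> : q = q`_n *: l + q1 by rewrite addrC subrK.
rewrite laL itg_hornerD; [|cont]; rewrite itg_hornerZ; [|cont].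
have E r : itg a b (fun x => p.[x] * r.[x]) = itg a b (fun x => p0.[x] * r.[x]) +
   (la l - itg a b (fun x => p0.[x] * l.[x])) / itg a b (fun x => l.[x] ^+ 2) *
    itg a b (fun x => l.[x] * r.[x]).
  rewrite itgC; [|cont..]; rewrite itg_hornerD ?itg_hornerZ; [|cont..].
  by congr (_ + _ * _); rewrite itgC//; cont.
rewrite (E l) (E q1) (lo q1 sq1) (p0P q1 sq1).
have -> : itg a b (fun x => l.[x] * l.[x]) = itg a b (fun x => l.[x] ^+ 2).
  exact: itg_sqrE (@cont_horner _ l).
by rewrite divfK ?gt_eqF//; lra.
Qed.

Lemma proj_exists n w : contR w ->
  exists2 p : {poly R}, (size p <= n)%N & orth n (fun x => w x - p.[x]).
Proof.
move=> cw; have [|p sp pP] := @poly_riesz n (fun q => itg a b (fun x => w x * q.[x])).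
  by move=> c p q; rewrite itg_hornerD ?itg_hornerZ.
exists p => // q sq.
rewrite (eq_itg (g := fun x => w x * q.[x] - p.[x] * q.[x]) leab).
- by rewrite itgB ?pP ?subrr//; cont.
- by cont.
- by cont.
- by move=> x _; rewrite mulrBl.
Qed.

Lemma monic_orth_exists n : exists l : {poly R},
  [/\ (size l <= n.+1)%N, l`_n = 1 & orth n (fun x => l.[x])].
Proof.
have [m sm mP] := proj_exists n (@cont_horner R 'X^n).
exists ('X^n - m); split.
- by rewrite (leq_trans (size_polyD _ _))// size_polyN size_polyXn geq_max leqnn leqW.
- by rewrite coefB coefXn eqxx nth_default ?subr0.
- move=> q sq; rewrite -(mP q sq); apply: (eq_itg leab); [by cont|by cont|].
  by move=> x _; rewrite hornerD hornerN.
Qed.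

Definition bubble : {poly R} := ('X - a%:P) * (b%:P - 'X).

Definition legendre_op p : {poly R} := - (bubble * p^`())^`().

Lemma legendre_op_selfadjoint p q :
  itg a b (fun x => (legendre_op p).[x] * q.[x]) =
  itg a b (fun x => bubble.[x] * (p^`().[x] * q^`().[x])).
Proof.
have H := @itg_ibp R a b (fun x => q^`().[x]) (fun x => (bubble * p^`())^`().[x])
  (fun x => q.[x]) (fun x => (bubble * p^`()).[x]) (fun x => is_derive_poly q x)
  (fun x => is_derive_poly (bubble * p^`()) x) ltac:(cont) ltac:(cont).
have E : itg a b (fun x => q^`().[x] * (bubble * p^`()).[x]) =
  itg a b (fun x => bubble.[x] * (p^`().[x] * q^`().[x])).
  apply: eq_itg; [exact: leab|cont..|] => x _; rewrite hornerM; ring.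
rewrite -E itgC; [|cont..]; rewrite /legendre_op -scaleN1r itg_hornerZ; [|cont].
have Bb : bubble.[b] = 0 by rewrite /bubble !hornerE subrr mulr0.
have Ba : bubble.[a] = 0 by rewrite /bubble !hornerE subrr mul0r.
have Zb : (bubble * p^`()).[b] = 0 by rewrite hornerM Bb mul0r.
have Za : (bubble * p^`()).[a] = 0 by rewrite hornerM Ba mul0r.
by rewrite E H E Za Zb; ring.
Qed.

(** Only the quadratic coefficient -1 of [bubble] reaches the top degree: X^n is sent to n(n + 1)
    X^n plus lower terms. *)
Lemma size_legendre_op n p : (size p <= n.+1)%N ->
  (size (legendre_op p - (n * n.+1)%:R *: p)%R <= n)%N.
Proof.
move=> sp; apply/leq_sizeP => j nj.
have E : bubble = - 'X ^+ 2 + (a + b) *: 'X - (a * b)%:P.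
  rewrite /bubble -!mul_polyC polyCD polyCM; ring.
have sn m : (n < m)%N -> p`_m = 0 by move=> nm; rewrite nth_default// (leq_trans sp).
rewrite /legendre_op coefB coefN coef_deriv coefZ.
have -> : (bubble * p^`())`_j.+1 = - (p`_j *+ j).
  rewrite E !mulrDl !mulNr -scalerAl !coefD !coefN coefZ coefXnM coefXM coefCM.
  rewrite !coef_deriv (sn j.+2) ?ltnS 1?leqW// mul0rn mulr0 subr0/= (sn j.+1)//.
  rewrite mul0rn mulr0 addr0 subSS subn1; case: j {nj} => [|j] //=.
have -> : - (- (p`_j *+ j) *+ j.+1) = (j * j.+1)%:R * p`_j.
  by rewrite mulNrn opprK -mulrnA mulr_natl.
move: nj; rewrite leq_eqVlt => /orP[/eqP <-|nj]; first by rewrite subrr.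
by rewrite sn// !mulr0 subrr.
Qed.

Lemma size_legendre_op_le n p : (size p <= n)%N -> (size (legendre_op p) <= n)%N.
Proof.
case: n => [|n] sp.
  move: sp; rewrite leqn0 size_poly_eq0 => /eqP ->.
  by rewrite /legendre_op deriv0 mulr0 deriv0 oppr0 size_poly0.
have -> : legendre_op p = (legendre_op p - (n * n.+1)%:R *: p) + (n * n.+1)%:R *: p.
  by rewrite subrK.
rewrite (leq_trans (size_polyD _ _))// geq_max leqW ?size_legendre_op//=.
exact: leq_trans (size_scale_leq _ _) sp.
Qed.

Lemma bubble_ge0 x : a <= x <= b -> 0 <= bubble.[x].
Proof. by move=> /andP[ax xb]; rewrite /bubble !hornerE mulr_ge0// subr_ge0. Qed.

Lemma bubble_le x : bubble.[x] <= (b - a) ^+ 2 / 4.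
Proof.
rewrite /bubble !hornerE -subr_ge0.
have -> : (b - a) ^+ 2 / 4 - (x - a) * (b - x) = (x - (a + b) / 2) ^+ 2 by field.
exact: sqr_ge0.
Qed.

(* The Legendre polynomial of degree [n] is an eigenvector of [legendre_op]
   with eigenvalue [n * n.+1]; only the leading coefficients matter here. *)
Lemma orth_bubble_le n p : orth n (fun x => p.[x]) ->
  (n * n.+1)%:R * itg a b (fun x => p.[x] ^+ 2) <=
  itg a b (fun x => bubble.[x] * p^`().[x] ^+ 2).
Proof.
have : (size p <= maxn n (size p))%N by rewrite leq_maxr.
have : (n <= maxn n (size p))%N by rewrite leq_maxl.
move: (maxn n (size p)) => N nN.
rewrite -(subnKC nN) {nN}; move: (N - n)%N => d.
have I0 q : 0 <= itg a b (fun x => bubble.[x] * q.[x] ^+ 2).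
  apply: itg_ge0 => //; first by cont.
  by move=> x xab; rewrite mulr_ge0 ?bubble_ge0 ?sqr_ge0.
(* Induction on the excess [d] of the size bound over [n]. The component of [p] along the monic
   orthogonal polynomial [l] of degree n + d is split off; the cross terms vanish because the
   self-adjoint operator does not raise degrees. *)
elim: d p => [|d IH] p sp po.
  have := po p; rewrite (itg_sqrE (@cont_horner _ p)) => ->; first by rewrite mulr0.
  by rewrite addn0 in sp.
rewrite addnS in sp; set N0 := (n + d)%N in IH sp.
have nN0 : (n <= N0)%N by rewrite leq_addr.
have [l [sl l1 lo]] := monic_orth_exists N0.
have sp1 := size_sub_lead sp sl l1; set c := p`_N0 in sp1; set p1 := _ - _ in sp1.
have pE : p = c *: l + p1 by rewrite addrC subrK.
have p1o : orth n (fun x => p1.[x]).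
  move=> q sq; rewrite (eq_itg (g := fun x => p.[x] * q.[x] - c * (l.[x] * q.[x])) leab).
  - rewrite itgB ?itgZ ?(po q sq) ?(orthW nN0 lo sq); [|cont..].
    by rewrite mulr0 subrr.
  - by cont.
  - by cont.
  - by move=> x _; rewrite /p1 hornerD hornerN hornerZ; ring.
have {}IH := IH _ sp1 p1o.
have E1 : itg a b (fun x => l.[x] * p1.[x]) = 0 by apply: lo.
have E2 : itg a b (fun x => bubble.[x] * (p1^`().[x] * l^`().[x])) = 0.
  rewrite -legendre_op_selfadjoint itgC; [|cont..].
  by apply: lo; exact: size_legendre_op_le.
have E3 : itg a b (fun x => bubble.[x] * (l^`().[x] * l^`().[x])) =
    (N0 * N0.+1)%:R * itg a b (fun x => l.[x] ^+ 2).
  rewrite -legendre_op_selfadjoint itgC; [|cont..].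
  have := lo _ (size_legendre_op sl).
  rewrite -scaleNr itg_hornerD ?itg_hornerZ ?(itg_sqrE (@cont_horner _ l)); [|cont..].
  by move/eqP; rewrite mulNr subr_eq0 => /eqP.
have -> : itg a b (fun x => p.[x] ^+ 2) =
    c ^+ 2 * itg a b (fun x => l.[x] ^+ 2) + itg a b (fun x => p1.[x] ^+ 2).
  rewrite -[RHS]addr0 -[X in _ + X](mulr0 (2 * c)) -E1 -!itgZ; [|cont..].
  rewrite -!itgD; [|cont..].
  apply: (eq_itg leab); [by cont|by cont|].
  by move=> x _; rewrite {1}pE hornerD hornerZ; ring.
have -> : itg a b (fun x => bubble.[x] * p^`().[x] ^+ 2) =
    c ^+ 2 * ((N0 * N0.+1)%:R * itg a b (fun x => l.[x] ^+ 2)) +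
    itg a b (fun x => bubble.[x] * p1^`().[x] ^+ 2).
  rewrite -E3 -[RHS]addr0 -[X in _ + X](mulr0 (2 * c)) -E2 -!itgZ; [|cont..].
  rewrite -!itgD; [|cont..].
  apply: (eq_itg leab); [by cont|by cont|].
  by move=> x _; rewrite {1}pE derivD derivZ hornerD hornerZ; ring.
rewrite mulrDr lerD// mulrCA ler_wpM2l ?sqr_ge0// ler_wpM2r//.
  by apply: itg_ge0 => //; [cont|move=> *; exact: sqr_ge0].
by rewrite ler_nat leq_mul.
Qed.

Lemma orth_poly_le n p : orth n (fun x => p.[x]) ->
  (n * n.+1)%:R * itg a b (fun x => p.[x] ^+ 2) <=
  (b - a) ^+ 2 / 4 * itg a b (fun x => p^`().[x] ^+ 2).
Proof.
move=> /orth_bubble_le /le_trans; apply; rewrite -itgZ; [|cont].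
apply: itg_le => //; [cont|cont|] => x _.
by rewrite ler_wpM2r ?sqr_ge0 ?bubble_le.
Qed.

End Orthogonality.

(** * Weierstrass approximation *)

Section Weierstrass.
Variable R : realType.
Implicit Types (f g : R -> R) (p : {poly R}) (x y e : R).

(** Bernstein polynomial with nodal values [g i], in de Casteljau's recursive form: positivity and
    moments follow by induction, without binomial coefficients. *)
Fixpoint bern (N : nat) (g : nat -> R) : {poly R} :=
  if N is N'.+1 then 'X * bern N' (g \o S) + (1 - 'X) * bern N' g else (g 0%N)%:P.

Lemma bernS N (g : nat -> R) x :
  (bern N.+1 g).[x] = x * (bern N (g \o S)).[x] + (1 - x) * (bern N g).[x].
Proof. by rewrite /= !hornerE. Qed.

Lemma bern_le N (g h : nat -> R) x : 0 <= x <= 1 ->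
  (forall i, (i <= N)%N -> g i <= h i) -> (bern N g).[x] <= (bern N h).[x].
Proof.
move=> /andP[x0 x1]; elim: N g h => [|N IH] g h gh.
  by rewrite /= !hornerC gh.
rewrite !bernS lerD// ler_wpM2l ?subr_ge0//; apply: IH => i iN; apply: gh => //.
exact: leqW.
Qed.

Lemma bern_affine N (g : nat -> R) c d x :
  (bern N (fun i => c + d * g i)).[x] = c + d * (bern N g).[x].
Proof.
elim: N g => [|N IH] g; first by rewrite /= !hornerC.
by rewrite !bernS IH [bern N (_ \o S)](_ : _ = bern N (fun i => c + d * (g \o S) i))// IH; ring.
Qed.

(** Second moment of the binomial distribution about [c]: its variance plus the squared distance
    from its mean to [c]. *)
Lemma bern_sqr N c x : (bern N (fun i => (i%:R - c) ^+ 2)).[x] =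
  N%:R * x * (1 - x) + (N%:R * x - c) ^+ 2.
Proof.
elim: N c => [|N IH] c; first by rewrite /= hornerC; ring.
rewrite bernS IH [bern N (_ \o S)](_ : _ = bern N (fun i => (i%:R - (c - 1)) ^+ 2)).
  by rewrite IH -natr1; ring.
congr bern; apply/funext => i /=; rewrite -natr1; ring.
Qed.

Lemma heine f a b e : contR f -> 0 < e -> exists2 d : R, 0 < d &
  forall x y, a <= x <= b -> `|x - y| < d -> `|f x - f y| <= e.
Proof.
move=> cf e0.
have /compact_near_coveringP/(_ R (0:R)^'+
    (fun d x => forall y, `|x - y| < d -> `|f x - f y| <= e) _) H := @segment_compact R a b.
have /H[d /= d0 dP] : forall x, `[a, b]%classic x ->
    \forall x' \near x & d \near 0^'+, forall y, `|x' - y| < d -> `|f x' - f y| <= e.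
  move=> x _; have /cvgrPdist_le/(_ (e / 2)) := cf x.
  rewrite divr_gt0// => /(_ isT) /nbhs_ballP[r /= r0 rP].
  exists (ball x (r / 2), [set d | d < r / 2]) => /=.
    split; first by apply: nbhsx_ballx; rewrite divr_gt0.
    by apply: nbhs_right_lt; rewrite divr_gt0.
  move=> [x' d] /= [xx' dr] y x'y.
  have h1 := rP x'; have h2 := rP y; rewrite /ball/= in h1 h2 xx'.
  have {}h1 := h1 ltac:(rewrite (lt_le_trans xx')//; lra).
  have {}h2 := h2 ltac:(rewrite -(subrK x' x) -addrA (le_lt_trans (ler_normD _ _))//; lra).
  rewrite -(subrKA (f x)) (le_trans (ler_normD _ _))//.
  by rewrite [X in X + _]distrC; lra.
exists (d / 2); first by rewrite divr_gt0.
move=> x y xab xy; have h2 : 0 < d / 2 by rewrite divr_gt0.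
apply: (dP (d / 2) _ h2 x) => //=.
by rewrite sub0r normrN gtr0_norm//; lra.
Qed.

Lemma weierstrass01 f e : contR f -> 0 < e ->
  exists p, forall x, 0 <= x <= 1 -> `|f x - p.[x]| <= e.
Proof.
move=> cf e0.
have [d d0 dP] := @heine f 0 1 (e / 2) cf ltac:(by rewrite divr_gt0).
have [c _ cM] := @EVT_max R (fun x => `|f x|) 0 1 ler01
  (continuous_subspaceT (cont_norm cf)).
have {}cM x : 0 <= x <= 1 -> `|f x| <= `|f c| by move=> x01; apply: cM; rewrite in_itv.
set M := `|f c| in cM; have M0 : 0 <= M by exact: normr_ge0.
(* With this [K] the parabola [K * (x - y) ^+ 2] exceeds 2 M as soon as x and y are [d] apart, so
   that e/2 plus the parabola bounds the oscillation of [f] everywhere. [N] is then chosen to make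
   the variance contribution K x (1 - x) / N at most e/2. *)
pose K := 2 * M / d ^+ 2.
have K0 : 0 <= K by rewrite /K divr_ge0 ?sqr_ge0// mulr_ge0.
have fK x y : 0 <= x <= 1 -> 0 <= y <= 1 -> `|f x - f y| <= e / 2 + K * (x - y) ^+ 2.
  move=> x01 y01; have [xy|xy] := ltP `|x - y| d.
    by rewrite (le_trans (dP _ _ x01 xy))// lerDl mulr_ge0// sqr_ge0.
  rewrite (le_trans (ler_normB _ _))//; have h1 := cM _ x01; have h2 := cM _ y01.
  suff : 2 * M <= K * (x - y) ^+ 2 by lra.
  rewrite /K mulrAC -mulrA ler_peMr ?mulr_ge0// ler_pdivlMr ?exprn_gt0// mul1r.
  rewrite -[leRHS]real_normK ?num_real//; have := normr_ge0 (x - y).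
  by move: `|x - y| xy => z; nra.
pose N := (Num.truncn (2 * K / e)).+1.
have N0 : 0 < N%:R :> R by rewrite ltr0n.
have NK : K / N%:R <= e / 2.
  rewrite ler_pdivrMr// -ler_pdivrMl ?divr_gt0// ltW//.
  rewrite (_ : _ * K = 2 * K / e); last by field; lra.
  exact: truncnS_gt.
exists (bern N (fun i => f (i%:R / N%:R))) => x x01.
have iN i : (i <= N)%N -> 0 <= (i%:R / N%:R : R) <= 1.
  by move=> iN; rewrite divr_ge0//= ler_pdivrMr// mul1r ler_nat.
have q c' : (bern N (fun i => c' + (K / N%:R ^+ 2) * (i%:R - N%:R * x) ^+ 2)).[x]
    <= c' + e / 2.
  rewrite bern_affine bern_sqr subrr expr0n/= addr0 lerD2l.
  have -> : K / N%:R ^+ 2 * (N%:R * x * (1 - x)) = (K / N%:R) * (x * (1 - x)).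
    by move: (N%:R) N0 => z z0; field; rewrite gt_eqF.
  move/andP: x01 => [x0 x1].
  apply: le_trans NK; rewrite -[leRHS]mulr1 ler_wpM2l//; first by rewrite divr_ge0.
  by nra.
have E i : K / N%:R ^+ 2 * (i%:R - N%:R * x) ^+ 2 = K * (x - i%:R / N%:R) ^+ 2.
  by move: (N%:R) N0 => z z0; field; rewrite gt_eqF.
rewrite ler_norml; apply/andP; split.
- rewrite lerBrDl addrC -lerBrDl opprK.
  have := q (f x + e / 2); rewrite -addrA -splitr; apply: le_trans.
  apply: bern_le => // i /iN iN'; rewrite E.
  by have := fK _ _ x01 iN'; rewrite distrC ler_norml; lra.
- rewrite lerBlDr -lerBlDl.
  have := q (- f x + e / 2); rewrite -addrA -splitr => H'.
  suff : - (bern N (fun i => f (i%:R / N%:R))).[x] <= - f x + e by lra.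
  apply: le_trans H'; have := bern_affine N (fun i => f (i%:R / N%:R)) 0 (-1) x.
  rewrite add0r mulN1r => <-; apply: bern_le => // i /iN iN'; rewrite E.
  by have := fK _ _ x01 iN'; rewrite ler_norml; lra.
Qed.

Lemma weierstrass f a b e : a < b -> contR f -> 0 < e ->
  exists p, forall x, a <= x <= b -> `|f x - p.[x]| <= e.
Proof.
move=> ab cf e0; have d0 : 0 < b - a by rewrite subr_gt0.
have cg : contR (fun x => f (a + (b - a) * x)).
  move=> x; apply: (@continuous_comp _ _ _ (fun x => a + (b - a) * x) f); last exact: cf.
  by have : contR (fun x => a + (b - a) * x); [cont|exact].
have [p pP] := weierstrass01 cg e0.
exists (p \Po ((b - a)^-1 *: ('X - a%:P))) => x /andP[ax xb].
have yE : a + (b - a) * ((x - a) / (b - a)) = x by field; rewrite gt_eqF.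
have := pP ((x - a) / (b - a)); rewrite yE horner_comp !hornerE mulrC; apply.
by rewrite mulr_ge0 ?invr_ge0 ?subr_ge0 ?(ltW ab)//= mulrC ler_pdivrMr// mul1r lerD2r.
Qed.

End Weierstrass.

(** * The L2 norm and primitives of orthogonal functions *)

Section L2.
Variables (R : realType) (a b : R).
Hypothesis ab : a < b.
Implicit Types (f g w e : R -> R) (p q : {poly R}) (n : nat) (x t : R).

Let leab := ltW ab.
Notation k := (b - a).
Let k0 : 0 < k. Proof. by rewrite subr_gt0. Qed.

Definition norm2 f := itg a b (fun x => f x ^+ 2).
Definition nrm f := Num.sqrt (norm2 f).

Lemma norm2_ge0 f : contR f -> 0 <= norm2 f.
Proof. by move=> cf; apply: itg_ge0 => //; [cont|move=> *; exact: sqr_ge0]. Qed.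

Lemma nrm_ge0 f : 0 <= nrm f.
Proof. exact: sqrtr_ge0. Qed.

Lemma nrm_sqr f : contR f -> nrm f ^+ 2 = norm2 f.
Proof. by move=> cf; rewrite sqr_sqrtr// norm2_ge0. Qed.

Lemma nrm_norm f : contR f -> nrm (fun x => `|f x|) = nrm f.
Proof.
move=> cf; congr Num.sqrt; apply: (eq_itg leab); [by cont|by cont|] => x _.
by rewrite real_normK ?num_real.
Qed.

Lemma itg_mul_le f g : contR f -> contR g ->
  `|itg a b (fun x => f x * g x)| <= nrm f * nrm g.
Proof.
move=> cf cg; rewrite -(@ler_pXn2r _ 2)// ?nnegrE ?mulr_ge0 ?nrm_ge0//.
rewrite real_normK ?num_real// exprMn !nrm_sqr//; exact: cauchy_schwarz_itg.
Qed.

Lemma itg_norm_mul_le f g : contR f -> contR g ->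
  itg a b (fun x => `|f x| * `|g x|) <= nrm f * nrm g.
Proof.
move=> cf cg; rewrite -(nrm_norm cf) -(nrm_norm cg).
by apply: le_trans (itg_mul_le _ _); [exact: ler_norm|cont|cont].
Qed.

Lemma nrmD f g : contR f -> contR g ->
  nrm (fun x => f x + g x) <= nrm f + nrm g.
Proof.
move=> cf cg; rewrite -(@ler_pXn2r _ 2)// ?nnegrE ?addr_ge0 ?nrm_ge0//.
rewrite nrm_sqr; last by cont.
have -> : norm2 (fun x => f x + g x) =
    norm2 f + norm2 g + 2 * itg a b (fun x => f x * g x).
  rewrite /norm2 -itgZ; [|cont]; rewrite -!itgD; [|cont..].
  by apply: (eq_itg leab); [cont|cont|] => x _; ring.
rewrite sqrrD -!nrm_sqr// addrAC lerD2r lerD2l -[leRHS]mulr_natl ler_pM2l//.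
exact: le_trans (ler_norm _) (itg_mul_le cf cg).
Qed.

Lemma nrm_le f M : contR f -> 0 <= M -> (forall x, a <= x <= b -> `|f x| <= M) ->
  nrm f <= M * Num.sqrt k.
Proof.
move=> cf M0 fM; rewrite -(@ler_pXn2r _ 2)// ?nnegrE ?mulr_ge0 ?sqrtr_ge0//.
rewrite nrm_sqr// exprMn sqr_sqrtr ?(ltW k0)// -itg_cst /norm2; apply: itg_le => //; [cont|cont|].
move=> x /fM h; rewrite -real_normK ?num_real// lerXn2r ?nnegrE//.
Qed.

Lemma itg_norm_le f : contR f -> itg a b (fun x => `|f x|) <= Num.sqrt k * nrm f.
Proof.
move=> cf; have := itg_norm_mul_le (cont_cst 1) cf; rewrite /nrm {1}/norm2.
rewrite expr1n itg_cst mul1r (eq_itg (g := fun x => `|f x|) leab)//; [cont|cont|].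
by move=> x _; rewrite normr1 mul1r.
Qed.

Lemma itg_sub_le x f : a <= x <= b -> contR f ->
  `|itg a x f| <= itg a b (fun y => `|f y|).
Proof.
move=> /andP[ax xb] cf; apply: (le_trans (itg_norm ax cf)).
rewrite (itg_split a x b) lerDl; apply: itg_ge0 => //; cont.
Qed.

(** The primitive F vanishes at [a], so F(t)^2 is twice the integral of F f. Thus a factor 1/n
    gained on F in L2 becomes n^(-1/2) in the supremum norm. *)
Lemma prim_sqr_le f t : contR f -> a <= t <= b ->
  itg a t f ^+ 2 <= 2 * (nrm (itg a ^~ f) * nrm f).
Proof.
move=> cf tab; have cF := cont_itg a cf.
have -> : itg a t f ^+ 2 = 2 * itg a t (fun x => itg a x f * f x).
  have := itg_ibp a t (is_prim_itg a cf) (is_prim_itg a cf) cf cf.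
  rewrite itgxx mul0r subr0.
  rewrite (_ : (fun x => f x * itg a x f) = (fun x => itg a x f * f x)).
    by move=> E; rewrite expr2; lra.
  by apply/funext => x; rewrite mulrC.
rewrite ler_pM2l// (le_trans (ler_norm _))//.
have cFf : contR (fun x => itg a x f * f x) by cont.
apply: (le_trans (itg_sub_le tab cFf)).
rewrite (eq_itg (g := fun x => `|itg a x f| * `|f x|) leab).
- exact: itg_norm_mul_le.
- by cont.
- by cont.
- by move=> x _; rewrite normrM.
Qed.

Lemma poly_primitive_exists q :
  exists2 Q : {poly R}, Q^`() = q & (size Q <= (size q).+1)%N.
Proof.
exists (\poly_(i < (size q).+1) (q`_i.-1 / i%:R)); last exact: size_poly.
apply/polyP => j; rewrite coef_deriv coef_poly ltnS /=.
have [jq|jq] := ltnP j (size q); last by rewrite mul0rn nth_default.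
by rewrite -[LHS]mulr_natr divfK// pnatr_eq0.
Qed.

Lemma orth_itg0 n e : (0 < n)%N -> contR e -> orth a b n e -> itg a b e = 0.
Proof.
move=> n0 ce eo; have := eo 1; rewrite size_poly1 => /(_ n0) <-.
by apply: (eq_itg leab); [cont|cont|] => x _; rewrite hornerC mulr1.
Qed.

(** Integration by parts against a primitive of the test polynomial: the boundary term vanishes
    because [e] has mean zero, and one degree of orthogonality is spent. *)
Lemma orth_prim n e : contR e -> orth a b n.+1 e -> orth a b n (itg a ^~ e).
Proof.
move=> ce eo q sq; have [Q QE sQ] := poly_primitive_exists q.
have pQ : is_prim (fun x => q.[x]) (fun x => Q.[x]).
  by move=> x; rewrite -QE; exact: is_derive_poly.
rewrite (itg_ibp a b (is_prim_itg a ce) pQ)//; last by cont.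
rewrite (orth_itg0 _ ce eo)// itgxx !mul0r subrr sub0r eo ?oppr0//.
by rewrite (leq_trans sQ)// ltnS.
Qed.

Lemma nrm_prim_le1 e : contR e -> nrm (itg a ^~ e) <= k * nrm e.
Proof.
move=> ce; have cE := cont_itg a ce.
have -> : k * nrm e = Num.sqrt k * nrm e * Num.sqrt k.
  by rewrite mulrAC -expr2 sqr_sqrtr ?(ltW k0).
apply: nrm_le => //; first by rewrite mulr_ge0 ?sqrtr_ge0.
move=> x xab; apply: (le_trans (itg_sub_le xab ce)); exact: itg_norm_le.
Qed.

(** The primitive w is orthogonal to one degree less, so the spectral gap reads (n - 1) n |w|^2 <=
    (k^2 / 4) |p|^2; the claim follows since n^2 <= 2 (n - 1) n for n >= 2. *)
Lemma nrm_poly_prim_le n p : (1 < n)%N -> orth a b n (fun x => p.[x]) ->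
  n%:R * nrm (itg a ^~ (fun x => p.[x])) <= k * nrm (fun x => p.[x]).
Proof.
case: n => [//|[//|n]] _ po; set m := n.+2.
have [W WE _] := poly_primitive_exists p.
have EW : itg a ^~ (fun x => p.[x]) = (fun x => (W - (W.[a])%:P).[x]).
  apply/funext => x; rewrite (@itg_prim _ _ (fun x => W.[x])) ?hornerE//.
  by move=> y; rewrite -WE; exact: is_derive_poly.
have := orth_prim (@cont_horner _ p) po; rewrite EW => /(orth_poly_le ab).
rewrite derivB WE derivC subr0 -/(norm2 _) -/(norm2 _).
set w := (fun x => (W - _).[x]); have cw : contR w by exact: cont_horner.
have cp := @cont_horner _ p; rewrite -!nrm_sqr// => H.
rewrite -(@ler_pXn2r _ 2)// ?nnegrE ?mulr_ge0 ?nrm_ge0 ?(ltW k0)//.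
rewrite !exprMn.
have h1 : m%:R ^+ 2 * nrm w ^+ 2 <= 2 * ((n.+1 * n.+2)%:R * nrm w ^+ 2).
  rewrite mulrA ler_wpM2r ?sqr_ge0// -natrX -natrM ler_nat expnS expn1 mulnA.
  by rewrite leq_mul2r mul2n -addnn addSn ltnS leq_addl orbT.
have h2 := sqr_ge0 (nrm (fun x => p.[x])).
have h3 := mulr_ge0 (sqr_ge0 k) h2.
rewrite /w in h1 H *; lra.
Qed.

(* Jackson's estimate for primitives: duality and density reduce it to the
   spectral gap of the Legendre operator on polynomials. *)
Lemma nrm_prim_le n e : (0 < n)%N -> contR e -> orth a b n e ->
  n%:R * nrm (itg a ^~ e) <= k * nrm e.
Proof.
case: n => [//|[|n]] _ ce eo; first by rewrite mul1r nrm_prim_le1.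
set m := n.+2 in eo *; set s := Num.sqrt k.
have s0 : 0 <= s by exact: sqrtr_ge0.
(* [K] is the total coefficient of the tolerance [h] in the final estimate. *)
pose K := k * s + m%:R * (2 * k * s).
have K0 : 0 <= K by rewrite /K addr_ge0 ?mulr_ge0 ?(ltW k0).
apply/ler_addgt0Pr => d d0; pose h := d / (K + 1).
have h0 : 0 < h by rewrite divr_gt0// ltr_wpDl.
have hK : h * K <= d.
  by rewrite /h mulrAC ler_pdivrMr ?ltr_wpDl// ler_pM2l// lerDl.
(* [P] approximates [e] within [h], and removing its projection [Q] restores the orthogonality. [Q]
   is small because the projection of [e] itself is zero. *)
have [P PP] := weierstrass ab ce h0.
have [Q sQ QP] := proj_exists ab m (@cont_horner _ P).
have cP := @cont_horner _ P; have cQ := @cont_horner _ Q.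
have neP : nrm (fun x => e x - P.[x]) <= h * s.
  by apply: nrm_le => //; [cont|exact: ltW].
have nP : nrm (fun x => P.[x]) <= nrm e + h * s.
  have -> : (fun x => P.[x]) = (fun x => e x + - (e x - P.[x])).
    by apply/funext => x; rewrite opprB addrC subrK.
  apply: (le_trans (nrmD _ _)); [cont|cont|].
  rewrite lerD2l; apply: le_trans neP; rewrite /nrm /norm2.
  by under [X in itg _ _ X]funext do rewrite sqrrN.
have PQ : itg a b (fun x => P.[x] * Q.[x]) = norm2 (fun x => Q.[x]).
  have := QP Q sQ; rewrite (eq_itg (g := fun x => P.[x] * Q.[x] - Q.[x] ^+ 2) leab).
  - by rewrite itgB; [rewrite /norm2; lra|cont|cont].
  - by cont.
  - by cont.
  - by move=> x _; ring.
have nPQ : nrm (fun x => P.[x] - Q.[x]) <= nrm (fun x => P.[x]).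
  rewrite /nrm ler_sqrt ?norm2_ge0//.
  have -> : norm2 (fun x => P.[x]) =
      norm2 (fun x => P.[x] - Q.[x]) + norm2 (fun x => Q.[x]).
    have -> : norm2 (fun x => P.[x] - Q.[x]) = norm2 (fun x => P.[x]) +
       norm2 (fun x => Q.[x]) - 2 * itg a b (fun x => P.[x] * Q.[x]).
      rewrite /norm2 -itgZ; [|cont]; rewrite -itgD; [|cont..].
      rewrite -itgB; [|cont..].
      by apply: (eq_itg leab); [cont|cont|] => x _; ring.
    by rewrite PQ; lra.
  by rewrite lerDl norm2_ge0.
have nQ : nrm (fun x => Q.[x]) <= h * s.
  have [->|Q0] := eqVneq (nrm (fun x => Q.[x])) 0; first by rewrite mulr_ge0 ?(ltW h0).
  have {}Q0 : 0 < nrm (fun x => Q.[x]) by rewrite lt0r Q0 nrm_ge0.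
  rewrite -(ler_pM2r Q0) -expr2 nrm_sqr// -PQ.
  have -> : itg a b (fun x => P.[x] * Q.[x]) =
      - itg a b (fun x => (e x - P.[x]) * Q.[x]).
    have -> : itg a b (fun x => (e x - P.[x]) * Q.[x]) =
        itg a b (fun x => e x * Q.[x]) - itg a b (fun x => P.[x] * Q.[x]).
      rewrite -itgB; [|cont..]; apply: (eq_itg leab); [cont|cont|] => x _; ring.
    by rewrite eo// sub0r opprK.
  rewrite (le_trans (ler_norm _))// normrN (le_trans (itg_mul_le _ _))//; [cont|].
  by rewrite ler_pM2r.
set w := itg a ^~ (fun x => (P - Q).[x]).
have cPQ := @cont_horner _ (P - Q).
have PQE : (fun x => (P - Q).[x]) = (fun x => P.[x] - Q.[x]).
  by apply/funext => x; rewrite hornerD hornerN.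
have nw : m%:R * nrm w <= k * (nrm e + h * s).
  apply: (le_trans (nrm_poly_prim_le _ _)) => //; first by rewrite PQE.
  by rewrite ler_pM2l// PQE (le_trans nPQ).
have nE : nrm (itg a ^~ e) <= nrm w + 2 * k * h * s.
  have cE := cont_itg a ce; have cw : contR w by apply: cont_itg.
  have -> : itg a ^~ e = (fun x => w x + (itg a x e - w x)).
    by apply/funext => x; rewrite addrC subrK.
  apply: (le_trans (nrmD _ _)); [cont|cont|].
  rewrite lerD2l; apply: nrm_le; [cont|by rewrite mulr_ge0 ?(ltW h0)// mulr_ge0 ?(ltW k0)|] => x xab.
  rewrite /w -itgB; [|cont|by []].
  have c1 : contR (fun x => e x - (P - Q).[x]) by cont.
  apply: (le_trans (itg_sub_le xab c1)).
  have c2 : contR (fun x => `|e x - P.[x]| + `|Q.[x]|) by cont.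
  apply: (@le_trans _ _ (itg a b (fun x => `|e x - P.[x]| + `|Q.[x]|))).
    apply: itg_le => //; first by cont.
    move=> y _; rewrite hornerD hornerN opprB addrA addrAC; exact: ler_normD.
  rewrite itgD; [|cont..].
  have i1 : itg a b (fun x => `|e x - P.[x]|) <= h * k.
    by rewrite -itg_cst; apply: itg_le => //; cont.
  have i2 := itg_norm_le cQ.
  have i3 : s * nrm (fun x => Q.[x]) <= h * k.
    apply: (@le_trans _ _ (s * (h * s))); first by rewrite ler_wpM2l.
    by rewrite mulrCA -expr2 sqr_sqrtr ?(ltW k0).
  rewrite -/s in i2; lra.
have m0 : 0 <= m%:R :> R by [].
have := ler_wpM2l m0 nE; rewrite /K in hK; lra.
Qed.

Lemma prim_sup_le n e t : (0 < n)%N -> contR e -> orth a b n e -> a <= t <= b ->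
  itg a t e ^+ 2 <= 2 * (k / n%:R) * norm2 e.
Proof.
move=> n0 ce eo tab; apply: (le_trans (prim_sqr_le ce tab)).
rewrite -nrm_sqr// -mulrA ler_pM2l// expr2 mulrA ler_wpM2r ?nrm_ge0//.
rewrite mulrAC ler_pdivlMr ?ltr0n// mulrC; exact: nrm_prim_le.
Qed.

(** The first primitive is orthogonal to one degree less, whence the factor with [n.-1]; its own L2
    norm supplies a further k/n. *)
Lemma prim2_sup_le n e t : (1 < n)%N -> contR e -> orth a b n e -> a <= t <= b ->
  itg a t (itg a ^~ e) ^+ 2 <= 2 * (k / n.-1%:R) * (k / n%:R) ^+ 2 * norm2 e.
Proof.
case: n => [//|[//|n]] _ ce eo tab; have cE := cont_itg a ce.
apply: (le_trans (prim_sup_le _ cE (orth_prim ce eo) tab)) => //.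
rewrite -[leRHS]mulrA ler_wpM2l//; first by rewrite mulr_ge0// divr_ge0// (ltW k0).
rewrite -!nrm_sqr// -exprMn ler_pXn2r// ?nnegrE ?mulr_ge0 ?nrm_ge0 ?divr_ge0 ?(ltW k0)//.
by rewrite mulrAC ler_pdivlMr ?ltr0n// mulrC; exact: nrm_prim_le.
Qed.

End L2.

(** * L2 projections and increments of functions *)

Section L2Aux.
Variables (R : realType) (a b : R).
Hypothesis ab : a < b.
Implicit Types (f g w e : R -> R) (p q : {poly R}) (n : nat) (x t : R).

Let leab := ltW ab.
Notation k := (b - a).
Notation nrm := (nrm a b).
Let k0 : 0 < k. Proof. by rewrite subr_gt0. Qed.

Lemma le_nrm f g : contR f -> contR g -> (forall x, a <= x <= b -> `|f x| <= g x) ->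
  nrm f <= nrm g.
Proof.
move=> cf cg fg; rewrite ler_sqrt; last exact: norm2_ge0.
apply: itg_le => //; [cont|cont|] => x /fg h.
by rewrite -real_normK ?num_real// lerXn2r ?nnegrE// (le_trans _ h).
Qed.

Lemma nrmZ c f : contR f -> nrm (fun x => c * f x) = `|c| * nrm f.
Proof.
move=> cf; rewrite /nrm /norm2; under [X in itg _ _ X]funext do rewrite exprMn.
by rewrite itgZ; [|cont]; rewrite sqrtrM ?sqr_ge0// sqrtr_sqr.
Qed.

Lemma proj_sub_nrm_le n f q : contR f -> (size q <= n)%N ->
  orth a b n (fun x => f x - q.[x]) ->
  nrm (fun x => f x - q.[x]) <= nrm f /\ nrm (fun x => q.[x]) <= nrm f.
Proof.
move=> cf sq fo; have cq := cont_horner q.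
have E0 : itg a b (fun x => (f x - q.[x]) * q.[x]) = 0 by exact: fo.
have E : norm2 a b f =
    norm2 a b (fun x => f x - q.[x]) + norm2 a b (fun x => q.[x]).
  rewrite -[RHS]addr0 -(mulr0 2) -E0 /norm2 -itgZ; [|cont]; rewrite -!itgD; [|cont..].
  by apply: (eq_itg leab); [cont|cont|] => x _; ring.
have h1 : 0 <= norm2 a b (fun x => f x - q.[x]) by apply: norm2_ge0; cont.
have h2 : 0 <= norm2 a b (fun x => q.[x]) by apply: norm2_ge0; cont.
by split; apply: ler_wsqrtr; rewrite E; lra.
Qed.

(** A mean value estimate without derivatives: over [m] equal pieces the quadratic terms add up to C
    (x - a)^2 / m, which is made arbitrarily small. *)
Lemma increment_le (Phi : R -> R) A C x : 0 <= A -> 0 <= C -> a <= x <= b ->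
  (forall s t, a <= s -> s <= t -> t <= b ->
     `|Phi t - Phi s| <= A * (t - s) + C * (t - s) ^+ 2) ->
  `|Phi x - Phi a| <= A * (x - a).
Proof.
move=> A0 C0 /andP[ax xb] H; apply/ler_addgt0Pr => d d0.
pose m := (Num.truncn (C * (x - a) ^+ 2 / d)).+1.
have m0 : 0 < m%:R :> R by rewrite ltr0n.
pose h := (x - a) / m%:R; have h0 : 0 <= h by rewrite divr_ge0 ?subr_ge0 ?(ltW m0).
have hm : m%:R * h = x - a by rewrite mulrC divfK// gt_eqF.
have S i : (i <= m)%N -> `|Phi (a + i%:R * h) - Phi a| <= i%:R * (A * h + C * h ^+ 2).
  elim: i => [|i IH] im; first by rewrite !mul0r addr0 subrr normr0.
  have ih0 : 0 <= i%:R * h by rewrite mulr_ge0.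
  have imh : i.+1%:R * h <= x - a by rewrite -hm ler_wpM2r// ler_nat.
  have := H (a + i%:R * h) (a + i.+1%:R * h).
  rewrite -natr1 in imh *.
  have -> : a + (i%:R + 1) * h - (a + i%:R * h) = h by ring.
  move=> /(_ ltac:(lra) ltac:(lra) ltac:(lra)) H1.
  have := ler_normD (Phi (a + (i%:R + 1) * h) - Phi (a + i%:R * h))
    (Phi (a + i%:R * h) - Phi a).
  rewrite subrKA => /le_trans; apply.
  by have := IH (ltnW im); lra.
have := S m (leqnn _); rewrite hm.
have -> : a + (x - a) = x by ring.
move=> /le_trans; apply.
have -> : m%:R * (A * h + C * h ^+ 2) = A * (x - a) + C * (x - a) * h.
  by rewrite -hm; ring.
rewrite lerD2l /h mulrA ler_pdivrMr// -mulrA -expr2 -ler_pdivrMl// mulrC ltW//.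
exact: truncnS_gt.
Qed.

(* Summation by parts for a coefficient that is only Lipschitz. *)
Lemma itg_lipschitz_le f g Lf S x : contR f -> contR g -> 0 <= Lf ->
  (forall y z, a <= y <= b -> a <= z <= b -> `|f y - f z| <= Lf * `|y - z|) ->
  (forall y, a <= y <= b -> `|itg a y g| <= S) -> a <= x <= b ->
  `|itg a x (fun y => f y * g y) - f x * itg a x g| <= Lf * S * (x - a).
Proof.
move=> cf cg Lf0 fL gS xab.
have aab : a <= a <= b by rewrite lexx.
have S0 : 0 <= S by apply: le_trans (gS a aab).
have [c _ cM] := @EVT_max R (fun x => `|g x|) a b leab
  (continuous_subspaceT (cont_norm cg)).
have {}cM y : a <= y <= b -> `|g y| <= `|g c| by move=> ?; apply: cM; rewrite in_itv.
pose Phi y := itg a y (fun y => f y * g y) - f y * itg a y g.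
have := @increment_le Phi (Lf * S) (Lf * `|g c|) x.
have -> : Phi a = 0 by rewrite /Phi !itgxx mulr0 subrr.
rewrite subr0; apply; rewrite ?mulr_ge0// => s t sa st tb.
have sab : a <= s <= b by rewrite sa (le_trans st).
have tab : a <= t <= b by rewrite tb (le_trans sa).
(* The first term is quadratic in t - s, by the Lipschitz bound on [f] and the crude bound on [g],
   and disappears under subdivision. Only the second, of size Lf S (t - s), survives. *)
have E : Phi t - Phi s =
    itg s t (fun y => (f y - f t) * g y) + (f s - f t) * itg a s g.
  have -> : itg s t (fun y => (f y - f t) * g y) =
      itg s t (fun y => f y * g y) - f t * itg s t g.
    rewrite -itgZ// -itgB; [|cont..].
    by apply: (eq_itg st); [cont|cont|] => y _; ring.
  by rewrite /Phi (itg_split a s t) (itg_split a s t g); ring.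
rewrite E addrC (le_trans (ler_normD _ _))// lerD//.
  rewrite normrM (le_trans (ler_pM _ _ (fL _ _ sab tab) (gS _ sab)))//.
  by rewrite distrC ger0_norm ?subr_ge0// mulrAC.
rewrite expr2 mulrA mulrAC [X in X * _]mulrAC; apply: itg_bound => //; first by cont.
move=> y /andP[sy yt]; have yab : a <= y <= b by rewrite (le_trans sa)// (le_trans yt).
rewrite normrM mulrC [leRHS](_ : _ = `|g c| * (Lf * (t - s))); last by ring.
rewrite ler_pM//; first exact: cM.
apply: (le_trans (fL _ _ yab tab)); rewrite ler_wpM2l// distrC ger0_norm ?subr_ge0//.
by rewrite lerD2l lerN2.
Qed.

End L2Aux.

(** * The error on one interval *)

Section Step.
Variables (R : realType) (a b : R) (F : R -> R -> R -> R) (L C2 M Mb Lb : R).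
Variables (u u1 u2 bb : R -> R) (p q0 : {poly R}) (n : nat).
Notation k := (b - a).
Hypotheses (ab : a < b) (n1 : (1 < n)%N) (k1 : k <= 1) (kL : k * (L + 1) <= 1 / 2).
Hypotheses (L0 : 0 <= L) (C20 : 0 <= C2) (M0 : 0 <= M) (Mb0 : 0 <= Mb) (Lb0 : 0 <= Lb).
Hypotheses (uP : is_prim u1 u) (u1P : is_prim u2 u1) (cu2 : contR u2).
Hypothesis u2E : forall x, a <= x <= b -> u2 x = F x (u x) (u1 x).
Hypothesis FL : forall x y1 z1 y2 z2, a <= x <= b ->
  `|F x y1 z1 - F x y2 z2| <= L * (`|y1 - y2| + `|z1 - z2|).
Hypothesis cF : forall v w, contR v -> contR w -> contR (fun x => F x (v x) (w x)).
Hypothesis u2M : forall x, a <= x <= b -> `|u2 x| <= M.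
Hypothesis lin : forall x y z, a <= x <= b -> `|y| <= 2 * M -> `|z| <= 2 * M ->
  `|F x (u x) (u1 x) - F x (u x - y) (u1 x - z) - bb x * z| <=
  L * `|y| + C2 * (`|y| + `|z|) * `|z|.
Hypotheses (cbb : contR bb) (bbM : forall x, a <= x <= b -> `|bb x| <= Mb).
Hypothesis bbL : forall x y, a <= x <= b -> a <= y <= b ->
  `|bb x - bb y| <= Lb * `|x - y|.
Hypothesis sp : (size (p^`()^`()) <= n)%N.
Hypothesis po : orth a b n (fun x => F x p.[x] p^`().[x] - p^`()^`().[x]).
Hypothesis sq0 : (size q0 <= n)%N.
Hypothesis q0o : orth a b n (fun x => u2 x - q0.[x]).

Let leab := ltW ab.
Let k0 : 0 < k. Proof. by rewrite subr_gt0. Qed.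
Let n0 : 0 < n%:R :> R. Proof. by rewrite ltr0n ltnW. Qed.
Notation nrm := (nrm a b).

Definition step_rho x := u2 x - q0.[x].
Notation rho := step_rho.
Let X := Num.sqrt (k / n%:R).
Let s := Num.sqrt k.
Let N := nrm rho.
Let R1 := itg a ^~ rho.
Let R0 := itg a ^~ R1.

(** The scale (k/n)^(3/2) |rho| to which all contributions of the step are compared. *)
Definition step_alpha := Num.sqrt (k / n%:R) ^+ 3 * nrm rho.
Notation a0 := step_alpha.
(** The terms with [L] and [C2] come from the remainder of the linearisation, those with [Mb] and
    [Lb] from its leading part; the final 1 gives [a0 <= D * a0], which absorbs R0. *)
Definition step_const := 2 * L + 4 * C2 * M + 2 * C2 * M + 4 * Mb + 2 * Lb + 1.
Notation D := step_const.

Let X0 : 0 <= X. Proof. exact: sqrtr_ge0. Qed.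
Let s0 : 0 <= s. Proof. exact: sqrtr_ge0. Qed.
Let N0 : 0 <= N. Proof. exact: nrm_ge0. Qed.
Let X2 : X ^+ 2 = k / n%:R. Proof. by rewrite sqr_sqrtr// divr_ge0 ?(ltW k0)// ltW. Qed.
Let s2 : s ^+ 2 = k. Proof. by rewrite sqr_sqrtr// ltW. Qed.
Let a0_ge0 : 0 <= a0. Proof. by rewrite mulr_ge0 ?exprn_ge0 ?nrm_ge0 ?sqrtr_ge0. Qed.
Let a0E : a0 = X ^+ 3 * N. Proof. by []. Qed.
Let cu1 : contR u1. Proof. exact: is_prim_continuous u1P. Qed.
Let cu : contR u. Proof. exact: is_prim_continuous uP. Qed.
Let crho : contR rho. Proof. by rewrite /rho; cont. Qed.
Let cR1 : contR R1. Proof. exact: cont_itg. Qed.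
Let cR0 : contR R0. Proof. exact: cont_itg. Qed.
Let R1P : is_prim rho R1. Proof. exact: is_prim_itg. Qed.
Let R0P : is_prim R1 R0. Proof. exact: is_prim_itg. Qed.
Let aab : a <= a <= b. Proof. by rewrite lexx. Qed.
Let bab : a <= b <= b. Proof. by rewrite lexx andbT. Qed.

Let X1 : X ^+ 2 <= 1.
Proof.
rewrite X2 ler_pdivrMr// mul1r (le_trans k1)// ler1n ltnW//.
Qed.

Let NM : N <= M * s.
Proof.
apply: (le_trans (proj1 (proj_sub_nrm_le ab cu2 sq0 q0o))).
exact: nrm_le.
Qed.

Let N2 : N ^+ 2 = norm2 a b rho. Proof. exact: nrm_sqr. Qed.

Let R1_sup x : a <= x <= b -> `|R1 x| <= 2 * (X * N).
Proof.
move=> xab; rewrite -(@ler_pXn2r _ 2)// ?nnegrE ?mulr_ge0//.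
rewrite real_normK ?num_real//.
apply: (le_trans (prim_sup_le ab (ltnW n1) crho q0o xab)).
rewrite -N2 -X2 !exprMn; have := mulr_ge0 (sqr_ge0 X) (sqr_ge0 N).
lra.
Qed.

Let R0_sup x : a <= x <= b -> `|R0 x| <= 2 * a0.
Proof.
move=> xab; rewrite -(@ler_pXn2r _ 2)// ?nnegrE ?mulr_ge0//.
rewrite real_normK ?num_real//.
apply: (le_trans (prim2_sup_le ab n1 crho q0o xab)).
have kn : k / n.-1%:R <= 2 * X ^+ 2.
  have m0 : 0 < n.-1%:R :> R by rewrite ltr0n -subn1 subn_gt0.
  rewrite X2 ler_pdivrMr// (_ : 2 * (k / n%:R) * n.-1%:R = k * (2 * n.-1%:R) / n%:R); last by ring.
  rewrite ler_pdivlMr// ler_pM2l// -natrM ler_nat.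
  case: (n) n1 => [//|[//|j]] _ /=.
  by rewrite mul2n -addnn addSn ltnS leq_addl.
rewrite -N2 -X2 (_ : (2 * a0) ^+ 2 = 2 * (2 * X ^+ 2) * (X ^+ 2) ^+ 2 * N ^+ 2); last first.
  by rewrite a0E; ring.
rewrite ler_wpM2r ?sqr_ge0// ler_wpM2r ?sqr_ge0// ler_wpM2l//.
Qed.

Let R1_nrm : nrm R1 <= X ^+ 2 * N.
Proof.
rewrite X2 mulrAC ler_pdivlMr// mulrC.
exact: (nrm_prim_le ab (ltnW n1) crho q0o).
Qed.

Let XN : X * N <= M.
Proof.
have h : X <= 1 by rewrite -(@ler_pXn2r _ 2)// ?nnegrE// expr1n.
have s1 : s <= 1 by rewrite -(@ler_pXn2r _ 2)// ?nnegrE// expr1n s2.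
apply: (@le_trans _ _ (1 * (M * 1))); last by rewrite mul1r mulr1.
by rewrite ler_pM// (le_trans NM)// ler_wpM2l.
Qed.

Let a0M : a0 <= M.
Proof.
rewrite a0E (_ : _ * _ = X ^+ 2 * (X * N)); last by ring.
rewrite -[leRHS]mul1r; apply: ler_pM => //; first exact: sqr_ge0.
exact: mulr_ge0.
Qed.

Let R1b : R1 b = 0.
Proof. exact: (orth_itg0 ab (ltnW n1) crho q0o). Qed.

Let R1a : R1 a = 0. Proof. by rewrite /R1 itgxx. Qed.
Let R0a : R0 a = 0. Proof. by rewrite /R0 itgxx. Qed.

Let R0b : R0 b = 0.
Proof.
case: (n) n1 q0o => [//|m] m1 mo.
exact: (orth_itg0 ab _ cR1 (orth_prim ab crho mo)).
Qed.

(** [h] is the leading part of the linearisation, estimated through its primitive; the remainder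
    [q1] is already small enough in L2. *)
Let h x := bb x * R1 x.
Let q1 x := F x (u x) (u1 x) - F x (u x - R0 x) (u1 x - R1 x) - h x.

Let ch : contR h. Proof. by rewrite /h; cont. Qed.
Let cq1 : contR q1.
Proof.
rewrite /q1; apply: contB => //; apply: contB; apply: cF => //; exact: contB.
Qed.

(** In the terms containing R0 the bound 2 a0 suffices. In the term quadratic in R1 one factor is
    bounded uniformly by 2 X N and the other in L2 by X^2 N; their product is 2 a0 N, and N <= M
    s. *)
Let q1_nrm : nrm q1 <= s * (2 * L + 4 * C2 * M + 2 * C2 * M) * a0.
Proof.
apply: (@le_trans _ _ (nrm (fun x => (2 * a0 * (L + 2 * M * C2)) + C2 * (2 * (X * N)) * `|R1 x|))).
  apply: (le_nrm ab) => //; first by cont.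
  move=> x xab; have h0 := R0_sup xab; have h1 := R1_sup xab.
  apply: (le_trans (lin xab _ _)).
  - by apply: (le_trans h0); rewrite ler_pM2l.
  - by apply: (le_trans h1); rewrite ler_pM2l.
  - have g1 := ler_wpM2l L0 h0.
    have r1 : `|R1 x| <= 2 * M by apply: (le_trans h1); rewrite ler_pM2l.
    have g2 : `|R0 x| * `|R1 x| <= 2 * a0 * (2 * M) by rewrite ler_pM.
    have g3 : `|R1 x| * `|R1 x| <= 2 * (X * N) * `|R1 x| by rewrite ler_wpM2r.
    have g4 := ler_wpM2l C20 g2; have g5 := ler_wpM2l C20 g3.
    by lra.
apply: (le_trans (nrmD ab _ _)); [cont|cont|].
rewrite nrmZ; [|cont]; rewrite nrm_norm//.
have h1 : nrm (fun=> 2 * a0 * (L + 2 * M * C2)) <= 2 * a0 * (L + 2 * M * C2) * s.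
  apply: nrm_le; [by []|cont| |].
    by rewrite mulr_ge0 ?mulr_ge0// addr_ge0// !mulr_ge0.
  move=> x _; rewrite ger0_norm//.
  by rewrite mulr_ge0 ?mulr_ge0// addr_ge0// !mulr_ge0.
have XN0 : 0 <= X * N by rewrite mulr_ge0.
have c0 : 0 <= C2 * (2 * (X * N)) by rewrite mulr_ge0 ?mulr_ge0.
rewrite (ger0_norm c0).
have h2 : C2 * (2 * (X * N)) * nrm R1 <= C2 * 2 * a0 * (M * s).
  apply: (@le_trans _ _ (C2 * (2 * (X * N)) * (X ^+ 2 * N))).
    by rewrite ler_wpM2l.
  rewrite a0E (_ : _ * _ = C2 * 2 * (X ^+ 3 * N) * N); last by ring.
  by rewrite ler_wpM2l// -?a0E !mulr_ge0.
lra.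
Qed.

Let orth_small f (q : {poly R}) x : contR f -> (size q <= n)%N ->
  orth a b n (fun x => f x - q.[x]) -> a <= x <= b ->
  `|itg a x (fun y => q.[y])| <= s * nrm f.
Proof.
move=> cf sq fo xab; have cq := cont_horner q.
apply: (le_trans (itg_sub_le xab cq)); apply: (le_trans (itg_norm_le ab cq)).
by rewrite ler_wpM2l//; case: (proj_sub_nrm_le ab cf sq fo).
Qed.

(** R0 is the primitive of R1, so summation by parts leaves the boundary term [bb x * R0 x] and a
    rest carrying the factor k. *)
Let bb_sup x : a <= x <= b -> `|itg a x h - bb x * R0 x| <= k * (2 * Lb) * a0.
Proof.
move=> xab; apply: (le_trans (itg_lipschitz_le ab cbb cR1 Lb0 bbL R0_sup xab)).
have h1 : x - a <= k by move: xab => /andP[_ ?]; rewrite lerD2r.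
rewrite (_ : k * (2 * Lb) * a0 = Lb * (2 * a0) * k); last by ring.
by rewrite ler_wpM2l// !mulr_ge0.
Qed.

Let h_nrm : nrm h <= Mb * (X ^+ 2 * N).
Proof.
apply: (@le_trans _ _ (nrm (fun x => Mb * `|R1 x|))).
  apply: (le_nrm ab) => //; first by cont.
  by move=> x xab; rewrite normrM ler_wpM2r// bbM.
rewrite nrmZ; [|cont]; rewrite nrm_norm// ger0_norm//.
by rewrite ler_wpM2l.
Qed.

Definition step_e x := u x - p.[x].
Definition step_e1 x := u1 x - p^`().[x].
Notation e := step_e.
Notation e1 := step_e1.
Let y := `|e a| + `|e1 a|.
(** [de] is delta, with derivative [de1] and polynomial second derivative [G]. As R0 and R1 vanish
    at both ends, delta and delta' agree there with the error and its derivative. *)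
Let de x := e x - R0 x.
Let de1 x := e1 x - R1 x.
Let G := q0 - p^`()^`().

Let e1P : is_prim (fun x => u2 x - p^`()^`().[x]) e1.
Proof. by apply: is_primB => // x; exact: is_derive_poly. Qed.
Let eP : is_prim e1 e.
Proof. by apply: is_primB => // x; exact: is_derive_poly. Qed.
Let de1P : is_prim (fun x => G.[x]) de1.
Proof.
have -> : (fun x => G.[x]) = (fun x => (u2 x - p^`()^`().[x]) - rho x).
  by apply/funext => x; rewrite /G /rho hornerD hornerN; ring.
exact: is_primB.
Qed.
Let deP : is_prim de1 de.
Proof. exact: is_primB. Qed.
Let cde1 : contR de1. Proof. exact: is_prim_continuous de1P. Qed.
Let cde : contR de. Proof. exact: is_prim_continuous deP. Qed.

Let g2 x := F x (u x - R0 x) (u1 x - R1 x) - F x p.[x] p^`().[x].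
Let cg2 : contR g2.
Proof.
rewrite /g2; apply: contB; apply: cF; [exact: contB|exact: contB|cont|cont].
Qed.

(** The method makes [G] the L2 projection of f(t, u, u') - f(t, U, U') = h + q1 + g2. The three
    projections are estimated separately; that of [g2] is obtained as the remaining part of [G]. *)
Let G_bound : exists G1 Gq G2 : {poly R},
  [/\ forall x, G.[x] = G1.[x] + Gq.[x] + G2.[x],
   (size G1 <= n)%N /\ orth a b n (fun x => h x - G1.[x]),
   (size Gq <= n)%N /\ orth a b n (fun x => q1 x - Gq.[x]) &
   (size G2 <= n)%N /\ orth a b n (fun x => g2 x - G2.[x])].
Proof.
have [G1 s1 o1] := proj_exists ab n ch.
have [Gq sq oq] := proj_exists ab n cq1.
exists G1, Gq, (G - G1 - Gq); split => //.
- by move=> x; rewrite !hornerD !hornerN; ring.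
- split.
    have sG : (size G <= n)%N.
      by rewrite (leq_trans (size_polyD _ _))// size_polyN geq_max sq0.
    rewrite (leq_trans (size_polyD _ _))// size_polyN geq_max sq andbT.
    by rewrite (leq_trans (size_polyD _ _))// size_polyN geq_max s1 andbT.
  move=> r sr; have E1 := o1 r sr; have Eq := oq r sr; have Ep := po sr; have E0 := q0o sr.
  rewrite (eq_itg (g := fun x => (u2 x - q0.[x]) * r.[x] - (F x p.[x] p^`().[x] - p^`()^`().[x]) * r.[x] - ((h x - G1.[x]) * r.[x] + (q1 x - Gq.[x]) * r.[x])) leab).
  + have cFp : contR (fun x => F x p.[x] p^`().[x]) by apply: cF; cont.
    rewrite itgB; [|cont..]; rewrite itgB; [|cont..]; rewrite itgD; [|cont..].
    by rewrite E1 Eq Ep E0 addr0 !subr0.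
  + by cont.
  + have cFp : contR (fun x => F x p.[x] p^`().[x]) by apply: cF; cont.
    by cont.
  + by move=> x xab; rewrite /g2 /q1 (u2E xab) /G !hornerD !hornerN; ring.
Qed.

(** Two bounds of different strength: inside the interval the increment of delta' is of order a0,
    whereas at the right end it is of order k a0. Only the latter is accumulated from node to
    node. *)
Let de1_bound Md : (forall x, a <= x <= b -> `|de x| + `|de1 x| <= Md) ->
  (forall x, a <= x <= b -> `|de1 x - de1 a| <= D * a0 + k * L * Md) /\
  `|de1 b - de1 a| <= k * (D * a0) + k * L * Md.
Proof.
move=> HM; have [G1 [Gq [G2 [GE [s1 o1] [sq oq] [s2' o2]]]]] := G_bound.
have Md0 : 0 <= Md by apply: le_trans (HM a aab); rewrite addr_ge0.
have E x : de1 x - de1 a = itg a x (fun y => G1.[y]) + itg a x (fun y => Gq.[y]) +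
    itg a x (fun y => G2.[y]).
  rewrite -(itg_prim a x de1P) -itgD; [|cont..]; rewrite -itgD; [|cont..].
  by congr itg; apply/funext => z; exact: GE.
have Bq x : a <= x <= b -> `|itg a x (fun y => Gq.[y])| <=
    k * (2 * L + 4 * C2 * M + 2 * C2 * M) * a0.
  move=> xab; apply: (le_trans (orth_small cq1 sq oq xab)).
  apply: (le_trans (ler_wpM2l s0 q1_nrm)).
  by rewrite -s2 expr2 -!mulrA.
have B2 x : a <= x <= b -> `|itg a x (fun y => G2.[y])| <= k * L * Md.
  move=> xab; apply: (le_trans (orth_small cg2 s2' o2 xab)).
  rewrite -s2 expr2 -!mulrA ler_wpM2l// mulrC; apply: nrm_le => //.
    exact: mulr_ge0.
  move=> z zab; apply: (le_trans (FL _ _ _ _ zab)); rewrite ler_wpM2l//.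
  apply: le_trans (HM z zab); rewrite /de /de1 /e /e1.
  by rewrite [u z - R0 z - _]addrAC [u1 z - R1 z - _]addrAC.
(* [h - G1] has mean zero, so G1 and h have the same integral over the interval, and the boundary
   term in the primitive of h vanishes with R0 at b. *)
have B1b : `|itg a b (fun y => G1.[y])| <= k * (2 * Lb) * a0.
  have := orth_itg0 ab (ltnW n1) _ o1; rewrite itgB; [|cont..].
  have c : contR (fun x => h x - G1.[x]) by cont.
  move=> /(_ c) /eqP; rewrite subr_eq0 => /eqP <-.
  by have := bb_sup bab; rewrite R0b mulr0 subr0.
have B1 x : a <= x <= b -> `|itg a x (fun y => G1.[y])| <= (4 * Mb + 2 * Lb) * a0.
  move=> xab.
  have c : contR (fun x => h x - G1.[x]) by cont.
  (* As h - G1 is orthogonal to degrees below [n], its primitive gains the factor X = sqrt(k/n) over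
     its L2 norm, which is at most Mb X^2 N; this gives the order X^3 N = a0. *)
  have d1 : `|itg a x (fun y => h y - G1.[y])| <= 2 * Mb * a0.
    rewrite -(@ler_pXn2r _ 2)// ?nnegrE ?mulr_ge0//.
    rewrite real_normK ?num_real//.
    apply: (le_trans (prim_sup_le ab (ltnW n1) c o1 xab)).
    rewrite -nrm_sqr// -X2.
    have nh : nrm (fun x => h x - G1.[x]) <= Mb * (X ^+ 2 * N).
      by apply: le_trans h_nrm; case: (proj_sub_nrm_le ab ch s1 o1).
    have nh2 : nrm (fun x => h x - G1.[x]) ^+ 2 <= (Mb * (X ^+ 2 * N)) ^+ 2.
      by rewrite ler_pXn2r// ?nnegrE ?nrm_ge0// !mulr_ge0// sqr_ge0.
    apply: (@le_trans _ _ (2 * X ^+ 2 * (Mb * (X ^+ 2 * N)) ^+ 2)).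
      by rewrite ler_wpM2l// mulr_ge0// sqr_ge0.
    have := sqr_ge0 (Mb * a0); rewrite a0E => hh.
    rewrite (_ : 2 * X ^+ 2 * (Mb * (X ^+ 2 * N)) ^+ 2 = 2 * (Mb * (X ^+ 3 * N)) ^+ 2); last by ring.
    rewrite (_ : (2 * Mb * (X ^+ 3 * N)) ^+ 2 = 4 * (Mb * (X ^+ 3 * N)) ^+ 2); last by ring.
    lra.
  have d2 : `|itg a x h| <= (2 * Mb + 2 * Lb) * a0.
    have := ler_normD (itg a x h - bb x * R0 x) (bb x * R0 x); rewrite subrK => /le_trans; apply.
    have d3 : `|bb x * R0 x| <= Mb * (2 * a0).
      by rewrite normrM ler_pM// ?bbM// R0_sup.
    have d4 : k * (2 * Lb) * a0 <= 1 * (2 * Lb * a0) by rewrite -!mulrA ler_wpM2r// !mulr_ge0.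
    have := bb_sup xab; lra.
  have -> : itg a x (fun y => G1.[y]) = itg a x h - itg a x (fun y => h y - G1.[y]).
    by rewrite itgB; [ring|cont..].
  by apply: (le_trans (ler_normB _ _)); lra.
have kq : k * (2 * L + 4 * C2 * M + 2 * C2 * M) * a0 <= (2 * L + 4 * C2 * M + 2 * C2 * M) * a0.
  rewrite -mulrA -[leRHS]mul1r ler_wpM2r// mulr_ge0// !addr_ge0// !mulr_ge0//.
have MA : 0 <= Mb * a0 by rewrite mulr_ge0.
have ka : 0 <= k * a0 by rewrite mulr_ge0 ?(ltW k0).
have kMA : 0 <= Mb * (k * a0) by rewrite mulr_ge0.
split=> [x xab|]; rewrite E.
  apply: (le_trans (ler_normD _ _)); apply: lerD; last exact: B2.
  apply: (le_trans (ler_normD _ _)).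
  have := Bq x xab; have := B1 x xab; have := a0_ge0; rewrite /D; lra.
apply: (le_trans (ler_normD _ _)); apply: lerD; last exact: B2.
apply: (le_trans (ler_normD _ _)).
have := Bq b bab; have := B1b; rewrite /D; lra.
Qed.

(** At b the increments add k (L + 1) Md + k D a0 to y, and Md <= 2 (y + D a0) turns this into the
    factor 2 L + 3. Inside, the error is at most Md + |R0|. *)
Lemma step_bound :
  `|e b| + `|e1 b| <= (1 + k * (2 * L + 3)) * y + k * (2 * L + 3) * (D * a0) /\
  forall x, a <= x <= b -> `|e x| <= 2 * y + 4 * (D * a0).
Proof.
have [c cab cM] := @EVT_max R (fun x => `|de x| + `|de1 x|) a b leab
  (continuous_subspaceT (contD (cont_norm cde) (cont_norm cde1))).
set Md := `|de c| + `|de1 c| in cM.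
have {}cM x : a <= x <= b -> `|de x| + `|de1 x| <= Md by move=> ?; apply: cM; rewrite in_itv.
have {}cab : a <= c <= b by move: cab; rewrite in_itv.
have Md0 : 0 <= Md by apply: le_trans (cM a aab); rewrite addr_ge0.
have [d1 d2] := de1_bound cM.
have d0 x : a <= x <= b -> `|de x - de a| <= k * Md.
  move=> xab; rewrite -(itg_prim a x deP); move: (xab) => /andP[ax xb].
  apply: (@le_trans _ _ (Md * (x - a))).
    apply: itg_bound => // z /andP[az zx].
    apply: le_trans (cM z _); first by rewrite lerDr.
    by rewrite az (le_trans zx).
  by rewrite mulrC ler_wpM2r// lerD2r.
have da : de a = e a by rewrite /de R0a subr0.
have d1a : de1 a = e1 a by rewrite /de1 R1a subr0.
have db : de b = e b by rewrite /de R0b subr0.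
have d1b : de1 b = e1 b by rewrite /de1 R1b subr0.
have tri (v w : R) : `|v| <= `|w| + `|v - w|.
  by have := ler_normD w (v - w); rewrite addrC subrK.
have D0 : 0 <= D * a0.
  rewrite mulr_ge0// /D !addr_ge0// !mulr_ge0//.
(* The increments of delta and delta' give Md <= y + D a0 + k (L + 1) Md; by the smallness of k the
   last term is at most Md / 2 and is absorbed. *)
have Mdle : Md <= 2 * (y + D * a0).
  have t0 := tri (de c) (de a); have t1 := tri (de1 c) (de1 a).
  have w0 := d0 c cab; have w1 := d1 c cab.
  have kM : k * (L + 1) * Md <= 1 / 2 * Md by rewrite ler_wpM2r.
  have yE : y = `|de a| + `|de1 a| by rewrite /y da d1a.
  have MdE : Md = `|de c| + `|de1 c| by [].
  by rewrite yE; move: Md MdE {cM Md0 d1 d2 d0} w0 w1 kM => m; lra.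
have a1D : a0 <= D * a0.
  by rewrite -[leLHS]mul1r ler_wpM2r// /D lerDr !addr_ge0// !mulr_ge0.
split.
  have t0 := tri (de b) (de a); have t1 := tri (de1 b) (de1 a).
  have e0 := d0 b bab; rewrite da d1a db d1b in t0 t1 e0 d2.
  have kMd := ler_wpM2l (mulr_ge0 (ltW k0) (addr_ge0 L0 ler01)) Mdle.
  have ky : 0 <= k * y by rewrite mulr_ge0 ?(ltW k0)// addr_ge0.
  have yE : y = `|e a| + `|e1 a| by [].
  by rewrite yE in ky kMd *; lra.
move=> x xab; have := cM x xab; have := R0_sup xab.
have := ler_normD (de x) (R0 x); rewrite /de subrK.
have := normr_ge0 (de1 x); lra.
Qed.

End Step.

(** * Weak derivatives against polynomials *)

Section Bump.
Variable R : realType.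
Implicit Types (f g v w : R -> R) (a b c x y : R) (p q : {poly R}).

Fixpoint smooth_upto n f : Prop := if n is n'.+1
  then (forall x, derivable f x 1) /\ smooth_upto n' f^`()%classic else True.

Lemma smooth_uptoS n f : smooth_upto n.+1 f -> smooth_upto n f.
Proof. by elim: n f => [//|n IH] f [df sf]; split => //; exact: IH. Qed.

Lemma is_prim_derive1 f F : is_prim f F -> F^`()%classic = f.
Proof. by move=> H; apply/funext => x; rewrite derive1E; case: (H x). Qed.

Lemma derivable_is_prim F : (forall x, derivable F x 1) -> is_prim F^`()%classic F.
Proof. by move=> dF x; rewrite derive1E; exact: DeriveDef. Qed.

Lemma smooth_uptoD n f g : smooth_upto n f -> smooth_upto n g ->
  smooth_upto n (fun x => f x + g x).
Proof.
elim: n f g => [//|n IH] f g [df sf] [dg sg].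
have H : is_prim (fun x => f^`()%classic x + g^`()%classic x) (fun x => f x + g x).
  by move=> x; apply: is_deriveD; exact: derivable_is_prim.
by split; [move=> x; have [] := H x|rewrite (is_prim_derive1 H); exact: IH].
Qed.

Lemma smooth_uptoM n f g : smooth_upto n f -> smooth_upto n g ->
  smooth_upto n (fun x => f x * g x).
Proof.
elim: n f g => [//|n IH] f g sf sg; have [df sf'] := sf; have [dg sg'] := sg.
have H : is_prim (fun x => f x * g^`()%classic x + f^`()%classic x * g x)
    (fun x => f x * g x).
  move=> x; have := is_deriveM (derivable_is_prim df x) (derivable_is_prim dg x).
  by rewrite /GRing.scale/= [g x * _]mulrC.
split; first by move=> x; have [] := H x.
rewrite (is_prim_derive1 H); apply: smooth_uptoD; apply: IH => //; exact: smooth_uptoS.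
Qed.

Lemma smooth_upto_horner n p : smooth_upto n (fun x => p.[x]).
Proof.
elim: n p => [//|n IH] p; have H : is_prim (fun x => p^`().[x]) (fun x => p.[x]).
  by move=> x; exact: is_derive_poly.
by split; [move=> x; have [] := H x|rewrite (is_prim_derive1 H); exact: IH].
Qed.

Lemma is_prim_comp_affine f F c d : is_prim f F ->
  is_prim (fun x => c * f (c * x + d)) (fun x => F (c * x + d)).
Proof.
move=> H x.
have dl : is_derive x (1:R) (fun x => c * x + d) c.
  rewrite -[X in is_derive _ _ _ X]addr0; apply: is_deriveD.
  by rewrite -[X in is_derive _ _ _ X]mulr1; apply: (@is_deriveZ _ _ _ id).
by rewrite mulrC; exact: (@is_derive1_comp _ F (fun x => c * x + d) x _ _ (H (c * x + d)) dl).
Qed.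

Lemma smooth_upto_comp_affine n f c d : smooth_upto n f ->
  smooth_upto n (fun x => f (c * x + d)).
Proof.
elim: n f => [//|n IH] f [df sf].
have H := is_prim_comp_affine c d (derivable_is_prim df).
split; first by move=> x; have [] := H x.
rewrite (is_prim_derive1 H); apply: smooth_uptoM; last exact: IH.
have := smooth_upto_horner n c%:P; congr smooth_upto.
by apply/funext => x; rewrite hornerC.
Qed.

Lemma smooth_upto_derivable n f : smooth_upto n.+1 f ->
  forall x, derivable (derive1n n f) x 1.
Proof.
by elim: n f => [|n IH] f [df sf] x; [exact: df|rewrite derive1Sn; exact: IH].
Qed.

(** The classical smooth flat function, with a polynomial factor in 1/x: this family is closed under
    differentiation, so that smoothness follows by induction. *)
Definition psi p x := if 0 < x then p.[x^-1] * expR (- x^-1) else 0.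

Lemma psi_le0 p x : x <= 0 -> psi p x = 0.
Proof. by rewrite /psi; case: ltP. Qed.

(** Induction on the Horner form, with [c] general: half of the exponential rate absorbs the factor
    y, the other half the shorter polynomial. *)
Lemma horner_expR_bound p c : 0 < c -> exists2 K : R, 0 <= K &
  forall y, 0 <= y -> `|p.[y]| <= K * expR (c * y).
Proof.
elim/poly_ind: p c => [|p d IH] c c0.
  by exists 0 => // y _; rewrite horner0 normr0 mul0r.
have c2 : 0 < c / 2 by rewrite divr_gt0.
have [K K0 HK] := IH _ c2.
exists (K * (2 / c) + `|d|) => [|y y0].
  by rewrite addr_ge0// mulr_ge0// divr_ge0// ltW.
have h1 : y <= 2 / c * expR (c / 2 * y).
  rewrite -ler_pdivrMl ?divr_gt0// invf_div.
  by apply: le_trans (expR_ge1Dx _); rewrite lerDr.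
have h2 : expR (c * y) = expR (c / 2 * y) * expR (c / 2 * y).
  by rewrite -expRD; congr expR; field.
have -> : (K * (2 / c) + `|d|) * expR (c * y) =
    K * expR (c / 2 * y) * (2 / c * expR (c / 2 * y)) + `|d| * expR (c * y).
  by rewrite h2; ring.
rewrite hornerD hornerC hornerM hornerX (le_trans (ler_normD _ _))//.
rewrite normrM (ger0_norm y0) lerD//; first by rewrite ler_pM// HK.
by rewrite ler_peMr// (le_trans _ (expR_ge1Dx _))// lerDl mulr_ge0// ltW.
Qed.

Lemma psi_bound p : exists2 K : R, 0 <= K & forall x, `|psi p x| <= K.
Proof.
have [K K0 HK] := horner_expR_bound p ltr01; exists K => // x; rewrite /psi.
case: ltP => x0; last by rewrite normr0.
have xi : 0 <= x^-1 by rewrite invr_ge0 ltW.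
have := HK _ xi; rewrite mul1r normrM (ger0_norm (expR_ge0 _)) expRN => h.
by rewrite ler_pdivrMr ?expR_gt0.
Qed.

(** The factor x^(-2) is absorbed into the polynomial. Quadratic flatness at 0 gives the derivative
    0 there. *)
Lemma psi_sqr_bound p : exists2 K : R, 0 <= K & forall x, `|psi p x| <= K * x ^+ 2.
Proof.
have [K K0 HK] := psi_bound ('X ^+ 2 * p); exists K => // x.
have := HK x; rewrite /psi; case: ltP => x0; last by rewrite normr0 mulr_ge0// sqr_ge0.
rewrite hornerM hornerXn -mulrA normrM exprVn gtr0_norm ?invr_gt0 ?exprn_gt0//.
by rewrite mulrC ler_pdivrMr ?exprn_gt0.
Qed.

Lemma psi_is_prim p : is_prim (psi ('X ^+ 2 * (p - p^`()))) (psi p).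
Proof.
move=> x; have [x0|x0|->] := ltgtP x 0.
- rewrite psi_le0 ?ltW//; apply: (@near_eq_is_derive _ _ _ (cst 0)).
  by near=> y; rewrite psi_le0// ltW//; near: y; exact: lt_nbhsl.
- have xn0 : x != 0 by rewrite gt_eqF.
  rewrite [psi ('X^2 * _) x]/psi x0.
  apply: (@near_eq_is_derive _ _ _ (fun y => p.[y^-1] * expR (- y^-1))).
    near=> y; rewrite /psi ifT//; near: y; exact: lt_nbhsr.
  have dV : is_derive x (1:R) (fun y => y^-1) (- x ^- 2).
    have := @is_deriveV R id x 1 1 xn0 (is_derive_id _ _).
    by rewrite /GRing.scale/= mulr1.
  have dp := @is_derive1_comp _ (fun y => p.[y]) (fun y => y^-1) x _ _ (is_derive_poly p x^-1) dV.
  have dN : is_derive x (1:R) (fun y => - y^-1) (x ^- 2).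
    by rewrite -[X in is_derive _ _ _ X]opprK; apply: is_deriveN.
  have de := @is_derive1_comp _ expR (fun y => - y^-1) x _ _ (is_derive_expR _) dN.
  have := is_deriveM dp de; rewrite /GRing.scale/= => H.
  apply: (is_derive_eq H) => /=.
  by rewrite hornerM hornerXn hornerD hornerN exprVn; move: (x ^- 2) => z; ring.
- rewrite psi_le0//; have [K K0 HK] := psi_sqr_bound p.
  have cv : h^-1 *: (psi p (h *: (1:R) + 0) - psi p 0) @[h --> (0:R)^'] --> (0:R).
    apply/cvgrPdist_le => e e0.
    have d0 : 0 < e / (K + 1) by rewrite divr_gt0// ltr_wpDl.
    near=> h; rewrite sub0r normrN (psi_le0 p (lexx 0)) subr0 addr0 /GRing.scale/= mulr1.
    have h0 : h != 0 by near: h; exact: nbhs_dnbhs_neq.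
    rewrite normrM normfV ler_pdivrMl ?normr_gt0//.
    apply: (le_trans (HK h)); rewrite -real_normK ?num_real// expr2 mulrCA ler_wpM2l//.
    have : `|h| <= e / (K + 1) by near: h; exact: dnbhs0_le.
    rewrite ler_pdivlMr ?ltr_wpDl// => hh; apply: le_trans hh.
    by rewrite mulrC ler_wpM2l// lerDl.
  apply: DeriveDef; first by apply/cvg_ex; exists 0.
  by apply/cvg_lim.
Unshelve. all: by end_near. Qed.

Lemma smooth_upto_psi n p : smooth_upto n (psi p).
Proof.
elim: n p => [//|n IH] p; have H := psi_is_prim p.
by split; [move=> x; have [] := H x|rewrite (is_prim_derive1 H); exact: IH].
Qed.

Lemma psi_cvg p c d : 0 < c -> psi p (n%:R * c + d) @[n --> \oo] --> p.[0].
Proof.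
move=> c0.
have cv : (n%:R * c + d)^-1 @[n --> \oo] --> (0:R).
  apply/cvgrPdist_le => e e0; near=> n.
  have h : e^-1 - d < n%:R * c.
    by rewrite -ltr_pdivrMr//; near: n; exact: nbhs_infty_gtr.
  have y0 : 0 < n%:R * c + d by have := invr_gt0 e; rewrite e0 => ?; lra.
  rewrite sub0r normrN gtr0_norm ?invr_gt0// -[e]invrK lef_pV2 ?posrE ?invr_gt0//.
  by lra.
have cG : contR (fun z => p.[z] * expR (- z)).
  apply: contM; first exact: cont_horner.
  have cN : contR (fun z : R => - z) by cont.
  by move=> z; apply: continuous_comp; [exact: cN|exact: continuous_expR].
have -> : p.[0] = p.[0] * expR (- 0) by rewrite oppr0 expR0 mulr1.
apply: (@cvg_trans _ ((fun z => p.[z] * expR (- z)) \o (fun n : nat => (n%:R * c + d)^-1) @ \oo)).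
  apply: near_eq_cvg; near=> n; rewrite /psi ifT//=.
  have h : - d < n%:R * c.
    by rewrite -ltr_pdivrMr//; near: n; exact: nbhs_infty_gtr.
  by lra.
by apply: (cvg_comp _ _ cv); exact: cG.
Unshelve. all: by end_near. Qed.

End Bump.

(** * Polynomials as test functions for weak derivatives *)

Section WeakPoly.
Variables (R : realType) (a b : R).
Hypothesis ab : a < b.
Implicit Types (f g v w : R -> R) (c x y : R) (p q : {poly R}).

Notation mu := (@lebesgue_measure R).
Notation I v := (\int[mu]_(x in `]a, b[) (v x)%R).
Notation integrable v := (mu.-integrable `]a, b[ (EFin \o v)).

Lemma contR_measurable f (D : set R) : contR f -> measurable_fun D f.
Proof. by move=> cf; apply: measurable_funTS; exact: continuous_measurable_fun. Qed.

Lemma contR_bounded f : contR f ->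
  exists2 K : R, 0 <= K & forall x, a <= x <= b -> `|f x| <= K.
Proof.
move=> cf; have [c _ cM] := @EVT_max R (fun x => `|f x|) a b (ltW ab)
  (continuous_subspaceT (cont_norm cf)).
by exists `|f c| => // x xab; apply: cM; rewrite in_itv.
Qed.

Lemma itv_oo_le x : `]a, b[%classic x -> a <= x <= b.
Proof. by rewrite /= in_itv/= => /andP[ax xb]; rewrite !ltW. Qed.

Lemma integrable_mul_cont v f : integrable v -> contR f ->
  integrable (fun x => v x * f x).
Proof.
move=> iv cf; have [K K0 HK] := contR_bounded cf.
rewrite (_ : EFin \o _ = (EFin \o v) \* (EFin \o f))%E; last first.
  by apply/funext => x /=; rewrite EFinM.
apply: integrableMl => //; first exact: contR_measurable.
exists K; split; first exact: num_real.
by move=> M KM x /itv_oo_le /HK h; apply: (le_trans h); exact: ltW.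
Qed.

Lemma dct_mul_ae v (F : nat -> R -> R) f K : integrable v ->
  (forall n, contR (F n)) -> contR f ->
  {ae mu, forall x, a < x < b -> F n x @[n --> \oo] --> f x} ->
  (forall n x, a < x < b -> `|F n x| <= K) ->
  I (fun x => v x * F n x) @[n --> \oo] --> I (fun x => v x * f x).
Proof.
move=> iv cF cf Ff FK.
have mv : measurable_fun `]a, b[ v.
  by apply/measurable_EFinP; exact: measurable_int iv.
have mvf g : contR g -> measurable_fun `]a, b[ (fun x => (v x * g x)%:E).
  by move=> cg; apply/measurable_EFinP; apply: measurable_funM => //; exact: contR_measurable.
have [|||||_ _ H] := @dominated_convergence _ _ _ mu `]a, b[ (measurable_itv _)
  (fun n x => (v x * F n x)%:E) (fun x => (v x * f x)%:E) (fun x => (`|v x| * K)%:E).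
- by move=> n; exact: mvf.
- exact: mvf.
- case: Ff => Z [mZ Z0 ZP]; exists Z; split => // x /= Hx; apply: ZP => /= H.
  apply: Hx; rewrite in_itv/= => xab; apply: cvg_EFin; first exact: nearW.
  by apply: cvgM; [exact: cvg_cst|exact: H].
- rewrite (_ : (fun x => _) = (fun x => `|v x|%:E * K%:E)%E); last first.
    by apply/funext => x; rewrite EFinM.
  by apply: integrableZr => //; exact: (integrable_abse iv).
- apply/nearW => x n /=; rewrite in_itv/= => xab; rewrite lee_fin normrM.
  by rewrite ler_wpM2l// FK.
have fin g : contR g -> (\int[mu]_(x in `]a, b[) (v x * g x)%:E)%E \is a fin_num.
  by move=> cg; apply: integrable_fin_num => //; exact: integrable_mul_cont.
apply: fine_cvg; rewrite fineK ?fin//.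
Qed.

Lemma dct_mul v (F : nat -> R -> R) f K : integrable v ->
  (forall n, contR (F n)) -> contR f ->
  (forall x, a < x < b -> F n x @[n --> \oo] --> f x) ->
  (forall n x, a < x < b -> `|F n x| <= K) ->
  I (fun x => v x * F n x) @[n --> \oo] --> I (fun x => v x * f x).
Proof. by move=> iv cF cf Ff; apply: dct_mul_ae => //; exact/nearW. Qed.

(* Smooth cutoffs of a polynomial: [psi 1] vanishes on the left of [0], so that
   the support of the product is the interval [a + 1/m, b - 1/m]. *)
Definition cutl m x := m%:R * x + (- (m%:R * a) - 1).
Definition cutr m x := - m%:R * x + (m%:R * b - 1).
Definition cutoff p m x : R := p.[x] * (psi 1 (cutl m x) * psi 1 (cutr m x)).

Lemma cutoff_test p m : (0 < m)%N -> test_function `]a, b[ (cutoff p m).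
Proof.
move=> m0; have m1 : 0 < m%:R :> R by rewrite ltr0n.
split.
  move=> n; apply: smooth_upto_derivable; apply: smooth_uptoM; first exact: smooth_upto_horner.
  by apply: smooth_uptoM; apply: smooth_upto_comp_affine; exact: smooth_upto_psi.
exists `[a + m%:R^-1, b - m%:R^-1]%classic; split; first exact: segment_compact.
  move=> x /=; rewrite !in_itv/= => /andP[h1 h2]; have := invr_gt0 (m%:R : R).
  by rewrite m1 => h3; apply/andP; split; lra.
move=> x /= /negP; rewrite in_itv/= negb_and -!ltNge => /orP[h|h].
  rewrite /cutoff (@psi_le0 _ _ (cutl m x)) ?mul0r ?mulr0//.
  have : m%:R * x < m%:R * (a + m%:R^-1) by rewrite ltr_pM2l.
  by rewrite mulrDr divff ?gt_eqF// /cutl; lra.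
rewrite /cutoff (@psi_le0 _ _ (cutr m x)) ?mulr0//.
have : m%:R * (b - m%:R^-1) < m%:R * x by rewrite ltr_pM2l.
by rewrite mulrBr divff ?gt_eqF// /cutr mulNr; lra.
Qed.

Lemma cutoff_cont p m : contR (cutoff p m).
Proof.
have c c' d : contR (fun x => psi 1 (c' * x + d)) by exact: is_prim_continuous (is_prim_comp_affine c' d (@psi_is_prim R 1)).
by rewrite /cutoff /cutl /cutr; cont; exact: c.
Qed.

Lemma psi1_le1 x : `|psi 1 x| <= 1.
Proof.
rewrite /psi; case: ltP => x0; last by rewrite normr0.
by rewrite hornerC mul1r ger0_norm ?expR_ge0// -expR0 ler_expR oppr_le0 invr_ge0 ltW.
Qed.

Lemma cvg_seqM (f g : nat -> R) (l m : R) : f n @[n --> \oo] --> l ->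
  g n @[n --> \oo] --> m -> f n * g n @[n --> \oo] --> l * m.
Proof. exact: cvgM. Qed.

Lemma cvg_seq_cst (l : R) : l @[n --> \oo] --> l.
Proof. exact: cvg_cst. Qed.

Lemma cutl_cvg q x : a < x -> psi q (cutl n.+1 x) @[n --> \oo] --> q.[0].
Proof.
move=> ax; have xa : 0 < x - a by rewrite subr_gt0.
have := @psi_cvg R q _ (x - a - 1) xa.
by apply: cvg_trans; apply: near_eq_cvg; apply/nearW => n; congr psi; rewrite /cutl -natr1; ring.
Qed.

Lemma cutr_cvg q x : x < b -> psi q (cutr n.+1 x) @[n --> \oo] --> q.[0].
Proof.
move=> ax; have xa : 0 < b - x by rewrite subr_gt0.
have := @psi_cvg R q _ (- 1) xa; rewrite -(cvg_shiftS).
by apply: cvg_trans; apply: near_eq_cvg; apply/nearW => n; congr psi; rewrite /cutr -natr1; ring.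
Qed.

Lemma cutoff_cvg p x : a < x < b -> cutoff p n.+1 x @[n --> \oo] --> p.[x].
Proof.
move=> /andP[ax xb].
by have := cvg_seqM (@cvg_seq_cst p.[x]) (cvg_seqM (cutl_cvg (q := 1) ax) (cutr_cvg (q := 1) xb));
  rewrite !hornerC !mulr1.
Qed.

Lemma cutoff_bounded p : exists2 K : R, 0 <= K &
  forall m x, a < x < b -> `|cutoff p m x| <= K.
Proof.
have [K K0 HK] := contR_bounded (cont_horner p); exists K => // m x /andP[ax xb].
have xab : a <= x <= b by rewrite !ltW.
rewrite /cutoff normrM -[K]mulr1 ler_pM// ?HK//.
by rewrite normrM -[leRHS]mulr1 ler_pM// psi1_le1.
Qed.

(* Wherever the derivative falls on a cutoff, the zero of [p] at that end point
   compensates the factor [m]. *)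
Lemma psi_shift_mul (z : R) :
  (z + 1) * psi ('X ^+ 2 * (1 - 1^`())) z = psi ('X + 'X ^+ 2) z.
Proof.
rewrite /psi; case: ltP => z0; last by rewrite mulr0.
have d1 : (1 : {poly R})^`() = 0 by rewrite -polyC1 derivC.
rewrite mulrA; congr (_ * _); rewrite d1 subr0 mulr1 hornerD hornerXn hornerX.
by field; rewrite gt_eqF.
Qed.

(** Derivative of [cutoff p m] when [p1] and [p2] are the quotients of [p] by x - a and b - x. In
    this form it is bounded uniformly in [m], and the terms with X + X^2 tend to 0 because that
    polynomial vanishes at 0. *)
Definition dcutoff p p1 p2 m x : R :=
  p^`().[x] * (psi 1 (cutl m x) * psi 1 (cutr m x)) +
  (p1.[x] * (psi ('X + 'X ^+ 2) (cutl m x) * psi 1 (cutr m x)) -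
   p2.[x] * (psi 1 (cutl m x) * psi ('X + 'X ^+ 2) (cutr m x))).

Lemma cutoff_derive p p1 p2 m : p = p1 * ('X - a%:P) -> p = p2 * (b%:P - 'X) ->
  is_prim (dcutoff p p1 p2 m) (cutoff p m).
Proof.
move=> E1 E2 x.
have dl := is_prim_comp_affine m%:R (- (m%:R * a) - 1) (@psi_is_prim R 1) x.
have dr := is_prim_comp_affine (- m%:R) (m%:R * b - 1) (@psi_is_prim R 1) x.
pose AB y := psi 1 (m%:R * y + (- (m%:R * a) - 1)) * psi 1 (- m%:R * y + (m%:R * b - 1)).
have dAB : is_derive x (1:R) AB _ := is_deriveM dl dr.
have := is_deriveM (is_derive_poly p x) dAB.
rewrite /GRing.scale/= => H; apply: (is_derive_eq H) => /=.
rewrite /AB /dcutoff -!psi_shift_mul /cutl /cutr.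
have e1 : p.[x] = p1.[x] * (x - a) by rewrite {1}E1 !hornerE.
have e2 : p.[x] = p2.[x] * (b - x) by rewrite {1}E2 !hornerE.
set A := psi 1 _; set B := psi 1 _; set A' := psi _ (m%:R * x + _).
set B' := psi _ (- m%:R * x + _).
rewrite mulrDr [p.[x] * (A * _)](_ : _ = - (p.[x] * m%:R * (A * B'))); last by ring.
rewrite [p.[x] * (B * _)](_ : _ = p.[x] * m%:R * (A' * B)); last by ring.
rewrite {1}e2 e1; ring.
Qed.

Lemma dcutoff_cont p p1 p2 m : contR (dcutoff p p1 p2 m).
Proof.
have c q c' d : contR (fun x => psi q (c' * x + d)) by exact: is_prim_continuous (is_prim_comp_affine c' d (@psi_is_prim R q)).
by rewrite /dcutoff /cutl /cutr; cont; exact: c.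
Qed.

Lemma dcutoff_cvg p p1 p2 x : a < x < b ->
  dcutoff p p1 p2 n.+1 x @[n --> \oo] --> p^`().[x].
Proof.
move=> /andP[ax xb]; have l1 := cutl_cvg (q := 1) ax; have r1 := cutr_cvg (q := 1) xb.
have l2 := cutl_cvg (q := ('X + 'X ^+ 2)) ax; have r2 := cutr_cvg (q := ('X + 'X ^+ 2)) xb.
have z : ('X + 'X ^+ 2 : {poly R}).[0] = 0 by rewrite !hornerE; ring.
rewrite z in l2 r2; rewrite hornerC in l1 r1.
have H1 := cvg_seqM (@cvg_seq_cst p^`().[x]) (cvg_seqM l1 r1).
have H2 := cvg_seqM (@cvg_seq_cst p1.[x]) (cvg_seqM l2 r1).
have H3 := cvg_seqM (@cvg_seq_cst p2.[x]) (cvg_seqM l1 r2).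
have E : p^`().[x] = p^`().[x] * (1 * 1) + (p1.[x] * (0 * 1) - p2.[x] * (1 * 0)).
  by ring.
by rewrite [X in _ --> X]E; apply: cvgD; [exact: H1|apply: cvgB; [exact: H2|exact: H3]].
Qed.

Lemma dcutoff_bounded p p1 p2 : exists K : R,
  forall m x, a < x < b -> `|dcutoff p p1 p2 m x| <= K.
Proof.
have [K K0 HK] := contR_bounded (cont_horner p^`()).
have [K1 K10 HK1] := contR_bounded (cont_horner p1).
have [K2 K20 HK2] := contR_bounded (cont_horner p2).
have [Q Q0 HQ] := @psi_bound R ('X + 'X ^+ 2).
exists (K * (1 * 1) + (K1 * (Q * 1) + K2 * (1 * Q))) => m x /andP[ax xb].
have xab : a <= x <= b by rewrite !ltW.
rewrite /dcutoff (le_trans (ler_normD _ _))// lerD//.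
  by rewrite !normrM !ler_pM ?mulr_ge0// ?HK ?psi1_le1.
rewrite (le_trans (ler_normB _ _))// lerD// !normrM.
  by rewrite !ler_pM ?mulr_ge0// ?HK1 ?psi1_le1 ?HQ.
by rewrite !ler_pM ?mulr_ge0// ?HK2 ?psi1_le1 ?HQ.
Qed.

Lemma weak_eq_horner v w p : integrable v -> integrable w ->
  (forall phi, test_function `]a, b[ phi ->
     I (fun x => v x * phi x) = I (fun x => w x * phi x)) ->
  I (fun x => v x * p.[x]) = I (fun x => w x * p.[x]).
Proof.
move=> iv iw H; have [K K0 HK] := cutoff_bounded p.
have cv u : integrable u -> I (fun x => u x * cutoff p n.+1 x) @[n --> \oo] -->
    I (fun x => u x * p.[x]).
  move=> iu; apply: (@dct_mul _ _ _ K) => //.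
  - by move=> n; exact: cutoff_cont.
  - exact: cont_horner.
  - by move=> x; exact: cutoff_cvg.
  - by move=> n x; exact: HK.
apply: (cvg_unique _ (cv v iv)) => //.
have := cv w iw; apply: cvg_trans; apply: near_eq_cvg; apply/nearW => n /=.
by rewrite H//; exact: cutoff_test.
Qed.

(** The zeros of [p] at the ends keep the derivatives of the cutoffs of [p] bounded, so that
    dominated convergence passes from them to [p] itself. *)
Lemma weak_derive_horner v w p : integrable v -> integrable w ->
  (forall phi, test_function `]a, b[ phi ->
     I (fun x => v x * phi^`()%classic x) = - I (fun x => w x * phi x)) ->
  p.[a] = 0 -> p.[b] = 0 ->
  I (fun x => v x * p^`().[x]) = - I (fun x => w x * p.[x]).
Proof.
move=> iv iw H pa pb; have [K K0 HK] := cutoff_bounded p.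
have /factor_theorem[p1 E1] : root p a by apply/rootP.
have /factor_theorem[q2 E2] : root p b by apply/rootP.
have {}E2 : p = (- q2) * (b%:P - 'X) by rewrite E2; ring.
have [K' HK'] := dcutoff_bounded p p1 (- q2).
have cv : I (fun x => w x * cutoff p n.+1 x) @[n --> \oo] -->
    I (fun x => w x * p.[x]).
  apply: (@dct_mul _ _ _ K) => //.
  - by move=> n; exact: cutoff_cont.
  - exact: cont_horner.
  - by move=> x; exact: cutoff_cvg.
  - by move=> n x; exact: HK.
have cv' : I (fun x => v x * dcutoff p p1 (- q2) n.+1 x) @[n --> \oo] -->
    I (fun x => v x * p^`().[x]).
  apply: (@dct_mul _ _ _ K') => //.
  - by move=> n; exact: dcutoff_cont.
  - exact: cont_horner.
  - by move=> x; exact: dcutoff_cvg.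
  - by move=> n x; exact: HK'.
apply: (cvg_unique _ cv') => //.
suff -> : (fun n => I (fun x => v x * dcutoff p p1 (- q2) n.+1 x)) =
  (fun n => - I (fun x => w x * cutoff p n.+1 x)) by exact: cvgN cv.
apply/funext => n; rewrite -H; last exact: cutoff_test.
by rewrite (is_prim_derive1 (cutoff_derive n.+1 E1 E2)).
Qed.

End WeakPoly.

(** * The projection error *)

Section Duality.
Variables (R : realType) (a b : R).
Hypothesis ab : a < b.
Implicit Types (f g v w u chi : R -> R) (x y : R) (p q phi : {poly R}) (n m i j : nat).

Notation k := (b - a).
Notation mu := (@lebesgue_measure R).
Notation I v := (\int[mu]_(x in `]a, b[) (v x)%R).
Notation integrable v := (mu.-integrable `]a, b[ (EFin \o v)).
Notation nrm := (nrm a b).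
Let leab := ltW ab.
Let k0 : 0 < k. Proof. by rewrite subr_gt0. Qed.

(** As f - q is orthogonal to q, its squared norm is its pairing with f. The hypothesis concerns
    polynomials only, so f - q is replaced by P - Z, with [P] a polynomial close to f and [Z] the
    projection of [P]; the error tends to 0 with [e]. *)
Lemma proj_sub_nrm_dual n f q Q : contR f -> (size q <= n)%N -> 0 <= Q ->
  orth a b n (fun x => f x - q.[x]) ->
  (forall phi, orth a b n (fun x => phi.[x]) ->
    `|itg a b (fun x => f x * phi.[x])| <= Q * nrm (fun x => phi.[x])) ->
  nrm (fun x => f x - q.[x]) <= Q.
Proof.
move=> cf sq Q0 fo H; set N := nrm _; have N0 : 0 <= N by exact: nrm_ge0.
have crho : contR (fun x => f x - q.[x]) by cont.
have [N1|N1] := eqVneq N 0; first by rewrite N1.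
have {N1}N1 : 0 < N by rewrite lt0r N1.
suff : N * N <= Q * N by rewrite ler_pM2r.
apply/ler_addgt0Pr => d d0; set s := Num.sqrt k.
have s0 : 0 <= s by exact: sqrtr_ge0.
pose e := d / (s * (N + Q) + 1).
have den0 : 0 < s * (N + Q) + 1 by rewrite ltr_wpDl// mulr_ge0// addr_ge0.
have e0 : 0 < e by rewrite divr_gt0.
have eK : e * (s * (N + Q)) <= d.
  by rewrite /e mulrAC ler_pdivrMr// ler_pM2l// lerDl.
have [P PP] := weierstrass ab cf e0.
have [Z sZ Zo] := proj_exists ab n (cont_horner P).
have sZq : (size (Z - q)%R <= n)%N.
  by rewrite (leq_trans (size_polyD _ _))// size_polyN geq_max sZ.
have cPf : contR (fun x => P.[x] - f x) by cont.
pose D x := (P.[x] - f x) - (Z - q).[x].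
have cD : contR D by rewrite /D; cont.
have oD : orth a b n D.
  move=> r sr; rewrite (eq_itg (g := fun x => (P.[x] - Z.[x]) * r.[x] - (f x - q.[x]) * r.[x]) leab).
  - by rewrite itgB; [rewrite Zo// fo// subrr|cont|cont].
  - by cont.
  - by cont.
  - by move=> x _; rewrite /D hornerD hornerN; ring.
have nD : nrm D <= e * s.
  apply: (le_trans (proj1 (proj_sub_nrm_le ab cPf sZq oD))).
  by apply: nrm_le => //; [exact: ltW|move=> x xab; rewrite distrC PP].
have DE x : (P - Z).[x] = (f x - q.[x]) + D x.
  by rewrite /D !hornerD !hornerN; ring.
have oPZ : orth a b n (fun x => (P - Z).[x]).
  move=> r sr; rewrite -(Zo r sr); apply: (eq_itg leab); [cont|cont|].
  by move=> x _; rewrite hornerD hornerN.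
have := H (P - Z) oPZ.
have nPZ : nrm (fun x => (P - Z).[x]) <= N + e * s.
  rewrite (_ : (fun x => (P - Z).[x]) = (fun x => (f x - q.[x]) + D x)).
    by rewrite (le_trans (nrmD ab _ _))// lerD2l.
  by apply/funext.
have -> : itg a b (fun x => f x * (P - Z).[x]) = N * N + itg a b (fun x => (f x - q.[x]) * D x).
  rewrite -expr2 nrm_sqr// /norm2 -itgD; [|cont..].
  rewrite -[LHS](subr0 _) -(oPZ q sq) -itgB; [|cont..].
  by apply: (eq_itg leab); [cont|cont|] => x _; rewrite DE; ring.
have h1 := itg_mul_le ab crho cD; rewrite -/N in h1.
have h2 : N * nrm D <= N * (e * s) by rewrite ler_wpM2l.
have h3 : Q * nrm (fun x => (P - Z).[x]) <= Q * (N + e * s) by rewrite ler_wpM2l.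
move=> h4; have := ler_norm (N * N + itg a b (fun x => (f x - q.[x]) * D x)).
have := ler_norm (- itg a b (fun x => (f x - q.[x]) * D x)); rewrite normrN.
lra.
Qed.

Lemma in_Lp_measurable (J : set R) (r : \bar R) v : in_Lp J r v -> `]a, b[ `<=` J ->
  measurable_fun `]a, b[ v.
Proof.
move=> /sub_Lfun_mfun; rewrite inE/= => mv JJ.
apply: (@eq_measurable_fun _ _ _ _ _ (v \_ J)).
  by move=> x; rewrite inE => /JJ xJ; rewrite patchE mem_set.
exact: measurable_funTS.
Qed.

(** [Lnorm] with exponent +oo unfolds to an essential supremum only on a space of positive
    measure. *)
Lemma muT_gt0 : (0 < mu [set: R])%E.
Proof.
apply: (@lt_le_trans _ _ (mu `]0%R, 1%R[)).
  by rewrite lebesgue_measure_itv/= lte_fin ltr01 oppr0 adde0 lte_fin.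
by apply: le_measure; rewrite ?inE//.
Qed.

Lemma Linf_normP (J : set R) v (B : R) : (Linf_norm J v <= B%:E)%E ->
  `]a, b[ `<=` J -> {ae mu, forall x, `]a, b[%classic x -> `|v x| <= B}.
Proof.
rewrite /Linf_norm unlock /Lnorm muT_gt0 => /ess_supP H JJ.
apply: filterS H => x /= H /JJ xJ; move: H.
by rewrite patchE mem_set.
Qed.

Lemma in_Linf_integrable (J : set R) v : in_Lp J +oo%E v -> `]a, b[ `<=` J ->
  integrable v.
Proof.
move=> vL JJ; have mv := in_Lp_measurable vL JJ.
move: vL => /sub_Lfun_finLfun; rewrite inE/= /finite_norm => nv.
have nv0 : (0 <= Linf_norm J v)%E by exact: Lnorm_ge0.
have /fineK nvE : Linf_norm J v \is a fin_num.
  by rewrite ge0_fin_numE.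
have [] := @Linf_normP J v (fine (Linf_norm J v)); rewrite ?nvE// => Z [mZ Z0 ZP].
pose B := fine (Linf_norm J v).
apply/integrableP; split; first exact/measurable_EFinP.
apply: (@le_lt_trans _ _ (\int[mu]_(x in `]a, b[) B%:E)%E).
  apply: ae_ge0_le_integral => //.
  - exact/measurableT_comp/measurable_EFinP.
  - by move=> x _; rewrite lee_fin fine_ge0.
  - exists Z; split => // x /= Hx; apply: ZP => /= Hv; apply: Hx => xab.
rewrite integral_cst//= lebesgue_measure_itv/= lte_fin ab.
by rewrite -EFinB -EFinM ltry.
Qed.

Lemma Rintegral_mul_le v (B : R) phi : integrable v -> 0 <= B ->
  {ae mu, forall x, `]a, b[%classic x -> `|v x| <= B} ->
  `|I (fun x => v x * phi.[x])| <= B * (Num.sqrt k * nrm (fun x => phi.[x])).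
Proof.
move=> iv B0 vB.
have iphi := integrable_mul_cont ab iv (cont_horner phi).
apply: (le_trans (le_normr_Rintegral _ iphi)) => //.
have cn : contR (fun x => B * `|phi.[x]|) by cont.
apply: (@le_trans _ _ (I (fun x => B * `|phi.[x]|))); last first.
  rewrite Rintegral_itg// itgZ; [|cont]; rewrite ler_wpM2l//.
  by apply: itg_norm_le; [|cont].
have ic : integrable (fun x => B * `|phi.[x]|).
  have := continuous_itv_integrable a b cn; apply: integrableS => //.
  exact: subset_itv_oo_cc.
have mphi : measurable_fun `]a, b[ (fun x => v x * phi.[x]).
  by have /integrableP[/measurable_EFinP] := iphi.
rewrite /Rintegral fine_le//.
- apply: integrable_fin_num => //; exact: (integrable_abse iphi).
- exact: integrable_fin_num.
- apply: ae_ge0_le_integral => //.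
  + by apply/measurable_EFinP; exact: measurableT_comp.
  + by move=> x _; rewrite lee_fin mulr_ge0.
  + by apply/measurable_EFinP; exact: contR_measurable.
  + case: vB => Z [mZ Z0 ZP]; exists Z; split => // x /= Hx; apply: ZP => /= Hv.
    by apply: Hx => xab; rewrite lee_fin normrM ler_wpM2r//; exact: Hv.
Qed.

Lemma Rintegral_sub0 (J : set R) h : `]a, b[ `<=` J ->
  (forall x, ~ `]a, b[%classic x -> h x = 0) -> \int[mu]_(x in J) (h x)%R = I h.
Proof.
move=> JJ h0; rewrite Rintegral_mkcond [RHS]Rintegral_mkcond; congr Rintegral.
apply/funext => x; rewrite !patchE.
have [xab|xab] := boolP (x \in `]a, b[%classic).
  by rewrite mem_set//; apply: JJ; rewrite inE in xab.
by case: ifP => // _; apply: h0 => xab'; move: xab; rewrite mem_set.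
Qed.

Lemma test_function_sub (J : set R) chi : `]a, b[ `<=` J ->
  test_function `]a, b[ chi -> test_function J chi.
Proof.
move=> JJ [d [K [cK KJ K0]]]; split => //; exists K; split => //.
exact: subset_trans JJ.
Qed.

Lemma test_function_out chi : test_function `]a, b[ chi ->
  forall x, ~ `]a, b[%classic x -> chi x = 0.
Proof. by move=> [_ [K [_ KJ K0]]] x xab; apply: K0 => /KJ. Qed.

Lemma test_function_derive chi : test_function `]a, b[ chi ->
  test_function `]a, b[ chi^`()%classic.
Proof.
move=> [d [K [cK KJ K0]]]; split.
  by move=> n x; rewrite -derive1Sn; exact: d.
exists K; split => // x xK; rewrite derive1E.
have oK : open (~` K) by apply: closed_openC; apply: compact_closed.
rewrite (@near_eq_derive _ _ _ _ (cst 0)) ?derive_cst//.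
have : nbhs x (~` K) by exact: open_nbhs_nbhs.
by apply: filterS => y; exact: K0.
Qed.

Lemma test_function_derive1n chi n : test_function `]a, b[ chi ->
  test_function `]a, b[ (derive1n n chi).
Proof.
by elim: n => // n IH H; rewrite derive1nS; apply: test_function_derive; exact: IH.
Qed.

Lemma weak_derivative_sub (J : set R) i v g chi : `]a, b[ `<=` J ->
  weak_derivative J i v g -> test_function `]a, b[ chi ->
  I (fun x => v x * derive1n i chi x) = (-1) ^+ i * I (fun x => g x * chi x).
Proof.
move=> JJ [_ _ H] tchi; have := H chi (test_function_sub JJ tchi).
rewrite (@Rintegral_sub0 J (fun x => v x * derive1n i chi x) JJ); last first.
  by move=> x xab; rewrite (test_function_out (test_function_derive1n i tchi) xab) mulr0.
rewrite (@Rintegral_sub0 J (fun x => g x * chi x) JJ)// => x xab.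
by rewrite (test_function_out tchi xab) mulr0.
Qed.

(** Weak derivatives of all orders are defined from [v]. Testing order i with chi' and order i + 1
    with chi shows [h] to be the weak derivative of [g]. *)
Lemma weak_derivative_step (J : set R) i v g h chi : `]a, b[ `<=` J ->
  weak_derivative J i v g -> weak_derivative J i.+1 v h ->
  test_function `]a, b[ chi ->
  I (fun x => g x * chi^`()%classic x) = - I (fun x => h x * chi x).
Proof.
move=> JJ Hg Hh tchi.
have E1 := weak_derivative_sub JJ Hg (test_function_derive tchi).
have E2 := weak_derivative_sub JJ Hh tchi.
have EE : I (fun x => v x * derive1n i chi^`()%classic x) = I (fun x => v x * derive1n i.+1 chi x).
  by rewrite derive1Sn.
move: EE; rewrite E1 E2 exprS mulN1r mulNr -mulrN => /(congr1 (fun z => (-1) ^+ i * z)).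
by rewrite !mulrA -expr2 sqrr_sign !mul1r.
Qed.

(** Each step writes [phi] as the derivative of its primitive, which vanishes at both ends by
    orthogonality to constants. Moving this derivative to [g i] gains a factor k/n and spends one
    degree of orthogonality. *)
Lemma weak_derivatives_chain (J : set R) m v (g : nat -> R -> R) (B : R) j : `]a, b[ `<=` J -> 0 <= B ->
  weak_derivatives_Lp J m +oo%E v g -> forall n i phi,
  (j <= n)%N -> (i + j <= m)%N -> (Linf_norm J (g (i + j)%N) <= B%:E)%E ->
  orth a b n (fun x => phi.[x]) ->
  `|I (fun x => g i x * phi.[x])| <=
  B * Num.sqrt k * (\prod_(l < j) (k / (n - l)%:R)) * nrm (fun x => phi.[x]).
Proof.
move=> JJ B0 Hg; elim: j => [|j IH] n i phi jn ijm gB phio.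
  rewrite big_ord0 mulr1; rewrite addn0 in gB ijm.
  have [_ gL] := Hg i ijm.
  rewrite -mulrA; apply: Rintegral_mul_le => //.
    exact: in_Linf_integrable gL JJ.
  exact: Linf_normP gB JJ.
case: n jn phio => [//|n] jn phio; rewrite ltnS in jn.
have ii : (i <= m)%N by rewrite (leq_trans _ ijm)// leq_addr.
have ii1 : (i.+1 <= m)%N by rewrite (leq_trans _ ijm)// addnS ltnS leq_addr.
have [Q QE _] := poly_primitive_exists phi.
pose Phi := Q - (Q.[a])%:P.
have PhiE x : Phi.[x] = itg a x (fun y => phi.[y]).
  rewrite (@itg_prim _ _ (fun x => Q.[x])) ?hornerE//.
  by move=> y; rewrite -QE; exact: is_derive_poly.
have Phia : Phi.[a] = 0 by rewrite PhiE itgxx.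
have Phib : Phi.[b] = 0.
  by rewrite PhiE; exact: (orth_itg0 ab (ltn0Sn n) (cont_horner phi) phio).
have dPhi : Phi^`() = phi by rewrite derivB derivC subr0.
have -> : I (fun x => g i x * phi.[x]) = - I (fun x => g i.+1 x * Phi.[x]).
  rewrite -{1}dPhi; apply: weak_derive_horner => //.
  - by have [_ gL] := Hg i ii; exact: in_Linf_integrable gL JJ.
  - by have [_ gL] := Hg i.+1 ii1; exact: in_Linf_integrable gL JJ.
  - move=> psi; exact: weak_derivative_step JJ (proj1 (Hg i ii)) (proj1 (Hg i.+1 ii1)).
have oPhi : orth a b n (fun x => Phi.[x]).
  have := orth_prim ab (cont_horner phi) phio; congr orth.
  by apply/funext => x; rewrite PhiE.
rewrite normrN; apply: (le_trans (IH n i.+1 Phi jn _ _ oPhi)); rewrite ?addSnnS//.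
rewrite big_ord_recl subn0 /=.
have -> : \prod_(l < j) (k / (n.+1 - bump 0 l)%:R) = \prod_(l < j) (k / (n - l)%:R).
  by apply: eq_bigr => l _; rewrite /bump leq0n add1n subSS.
set P := \prod_(l < j) _.
have P0 : 0 <= P by apply: prodr_ge0 => l _; rewrite divr_ge0 ?(ltW k0).
have nPhi : nrm (fun x => Phi.[x]) <= k / n.+1%:R * nrm (fun x => phi.[x]).
  rewrite mulrAC ler_pdivlMr ?ltr0n// mulrC.
  have := nrm_prim_le ab (ltn0Sn n) (cont_horner phi) phio.
  by rewrite (_ : itg a ^~ _ = (fun x => Phi.[x]))//; apply/funext => x; rewrite PhiE.
rewrite (_ : B * Num.sqrt k * (k / n.+1%:R * P) * nrm (fun x => phi.[x]) = B * Num.sqrt k * P * (k / n.+1%:R * nrm (fun x => phi.[x]))); last by ring.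
by rewrite ler_wpM2l// !mulr_ge0// sqrtr_ge0.
Qed.

(** Factor by factor, from n <= (l + 1)(n - l) for l < n. The power of j thus lost depends on the
    smoothness order only. *)
Lemma prod_div_le n j : (j <= n)%N ->
  \prod_(l < j) (k / (n - l)%:R) <= (j%:R * (k / n%:R)) ^+ j.
Proof.
move=> jn; rewrite -[X in _ ^+ X]card_ord -prodr_const; apply: ler_prod => l _.
rewrite divr_ge0 ?(ltW k0)//=.
have ln : (l < n)%N by rewrite (leq_trans (ltn_ord l)).
rewrite mulrCA ler_wpM2l ?(ltW k0)//.
have n0 : 0 < n%:R :> R by rewrite ltr0n (leq_ltn_trans _ ln).
have nl0 : 0 < (n - l)%:R :> R by rewrite ltr0n subn_gt0.
rewrite ler_pdivlMr// mulrC ler_pdivrMr// -natrM ler_nat.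
apply: (@leq_trans (l.+1 * (n - l))); last by rewrite leq_mul2r ltn_ord orbT.
by rewrite mulSn -{1}(subnKC (ltnW ln)) addnC leq_add2l leq_pmulr// subn_gt0.
Qed.

(** Two classical integrations by parts show that [u2] and [w] agree against test functions; cutoffs
    extend this to polynomials. *)
Lemma weak_second_derivative u u1 u2 w phi : is_prim u1 u -> is_prim u2 u1 ->
  contR u2 -> integrable w ->
  (forall chi, test_function `]a, b[ chi ->
    I (fun x => u x * derive1n 2 chi x) = I (fun x => w x * chi x)) ->
  itg a b (fun x => u2 x * phi.[x]) = I (fun x => w x * phi.[x]).
Proof.
move=> uP u1P cu2 iw H; rewrite -Rintegral_itg//; last by cont.
apply: weak_eq_horner => //.
  apply: integrableS (continuous_itv_integrable a b cu2) => //.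
  exact: subset_itv_oo_cc.
move=> chi tchi; rewrite -(H chi tchi).
have cu1 := is_prim_continuous u1P; have cu := is_prim_continuous uP.
have d0 : is_prim chi^`()%classic chi.
  by apply: derivable_is_prim => x; have [/(_ 0%N x)] := tchi.
have d1 : is_prim chi^`()^`()%classic chi^`()%classic.
  apply: derivable_is_prim => x; have [/(_ 1%N x)] := tchi.
  by rewrite derive1n1.
have d2 : contR chi^`()^`()%classic.
  apply: (@is_prim_continuous _ chi^`()^`()^`()%classic).
  apply: derivable_is_prim => x; have [/(_ 2%N x)] := tchi.
  by rewrite derive1nS derive1n1.
have -> : derive1n 2 chi = chi^`()^`()%classic by rewrite derive1nS derive1n1.
have c0 := is_prim_continuous d0; have c1 := is_prim_continuous d1.
have out x : ~ `]a, b[%classic x -> chi x = 0 by exact: test_function_out.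
have out1 x : ~ `]a, b[%classic x -> chi^`()%classic x = 0.
  by apply: test_function_out; exact: test_function_derive.
have na : ~ `]a, b[%classic a by rewrite /= in_itv/= ltxx.
have nb : ~ `]a, b[%classic b by rewrite /= in_itv/= ltxx andbF.
rewrite (Rintegral_itg leab (contM cu2 c0)) (Rintegral_itg leab (contM cu d2)).
rewrite (itg_ibp a b uP d1)// (itg_ibp a b u1P d0)// !out1// !out// !mulr0 !subr0 !sub0r opprK.
by apply: (eq_itg leab); cont.
Qed.

Lemma Wint_norm_lt (J : set R) m v (y : \bar R) : (Wint_norm J m v < y)%E ->
  exists2 g, weak_derivatives_Lp J m +oo%E v g &
    forall j, (j <= m)%N -> (Linf_norm J (g j) <= y)%E.
Proof.
move=> /ereal_inf_lt[_ [g Hg <-] gy]; exists g => // j jm.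
apply: le_trans (ltW gy).
have jm1 : (j < m.+1)%N by [].
exact: (@le_bigmax_cond _ _ _ 0%E (Ordinal jm1) xpredT (fun j : 'I_m.+1 => Linf_norm J (g j))).
Qed.

Lemma Wint_norm_ge0 (J : set R) m v : (0%E <= Wint_norm J m v)%E.
Proof.
apply: le_ereal_inf_tmp => _ [g _ <-]; exact: bigmax_ge_id.
Qed.

Lemma couple_lt (J : set R) m v0 v1 (tau z : R) : 0 < tau ->
  (Wint_norm J m v0 + tau%:E * Wint_norm J m.+1 v1 < z%:E)%E ->
  exists B0 B1 : R, [/\ 0 <= B0, 0 <= B1, (Wint_norm J m v0 < B0%:E)%E,
    (Wint_norm J m.+1 v1 < B1%:E)%E & B0 + tau * B1 <= z].
Proof.
move=> tau0; have := Wint_norm_ge0 J m v0; have := Wint_norm_ge0 J m.+1 v1.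
case: (Wint_norm J m v0) => [x0| |]//; case: (Wint_norm J m.+1 v1) => [x1| |]//=;
  rewrite ?gt0_muley ?lte_fin// ?addeoo// ?addooe// ?addye//.
rewrite !lee_fin => x10 x00 h.
(* [d] distributes the slack so that both norms are strictly below their bounds. *)
pose d := (z - (x0 + tau * x1)) / (1 + tau).
have t1 : 0 < 1 + tau by rewrite addr_gt0.
have d0 : 0 < d by rewrite divr_gt0 ?subr_gt0.
have dE : d * (1 + tau) = z - (x0 + tau * x1) by rewrite divfK ?gt_eqF.
exists (x0 + d), (x1 + d); split; rewrite ?lte_fin ?ltrDl// ?addr_ge0 ?(ltW d0)//.
lra.
Qed.

End Duality.

(** * Projection error for integer and fractional smoothness *)

Section Approximation.
Variables (R : realType) (a b : R).
Hypothesis ab : a < b.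
Implicit Types (f g v w u chi : R -> R) (x y : R) (p q phi : {poly R}) (n m i j : nat).

Notation k := (b - a).
Notation mu := (@lebesgue_measure R).
Notation I v := (\int[mu]_(x in `]a, b[) (v x)%R).
Notation integrable v := (mu.-integrable `]a, b[ (EFin \o v)).
Notation nrm := (nrm a b).
Let leab := ltW ab.
Let k0 : 0 < k. Proof. by rewrite subr_gt0. Qed.

Lemma test_function_cont chi : test_function `]a, b[ chi -> contR chi.
Proof.
move=> [dc _]; apply: (@is_prim_continuous _ chi^`()%classic).
by apply: derivable_is_prim => x; exact: (dc 0%N x).
Qed.

Lemma locally_integrable_mul (J : set R) v chi : `]a, b[ `<=` J ->
  locally_integrable J v -> test_function `]a, b[ chi ->
  integrable (fun x => v x * chi x).
Proof.
move=> JJ [mv oJ lv] tchi; have cchi := test_function_cont tchi.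
have [_ [K [cK Kab K0]]] := tchi.
have mK : measurable K by exact: compact_measurable.
have KJ : K `<=` J by exact: subset_trans JJ.
have iv : mu.-integrable K (EFin \o v).
  apply/integrableP; split; last exact: lv.
  by apply/measurable_EFinP; apply: measurable_funS mv => //; exact: open_measurable.
have ivc : mu.-integrable K (EFin \o (fun x => v x * chi x)).
  have [M M0 HM] := contR_bounded ab cchi.
  rewrite (_ : EFin \o _ = (EFin \o v) \* (EFin \o chi))%E; last first.
    by apply/funext => x /=; rewrite EFinM.
  apply: integrableMl => //; first exact: contR_measurable.
  exists M; split; first exact: num_real.
  by move=> N MN x /Kab /itv_oo_le /HM h; apply: (le_trans h); exact: ltW.
have mab : measurable (`]a, b[ : set R) by [].
have [_ H2] := integrable_mkcond (mu := mu) (EFin \o (fun x => v x * chi x)) mab.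
have [H1 _] := integrable_mkcond (mu := mu) (EFin \o (fun x => v x * chi x)) mK.
apply: H2; move: (H1 ivc).
congr (mu.-integrable setT _); apply/funext => x; rewrite !patchE.
have [xK|xK] := boolP (x \in K).
  by rewrite mem_set//; apply: Kab; rewrite inE in xK.
case: ifP => // _ /=; rewrite K0 ?mulr0// => h; move: xK; rewrite mem_set//.
Qed.

Variables (J : set R) (u U u1 u2 : R -> R) (q0 : {poly R}) (n m : nat).
Hypotheses (JJ : `]a, b[ `<=` J) (uU : forall x, a < x < b -> U x = u x).
Hypotheses (uP : is_prim u1 u) (u1P : is_prim u2 u1) (cu2 : contR u2).
Hypotheses (n0 : (0 < n)%N) (sq0 : (size q0 <= n)%N).
Hypothesis q0o : orth a b n (fun x => u2 x - q0.[x]).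
Hypothesis m2 : (1 < m)%N.

Let s := Num.sqrt k.
Let s0 : 0 <= s. Proof. exact: sqrtr_ge0. Qed.
Let rho x := u2 x - q0.[x].
Let kn0 : 0 < k / n%:R. Proof. by rewrite divr_gt0 ?ltr0n. Qed.

Let prod_le j : (j <= n)%N -> (j <= m)%N ->
  \prod_(l < j) (k / (n - l)%:R) <= (m%:R * (k / n%:R)) ^+ j.
Proof.
move=> jn jm; apply: (le_trans (prod_div_le ab jn)).
have h : j%:R * (k / n%:R) <= m%:R * (k / n%:R) by rewrite ler_wpM2r ?(ltW kn0)// ler_nat.
by apply: lerXn2r => //; rewrite nnegrE mulr_ge0 ?(ltW kn0).
Qed.

Let chain v (g : nat -> R -> R) M (B : R) j phi : weak_derivatives_Lp J M +oo%E v g ->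
  (forall i, (i <= M)%N -> (Linf_norm J (g i) <= B%:E)%E) -> 0 <= B ->
  (j <= n)%N -> (j.+2 <= M)%N -> orth a b n (fun x => phi.[x]) ->
  `|I (fun x => g 2%N x * phi.[x])| <=
  B * s * (\prod_(l < j) (k / (n - l)%:R)) * nrm (fun x => phi.[x]).
Proof.
move=> Hg gB B0 jn jM phio.
by apply: (weak_derivatives_chain ab JJ B0 Hg jn _ _ phio) => //; exact: gB.
Qed.

Let rho_single j W : (j <= n)%N -> (j.+2 <= m)%N -> (Wint_norm J m U <= W%:E)%E ->
  nrm rho <= s * (\prod_(l < j) (k / (n - l)%:R)) * W.
Proof.
move=> jn jm UW; set P := \prod_(l < j) _.
have P0 : 0 <= P by apply: prodr_ge0 => l _; rewrite divr_ge0 ?(ltW k0).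
have W0 : 0 <= W by have := le_trans (Wint_norm_ge0 J m U) UW; rewrite lee_fin.
apply/ler_addgt0Pr => d d0.
pose e := d / (s * P + 1).
have den0 : 0 < s * P + 1 by rewrite ltr_wpDl// mulr_ge0.
have e0 : 0 < e by rewrite divr_gt0.
have eK : e * (s * P) <= d.
  by rewrite /e mulrAC ler_pdivrMr// ler_pM2l// lerDl.
have [|g Hg gB] := @Wint_norm_lt R J m U (W + e)%:E.
  by apply: (le_lt_trans UW); rewrite lte_fin ltrDl.
have We0 : 0 <= W + e by rewrite addr_ge0// ltW.
have jj2 : (2 <= m)%N by [].
have [_ g2L] := Hg 2%N jj2.
have ig2 := in_Linf_integrable ab g2L JJ.
apply: (@le_trans _ _ ((W + e) * s * P)); last by lra.
apply: (proj_sub_nrm_dual ab cu2 sq0 _ q0o); first by rewrite !mulr_ge0.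
move=> phi phio; rewrite (weak_second_derivative (w := g 2%N) ab phi uP u1P cu2)//.
  exact: chain Hg gB We0 jn jm phio.
move=> chi tchi; have [Hw _] := Hg 2%N jj2.
have := weak_derivative_sub JJ Hw tchi; rewrite expr2 mulrNN !mul1r => <-.
by apply: eq_Rintegral => x; rewrite inE/= in_itv/= => xab; rewrite uU.
Qed.

Let rho_couple j0 j1 v0 v1 (B0 B1 : R) : (j0 <= n)%N -> (j0.+2 <= m)%N ->
  (j1 <= n)%N -> (j1.+1 <= m)%N ->
  {ae mu, forall x, J x -> U x = v0 x + v1 x} -> 0 <= B0 -> 0 <= B1 ->
  (Wint_norm J m v0 < B0%:E)%E -> (Wint_norm J m.+1 v1 < B1%:E)%E ->
  nrm rho <= s * (\prod_(l < j0) (k / (n - l)%:R)) * B0 +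
             s * (\prod_(l < j1) (k / (n - l)%:R)) * B1.
Proof.
move=> j0n j0m j1n j1m Uv B00 B10 /Wint_norm_lt[g Hg gB] /Wint_norm_lt[h Hh hB].
set P0 := \prod_(l < j0) _; set P1 := \prod_(l < j1) _.
have P00 : 0 <= P0 by apply: prodr_ge0 => l _; rewrite divr_ge0 ?(ltW k0).
have P10 : 0 <= P1 by apply: prodr_ge0 => l _; rewrite divr_ge0 ?(ltW k0).
have j2m : (2 <= m)%N by [].
have j2m1 : (2 <= m.+1)%N by rewrite ltnW.
have [Hg2 g2L] := Hg 2%N j2m; have ig2 := in_Linf_integrable ab g2L JJ.
have [Hh2 h2L] := Hh 2%N j2m1; have ih2 := in_Linf_integrable ab h2L JJ.
have iw : integrable (fun x => g 2%N x + h 2%N x).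
  rewrite (_ : EFin \o _ = (EFin \o g 2%N) \+ (EFin \o h 2%N))%E.
    exact: integrableD.
  by apply/funext => x /=; rewrite EFinD.
apply: (proj_sub_nrm_dual ab cu2 sq0 _ q0o); first by rewrite addr_ge0// !mulr_ge0.
move=> phi phio.
rewrite (weak_second_derivative (w := fun x => g 2%N x + h 2%N x) ab phi uP u1P cu2)//; last first.
  move=> chi tchi.
  have E0 := weak_derivative_sub JJ Hg2 tchi; have E1 := weak_derivative_sub JJ Hh2 tchi.
  rewrite expr2 mulrNN !mul1r in E0 E1.
  have tchi2 := test_function_derive1n 2 tchi.
  have [[lv0 _ _] _] := Hg 0%N (leq0n _); have [[lv1 _ _] _] := Hh 0%N (leq0n _).
  have i0 := locally_integrable_mul JJ lv0 tchi2.
  have i1 := locally_integrable_mul JJ lv1 tchi2.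
  have c2 := test_function_cont tchi2; have c0 := test_function_cont tchi.
  have cu : contR u := is_prim_continuous uP.
  have -> : I (fun x => (g 2%N x + h 2%N x) * chi x) =
      I (fun x => g 2%N x * chi x) + I (fun x => h 2%N x * chi x).
    rewrite -RintegralD//; [|exact: (integrable_mul_cont ab)..].
    by apply: eq_Rintegral => x _; rewrite mulrDl.
  rewrite -E0 -E1 -RintegralD// /Rintegral; congr fine.
  apply: ae_eq_integral => //.
  - by apply/measurable_EFinP; apply: contR_measurable; cont.
  - apply/measurable_EFinP; apply: measurable_funD; apply/measurable_EFinP.
      exact: measurable_int i0.
    exact: measurable_int i1.
  - case: Uv => Z [mZ Z0 ZP]; exists Z; split => // x /= Hx; apply: ZP => /= Hv.
    apply: Hx => xab; congr EFin; rewrite -mulrDl -Hv ?uU//; exact: JJ.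
have -> : I (fun x => (g 2%N x + h 2%N x) * phi.[x]) =
    I (fun x => g 2%N x * phi.[x]) + I (fun x => h 2%N x * phi.[x]).
  have c := cont_horner phi.
  rewrite -RintegralD//; [|exact: (integrable_mul_cont ab)..].
  by apply: eq_Rintegral => x _; rewrite mulrDl.
apply: (le_trans (ler_normD _ _)); rewrite mulrDl lerD//.
  by have := chain Hg gB B00 j0n j0m phio; rewrite -/P0; lra.
by have := chain Hh hB B10 j1n j1m phio; rewrite -/P1; lra.
Qed.

Lemma W_norm_couple (sg : R) (W tau e : R) : Num.truncn sg = m -> sg - m%:R != 0 ->
  (W_norm J sg U <= W%:E)%E -> 0 < tau -> 0 < e ->
  exists v0 v1 : R -> R, exists B0 B1 : R,
  [/\ {ae mu, forall x, J x -> U x = v0 x + v1 x}, 0 <= B0 /\ 0 <= B1,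
    (Wint_norm J m v0 < B0%:E)%E, (Wint_norm J m.+1 v1 < B1%:E)%E &
    B0 + tau * B1 <= tau `^ (sg - m%:R) * W + e].
Proof.
move=> tr th; rewrite /W_norm tr (negbTE th) => UW tau0 e0.
set theta := sg - m%:R in th UW *.
have tt0 : 0 < tau `^ theta by rewrite powR_gt0.
have : (K_functional J m U tau < (tau `^ theta * W + e)%:E)%E.
  have : ((tau `^ (- theta))%:E * K_functional J m U tau <= W%:E)%E.
    by apply: le_trans UW; apply: ereal_sup_ubound; exists tau.
  rewrite powRN -lee_pdivlMl ?invr_gt0// invrK -EFinM => h.
  by apply: (le_lt_trans h); rewrite lte_fin ltrDl.
move=> /ereal_inf_lt[_ [v0 [v1 [Uv ->]]] /(couple_lt tau0)[B0 [B1 [? ? ? ? ?]]]].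
by exists v0, v1, B0, B1.
Qed.

Let le_mul_add (X Q Y : R) : 0 <= Q -> (forall e, 0 < e -> X <= Q * (Y + e)) -> X <= Q * Y.
Proof.
move=> Q0 H; apply/ler_addgt0Pr => d d0; pose e := d / (Q + 1).
have den0 : 0 < Q + 1 by rewrite ltr_wpDl.
have eK : Q * e <= d by rewrite mulrC /e mulrAC ler_pdivrMr// ler_pM2l// lerDl.
by have := H e (divr_gt0 d0 den0); lra.
Qed.

(** Here [sg] is s + 1 and [n] is r - 1. If s <= r, all derivatives beyond the second are used, each
    with a gain of order k/n. If r <= s, orthogonality allows only [n] integrations by parts; then r
    <= m, and the missing powers of r are bounded by powers of [m], part of the constant. *)
Lemma nrm_rho_le (sg W : R) : 1 <= sg - 1 -> Num.truncn sg = m ->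
  (W_norm J sg U <= W%:E)%E ->
  nrm rho <= s * ((m%:R ^+ m * 2 `^ (sg - 2) + m%:R `^ (sg - 2)) *
    (k `^ (Num.min n.+1%:R (sg - 1) - 1) / n.+1%:R `^ (sg - 2))) * W.
Proof.
move=> sg1 tr UW; set C := _ + _; set G := C * _.
have sg0 : 0 <= sg by lra.
have /andP[msg sgm] : m%:R <= sg < m.+1%:R by rewrite -tr truncn_itv.
rewrite -natr1 in sgm.
have sg2 : 0 <= sg - 2 by lra.
have n0' : 0 < n%:R :> R by rewrite ltr0n.
have r0 : 0 < n.+1%:R :> R by rewrite ltr0n.
have m1 : 1 <= m%:R :> R by rewrite ler1n ltnW.
have m0 : 0 <= m%:R :> R by lra.
have mm1 : 1 <= m%:R ^+ m :> R by rewrite exprn_ege1.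
have rp : 0 < n.+1%:R `^ (sg - 2) :> R by rewrite powR_gt0.
have tau0 := kn0; have prodm := prod_le; set tau := k / n%:R in prodm tau0.
have C10 : 0 <= m%:R ^+ m * 2 `^ (sg - 2) :> R by rewrite mulr_ge0 ?powR_ge0 ?exprn_ge0.
have C20 : 0 <= m%:R `^ (sg - 2) :> R by exact: powR_ge0.
(* [m%:R ^+ m] dominates the powers of m from the products, and the power of 2 comes from k/n <= 2
   k/(n + 1). *)
have conv1 : sg - 1 <= n.+1%:R -> m%:R ^+ m * tau `^ (sg - 2) <= G.
  move=> sr; rewrite /G /Num.min ltNge sr /=.
  have -> : sg - 1 - 1 = sg - 2 by ring.
  have t2 : tau <= 2 * k / n.+1%:R.
    rewrite /tau ler_pdivrMr// mulrAC ler_pdivlMr// [2 * k]mulrC -mulrA ler_pM2l//.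
    by rewrite -natrM ler_nat mul2n -addnn -addn1 leq_add2l.
  have : tau `^ (sg - 2) <= (2 * k / n.+1%:R) `^ (sg - 2).
    by apply: ge0_ler_powR => //; rewrite nnegrE ?(ltW tau0)// divr_ge0// mulr_ge0 ?(ltW k0).
  rewrite powRM ?mulr_ge0 ?invr_ge0 ?(ltW k0)// powRM ?(ltW k0)// -powR_inv1 ?(ltW r0)//.
  rewrite -powRrM mulN1r powRN => h.
  apply: (le_trans (ler_wpM2l (le_trans ler01 mm1) h)).
  have kk : 0 <= k `^ (sg - 2) / n.+1%:R `^ (sg - 2) by rewrite divr_ge0 ?powR_ge0.
  have := mulr_ge0 C20 kk; rewrite /C; lra.
have conv2 : n.+1%:R <= sg - 1 -> (n.+1 <= m)%N -> k ^+ n <= G.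
  move=> rs nm; rewrite /G; have -> : Num.min n.+1%:R (sg - 1) = n.+1%:R by apply/min_idPl.
  rewrite -natr1 addrK powR_mulrn ?(ltW k0)//.
  have kn : 0 <= k ^+ n by rewrite exprn_ge0 ?(ltW k0).
  have : n.+1%:R `^ (sg - 2) <= m%:R `^ (sg - 2) :> R.
    by apply: ge0_ler_powR => //; rewrite ?nnegrE// ler_nat.
  rewrite natr1 => h; rewrite mulrCA ler_peMr// ler_pdivlMr// mul1r (le_trans h)//.
  by rewrite /C lerDr.
have G0 : 0 <= G.
  by rewrite /G mulr_ge0 ?addr_ge0// divr_ge0 ?powR_ge0.
have [Wneg|W0] := ltP W 0.
  exfalso; move: UW; rewrite /W_norm tr; case: ifP => [_|th] UW.
    by have := le_trans (Wint_norm_ge0 J m U) UW; rewrite lee_fin leNgt Wneg.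
  have tn0 : sg - m%:R != 0 by rewrite th.
  have UW' : (W_norm J sg U <= W%:E)%E by rewrite /W_norm tr th.
  have [v0 [v1 [B0 [B1 [_ [B00 B10] _ _]]]]] := W_norm_couple tr tn0 UW' ltr01 (e := - W / 2) ltac:(lra).
  by rewrite powR1 mul1r => h; lra.
have prodn : \prod_(l < n) (k / (n - l)%:R) <= k ^+ n.
  apply: (le_trans (prod_div_le ab (leqnn n))).
  by rewrite mulrC divfK// gt_eqF.
have p2 j : (j = m - 2)%N -> sg - m%:R = 0 -> tau ^+ j = tau `^ (sg - 2).
  move=> -> th; rewrite -powR_mulrn ?(ltW tau0)// natrB//; congr powR; lra.
have [th|th] := eqVneq (sg - m%:R) 0.
  have {}UW : (Wint_norm J m U <= W%:E)%E by move: UW; rewrite /W_norm tr th eqxx.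
  have [mn|nm] := leqP (m - 2) n.
    apply: (le_trans (rho_single mn _ UW)); first by rewrite -addn2 subnK.
    rewrite ler_wpM2r// ler_wpM2l// (le_trans (prodm _ mn _)) ?leq_subr//.
    rewrite exprMn (p2 _ erefl th); apply: le_trans (conv1 _).
      by rewrite ler_wpM2r ?powR_ge0// ler_weXn2l// leq_subr.
    have : m%:R <= (n + 2)%:R :> R by rewrite ler_nat addnC -leq_subLR.
    by rewrite natrD -natr1; lra.
  have nm2 : (n.+2 < m)%N by move: nm; rewrite ltn_subRL add2n.
  apply: (le_trans (rho_single (leqnn n) _ UW)).
    exact: ltnW.
  rewrite ler_wpM2r// ler_wpM2l// (le_trans prodn)//; apply: conv2.
    have : n.+2%:R <= m%:R :> R by rewrite ler_nat ltnW.
    by rewrite -natr1; lra.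
  by rewrite ltnW// ltnW.
have sQ : 0 <= s * G by rewrite mulr_ge0.
apply: le_mul_add => // e e0.
have [mn|nm] := leqP (m - 1) n.
  have pt : 0 < tau `^ (sg - m%:R) by rewrite powR_gt0.
  (* The smoother part [v1] admits one more integration by parts, with gain of order tau = k/n; the
     K-functional at this very tau balances the two parts. *)
  have [v0 [v1 [B0 [B1 [Uv [B00 B10] v0B v1B BW]]]]] :=
    W_norm_couple tr th UW tau0 (mulr_gt0 pt e0).
  have mn2 : (m - 2 <= n)%N by rewrite (leq_trans _ mn)// leq_sub2l.
  apply: (le_trans (rho_couple mn2 _ mn _ Uv B00 B10 v0B v1B)).
  - by rewrite -addn2 subnK.
  - by rewrite subn1 prednK// ltnW.
  have m1E : (m - 1 = (m - 2).+1)%N by rewrite -subSn.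
  have h0 := prodm _ mn2 (leq_subr _ _); have h1 := prodm _ mn (leq_subr _ _).
  have mt0 : 0 <= m%:R * tau by rewrite mulr_ge0 ?(ltW tau0).
  have p0 : 0 <= s * (m%:R ^+ m * tau ^+ (m - 2)).
    by rewrite !mulr_ge0 ?exprn_ge0 ?(ltW tau0).
  apply: (@le_trans _ _ (s * (m%:R ^+ m * tau ^+ (m - 2)) * (B0 + tau * B1))).
    rewrite mulrDr lerD//.
      rewrite ler_wpM2r// ler_wpM2l// (le_trans h0)// exprMn.
      by rewrite ler_wpM2r ?exprn_ge0 ?(ltW tau0)// ler_weXn2l// leq_subr.
    rewrite mulrA ler_wpM2r// -mulrA ler_wpM2l// (le_trans h1)// exprMn.
    rewrite {2}m1E exprSr mulrA ler_wpM2r ?(ltW tau0)//.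
    by rewrite ler_wpM2r ?exprn_ge0 ?(ltW tau0)// ler_weXn2l// leq_subr.
  apply: (le_trans (ler_wpM2l p0 BW)).
  rewrite -mulrDr.
  have We : 0 <= W + e by rewrite addr_ge0// ltW.
  have pE : tau ^+ (m - 2) * tau `^ (sg - m%:R) = tau `^ (sg - 2).
    rewrite -powR_mulrn ?(ltW tau0)// -powRD; last by rewrite (gt_eqF tau0) implybT.
    by rewrite natrB//; congr powR; ring.
  rewrite (_ : s * (m%:R ^+ m * tau ^+ (m - 2)) * (tau `^ (sg - m%:R) * (W + e)) = s * (m%:R ^+ m * (tau ^+ (m - 2) * tau `^ (sg - m%:R))) * (W + e)); last by ring.
  rewrite pE ler_wpM2r// ler_wpM2l// conv1//.
  have : m%:R <= (n + 1)%:R :> R by rewrite ler_nat addnC -leq_subLR.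
  by rewrite natrD -natr1; lra.
(* Both parts admit the same number [n] of integrations by parts, so they are weighted equally and
   the K-functional is taken at 1. *)
have [v0 [v1 [B0 [B1 [Uv [B00 B10] v0B v1B]]]]] := W_norm_couple tr th UW ltr01 e0.
rewrite powR1 !mul1r => BW.
have nm1 : (n.+1 < m)%N by move: nm; rewrite ltn_subRL add1n.
apply: (le_trans (rho_couple (leqnn n) nm1 (leqnn n) (ltnW nm1) Uv B00 B10 v0B v1B)).
rewrite -mulrDr; apply: ler_pM => //.
- rewrite mulr_ge0//; apply: prodr_ge0 => l _; rewrite divr_ge0 ?(ltW k0)//.
- exact: addr_ge0.
- rewrite ler_wpM2l// (le_trans prodn)//; apply: conv2 => //; last exact: ltnW.
  have : n.+2%:R <= m%:R :> R by rewrite ler_nat.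
  by rewrite -natr1; lra.
Qed.

End Approximation.

(** * Regularity at the nodes *)

Section Jump.
Variables (R : realType) (a c b : R).
Hypotheses (ac : a < c) (cb : c < b).
Implicit Types (f g v w u chi : R -> R) (x y : R) (p q r P Q : {poly R}).

Notation mu := (@lebesgue_measure R).
Notation I v := (\int[mu]_(x in `]a, b[) (v x)%R).
Notation integrable v := (mu.-integrable `]a, b[ (EFin \o v)).

Let ab : a < b. Proof. exact: lt_trans cb. Qed.

Definition glue f g x : R := if x < c then f x else g x.

Lemma glue_measurable f g (D : set R) : contR f -> contR g -> measurable_fun D (glue f g).
Proof.
move=> cf cg; apply: measurable_funTS; apply: measurable_fun_ifT.
- by apply: measurable_fun_ltr; [exact: measurable_id|exact: measurable_cst].
- exact: contR_measurable.
- exact: contR_measurable.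
Qed.

Lemma glue_integrable f g : contR f -> contR g -> integrable (glue f g).
Proof.
move=> cf cg; have [K K0 HK] := contR_bounded ab cf; have [K' K'0 HK'] := contR_bounded ab cg.
apply: measurable_bounded_integrable => //.
- by rewrite /= lebesgue_measure_itv/= lte_fin ab -EFinB ltry.
- exact: glue_measurable.
- exists (K + K'); split; first exact: num_real.
  move=> M KM x /itv_oo_le xab; apply: (le_trans _ (ltW KM)); rewrite /glue.
  by case: ifP => _; [have := HK x xab|have := HK' x xab]; lra.
Qed.

Lemma Rintegral_glue f g h : contR f -> contR g -> contR h ->
  I (fun x => glue f g x * h x) =
  itg a c (fun x => f x * h x) + itg c b (fun x => g x * h x).
Proof.
move=> cf cg ch.
have E : (fun x => glue f g x * h x) = glue (fun x => f x * h x) (fun x => g x * h x).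
  by apply/funext => x; rewrite /glue; case: ifP.
have i1 : integrable (glue (fun x => f x * h x) (fun x => g x * h x)).
  by apply: glue_integrable; exact: contM.
rewrite E -(Rintegral_itg (ltW ac) (contM cf ch)) -(Rintegral_itg (ltW cb) (contM cg ch)).
have bc : (BRight a <= BRight c)%O by rewrite bnd_simp ltW.
have cB : (BRight c <= BLeft b)%O by rewrite bnd_simp.
have := Rintegral_itvB i1 bc cB => /eqP; rewrite subr_eq => /eqP ->; rewrite addrC.
congr (_ + _); last first.
  apply: eq_Rintegral => x; rewrite inE/= in_itv/= => /andP[cx _].
  by rewrite /glue ltNge (ltW cx).
rewrite -Rintegral_itv_bndo_bndc; last first.
  apply: integrableS i1 => // x /=; rewrite !in_itv/= => /andP[-> xc]/=.
  exact: (lt_trans xc cb).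
by apply: eq_Rintegral => x; rewrite inE/= in_itv/= => /andP[_ xc]; rewrite /glue xc.
Qed.

(** Double zeros at both ends, so that two derivatives can be moved onto a multiple of it without
    boundary terms. *)
Definition bump_poly : {poly R} := ('X - a%:P) ^+ 2 * ('X - b%:P) ^+ 2.

Lemma bump_poly0 r : [/\ (bump_poly * r).[a] = 0, (bump_poly * r).[b] = 0,
  (bump_poly * r)^`().[a] = 0 & (bump_poly * r)^`().[b] = 0].
Proof.
have e : bump_poly * r = ('X - a%:P) * (('X - a%:P) * ('X - b%:P) ^+ 2 * r).
  by rewrite /bump_poly; ring.
have e' : bump_poly * r = ('X - b%:P) * (('X - b%:P) * ('X - a%:P) ^+ 2 * r).
  by rewrite /bump_poly; ring.
split.
- by rewrite e hornerM hornerXsubC subrr mul0r.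
- by rewrite e' hornerM hornerXsubC subrr mul0r.
- rewrite e derivM derivXsubC mul1r hornerD [in X in _ + X]hornerM hornerXsubC subrr mul0r addr0.
  by rewrite -mulrA hornerM hornerXsubC subrr mul0r.
- rewrite e' derivM derivXsubC mul1r hornerD [in X in _ + X]hornerM hornerXsubC subrr mul0r addr0.
  by rewrite -mulrA hornerM hornerXsubC subrr mul0r.
Qed.

(* The polynomials [bump_poly * peak m] concentrate at [c]. *)
Definition peak m : {poly R} := (1 - (b - a) ^- 2 *: ('X - c%:P) ^+ 2) ^+ m.

Lemma peakE m x : (peak m).[x] = (1 - (b - a) ^- 2 * (x - c) ^+ 2) ^+ m.
Proof. by rewrite /peak !hornerE. Qed.

Lemma peakc m : (peak m).[c] = 1.
Proof. by rewrite peakE subrr expr0n/= mulr0 subr0 expr1n. Qed.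

Lemma peak_base x : a < x < b ->
  0 <= 1 - (b - a) ^- 2 * (x - c) ^+ 2 /\ 1 - (b - a) ^- 2 * (x - c) ^+ 2 <= 1.
Proof.
move=> /andP[ax xb]; have ba0 : 0 < (b - a) ^+ 2 by rewrite exprn_gt0// subr_gt0.
split; last by rewrite lerBlDr lerDl mulr_ge0 ?invr_ge0 ?sqr_ge0.
rewrite subr_ge0 ler_pdivrMl// mulr1 -[leLHS]real_normK ?num_real//.
have xc : `|x - c| <= b - a.
  by have := ac; have := cb; rewrite ler_norml => ? ?; apply/andP; split; lra.
by apply: lerXn2r => //; rewrite nnegrE ?subr_ge0 ?(ltW ab).
Qed.

(** An integrable function carries no point mass. For [r] equal to [peak m] the left side stays at a
    fixed nonzero multiple of [D], while the right side tends to 0 because the peaks tend to 0 away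
    from c. *)
Lemma integral_peak_eq0 v (D : R) : integrable v ->
  (forall r, D * (bump_poly * r).[c] = I (fun x => v x * (bump_poly * r).[x])) ->
  D = 0.
Proof.
move=> iv H; have bc : 0 < bump_poly.[c].
  rewrite /bump_poly hornerM !horner_exp !hornerXsubC.
  by rewrite mulr_gt0// exprn_even_gt0//= subr_eq0 ?(gt_eqF ac) ?(lt_eqF cb).
have [K K0 HK] := contR_bounded ab (cont_horner bump_poly).
have cv : I (fun x => v x * (bump_poly * peak m).[x]) @[m --> \oo] -->
    I (fun x => v x * 0).
  apply: (@dct_mul_ae _ _ _ ab v (fun m x => (bump_poly * peak m).[x]) (fun=> 0) K iv).
  - by move=> m; exact: cont_horner.
  - exact: cont_cst.
  - exists [set c]; split => //; first by rewrite lebesgue_measure_set1.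
    move=> x /= Hx; apply: contrapT => xc; apply: Hx => xab.
    have -> : (fun m => (bump_poly * peak m).[x]) =
        (fun m => bump_poly.[x] * (1 - (b - a) ^- 2 * (x - c) ^+ 2) ^+ m).
      by apply/funext => m; rewrite hornerM peakE.
    rewrite -(mulr0 bump_poly.[x]); apply: cvg_seqM; first exact: cvg_seq_cst.
    apply: cvg_expr.
    have [h0 h1] := peak_base xab; rewrite ger0_norm// ltrBlDr ltrDl.
    apply: mulr_gt0; first by rewrite invr_gt0 exprn_gt0// subr_gt0.
    by rewrite lt_neqAle sqr_ge0 andbT eq_sym sqrf_eq0 subr_eq0; apply/eqP.
  - move=> m x xab; rewrite hornerM normrM -[K]mulr1 ler_pM ?HK//.
      by case/andP: xab => ? ?; rewrite !ltW.
    have [h0 h1] := peak_base xab.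
    by rewrite peakE normrX (ger0_norm h0) exprn_ile1.
move: cv; under eq_Rintegral do rewrite mulr0.
rewrite Rintegral_cst// mul0r.
have -> : (fun m => I (fun x => v x * (bump_poly * peak m).[x])) = (fun=> D * bump_poly.[c]).
  by apply/funext => m; rewrite -H hornerM peakc mulr1.
move=> cv; have /eqP : D * bump_poly.[c] = 0.
  by apply: (cvg_unique (@Rhausdorff R) (@cvg_seq_cst _ (D * bump_poly.[c])) cv).
by rewrite mulf_eq0 (gt_eqF bc) orbF => /eqP.
Qed.

(** Integrating by parts on each side of c leaves the jump times the test polynomial at c;
    everything else is an integral against an integrable function. *)
Lemma glue_jump P Q w : integrable w ->
  (forall r, I (fun x => glue (horner P) (horner Q) x * (bump_poly * r)^`().[x]) =
     - I (fun x => w x * (bump_poly * r).[x])) ->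
  P.[c] = Q.[c].
Proof.
move=> iw H; apply/eqP; rewrite -subr_eq0; apply/eqP.
pose V := glue (horner P^`()) (horner Q^`()).
have iV : integrable V by apply: glue_integrable; exact: cont_horner.
have iv : integrable (fun x => V x - w x).
  rewrite (_ : EFin \o _ = (EFin \o V) \- (EFin \o w))%E; first exact: integrableB.
  by apply/funext => x /=; rewrite EFinB.
apply: (integral_peak_eq0 iv) => r; set q := bump_poly * r.
have [qa qb _ _] := bump_poly0 r; rewrite -/q in qa qb.
have -> : I (fun x => (V x - w x) * q.[x]) = I (fun x => V x * q.[x]) - I (fun x => w x * q.[x]).
  have cq := cont_horner q.
  rewrite -RintegralB//; [|exact: (integrable_mul_cont ab)..].
  by apply: eq_Rintegral => x _; rewrite mulrBl.
have := H r; rewrite -/q !Rintegral_glue; [|exact: cont_horner..].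
rewrite (itg_ibp a c (fun x => is_derive_poly P x) (fun x => is_derive_poly q x)); [|exact: cont_horner..].
rewrite (itg_ibp c b (fun x => is_derive_poly Q x) (fun x => is_derive_poly q x)); [|exact: cont_horner..].
by rewrite qa qb; lra.
Qed.

Lemma in_L2_integrable (J : set R) v : in_Lp J 2%:E v -> `]a, b[ `<=` J -> integrable v.
Proof.
move=> vL JJ; have mv := in_Lp_measurable vL JJ.
have iv2 := Lfun2_integrable_sqr vL.
have fin : (mu `]a, b[ < +oo)%E by rewrite /= lebesgue_measure_itv/= lte_fin ab -EFinB ltry.
have i2 : integrable (fun x => v x ^+ 2 + 1).
  rewrite (_ : EFin \o _ = (EFin \o (fun x => v x ^+ 2)%R) \+ (EFin \o cst 1%R))%E; last first.
    by apply/funext => x /=; rewrite EFinD.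
  apply: integrableD => //; last first.
    apply: integrableS (continuous_itv_integrable a b (cont_cst 1)) => //.
    exact: subset_itv_oo_cc.
  have : mu.-integrable `]a, b[ (EFin \o (fun x => (v \_ J) x ^+ 2)%R) by apply: integrableS iv2.
  apply: eq_integrable => // x; rewrite inE => xab /=.
  by rewrite patchE mem_set//; exact: JJ.
apply: le_integrable i2 => //; first exact/measurable_EFinP.
move=> x xab /=; rewrite lee_fin [leRHS]ger0_norm ?addr_ge0 ?sqr_ge0//.
rewrite -[_ ^+ 2]real_normK ?num_real//; have := sqr_ge0 (`|v x| - 1 / 2); lra.
Qed.

Lemma in_W2_C1 (J : set R) (U : R -> R) P Q : `]a, b[ `<=` J -> in_W J 2 2%:E U ->
  (forall x, a < x < c -> U x = P.[x]) -> (forall x, c < x < b -> U x = Q.[x]) ->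
  P.[c] = Q.[c] /\ P^`().[c] = Q^`().[c].
Proof.
move=> JJ [g Hg] UP UQ; have [_ /in_L2_integrable/(_ JJ) i1] := Hg 1%N isT.
have [_ /in_L2_integrable/(_ JJ) i2] := Hg 2%N isT.
have i0 : integrable (glue (horner P) (horner Q)).
  by apply: glue_integrable; exact: cont_horner.
have H1 chi : test_function `]a, b[ chi ->
    I (fun x => glue (horner P) (horner Q) x * chi^`()%classic x) = - I (fun x => g 1%N x * chi x).
  move=> tchi; have [H _] := Hg 1%N isT; have := weak_derivative_sub JJ H tchi.
  rewrite expr1 mulN1r => <-; rewrite /Rintegral; congr fine.
  have [mU oJ _] : locally_integrable J U by case: H.
  have mU' : measurable_fun `]a, b[ U.
    by apply: measurable_funS mU => //; exact: open_measurable.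
  have cchi := test_function_cont (test_function_derive tchi).
  apply: ae_eq_integral => //.
  - apply/measurable_EFinP; apply: measurable_funM; last exact: contR_measurable.
    by apply: glue_measurable; exact: cont_horner.
  - by apply/measurable_EFinP; apply: measurable_funM => //; exact: contR_measurable.
  - exists [set c]; split => //; first exact: lebesgue_measure_set1.
    move=> x /= Hx; apply: contrapT => xc; apply: Hx; rewrite in_itv/= => /andP[ax xb].
    rewrite /glue; case: ltP => [xlc|cx]; first by rewrite UP ?ax.
    by rewrite UQ ?xb ?andbT// lt_neqAle cx andbT; apply/eqP => h; apply: xc.
have PQ : P.[c] = Q.[c].
  apply: (glue_jump i1) => r; have [qa qb _ _] := bump_poly0 r.
  exact: (weak_derive_horner ab).
(* For the derivatives, the first-order relation is applied to the derivative of [q]: the terms with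
   the values at c cancel by [PQ], which leaves the relation of [glue_jump] for P' and Q'. *)
split => //; apply: (glue_jump i2) => r; set q := bump_poly * r.
have [qa qb q'a q'b] := bump_poly0 r; rewrite -/q in qa qb q'a q'b.
have E1 := weak_derive_horner ab i0 i1 H1 q'a q'b.
have E2 : I (fun x => g 1%N x * q^`().[x]) = - I (fun x => g 2%N x * q.[x]).
  apply: (weak_derive_horner ab) => // chi tchi.
  have [W1 _] := Hg 1%N isT; have [W2 _] := Hg 2%N isT.
  exact: weak_derivative_step JJ W1 W2 tchi.
move: E1; rewrite -E2 !Rintegral_glue; [|exact: cont_horner..].
rewrite (itg_ibp a c (fun x => is_derive_poly P x) (fun x => is_derive_poly q^`() x)); [|exact: cont_horner..].
rewrite (itg_ibp c b (fun x => is_derive_poly Q x) (fun x => is_derive_poly q^`() x)); [|exact: cont_horner..].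
by rewrite q'a q'b PQ; lra.
Qed.

End Jump.

(** * The initial value problem *)

Section OneSided.
Variable R : realType.
Implicit Types (g h : R -> R) (x y l s t : R) (A : set R).

Lemma has_derivative_in_near A g x l : has_derivative_in A g x l -> forall e : R, 0 < e ->
  exists2 d : R, 0 < d & forall y, A y -> `|y - x| < d ->
    `|g y - g x - l * (y - x)| <= e * `|y - x|.
Proof.
move=> H e e0; have /cvgrPdist_lt/(_ _ e0) := H.
rewrite /within/= near_withinE/= => /nbhs_ballP[d /= d0 Hd]; exists d => // y Ay yx.
have [->|ynx] := eqVneq y x; first by rewrite !subrr mulr0 subrr normr0 mulr0.
have y0 : y - x != 0 by rewrite subr_eq0.
have yy0 : 0 < `|y - x| by rewrite normr_gt0.
have xy : ball x d y by rewrite /ball/= distrC.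
have /ltW := Hd y xy ynx Ay.
by rewrite -(ler_pM2r yy0) -normrM mulrBl divfK// distrC.
Qed.

Lemma has_derivative_in_continuous A g x l : has_derivative_in A g x l ->
  g y @[y --> within A (nbhs x)] --> g x.
Proof.
move=> /has_derivative_in_near/(_ 1 ltr01)[d d0 Hd].
apply/cvgrPdist_lt => e e0; rewrite near_withinE; apply/nbhs_ballP.
have l1 : 0 < `|l| + 1 by rewrite ltr_wpDl.
exists (Num.min d (e / (`|l| + 1))) => /=; first by rewrite lt_min d0 divr_gt0.
move=> y; rewrite /ball/= lt_min => /andP[yd ye] Ay; rewrite distrC in yd ye.
have := Hd y Ay yd; rewrite mul1r => h.
rewrite ltr_pdivlMr// in ye.
have h2 : `|g y - g x| <= `|g y - g x - l * (y - x)| + `|l * (y - x)|.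
  by rewrite -[X in `|X| <= _](subrK (l * (y - x))) ler_normD.
rewrite normrM in h2; rewrite distrC; lra.
Qed.

Lemma has_derivative_in_is_derive A g x l : nbhs x A -> has_derivative_in A g x l ->
  is_derive x 1 g l.
Proof.
move=> /nbhs_ballP[d1 /= d10 Ad] H.
have cv : h^-1 *: ((g \o shift x) (h *: (1 : R)) - g x) @[h --> 0^'] --> l.
  apply/cvgrPdist_le => e e0; have [d d0 Hd] := has_derivative_in_near H e0.
  near=> h.
  have h0 : h != 0 by near: h; exact: nbhs_dnbhs_neq.
  have hh0 : 0 < `|h| by rewrite normr_gt0.
  have hd : `|h| < d by near: h; apply: dnbhs0_lt.
  have hd1 : `|h| < d1 by near: h; apply: dnbhs0_lt.
  have A1 : A (h + x) by apply: Ad; rewrite /ball/= opprD addrCA subrr addr0 normrN.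
  have := Hd _ A1; rewrite addrK => /(_ hd) {}Hd.
  rewrite /= /GRing.scale/= mulr1 distrC -(ler_pM2r hh0) -normrM mulrBl.
  by rewrite [h^-1 * _]mulrC divfK.
by apply: DeriveDef; [exact: cvgP cv|exact: cvg_lim cv].
Unshelve. all: by end_near. Qed.

Lemma mvt_in A g h s t : s < t -> (forall x, s <= x <= t -> A x) ->
  (forall x, s <= x <= t -> has_derivative_in A g x (h x)) ->
  exists2 c, s <= c <= t & g t - g s = h c * (t - s).
Proof.
move=> st sA H.
have dg x : x \in `]s, t[ -> is_derive x 1 g (h x).
  move=> xst; apply: (@has_derivative_in_is_derive A); last first.
    by apply: H; move: xst; rewrite in_itv/= => /andP[? ?]; rewrite !ltW.
  apply: filterS (near_in_itvoo xst) => y; rewrite in_itv/= => /andP[? ?].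
  by apply: sA; rewrite !ltW.
have cg : {within `[s, t], continuous g}.
  apply/subspace_continuousP => x /=; rewrite in_itv/= => /H /has_derivative_in_continuous.
  apply: cvg_trans; apply: cvg_app; apply: within_subset => y /=; rewrite in_itv; exact: sA.
have [c] := MVT st dg cg; rewrite in_itv/= => /andP[sc ct] E.
by exists c => //; rewrite !ltW.
Qed.

Lemma increment_in_le A g h s t (K : R) : (forall x, s <= x <= t \/ t <= x <= s -> A x) ->
  (forall x, s <= x <= t \/ t <= x <= s -> has_derivative_in A g x (h x)) ->
  (forall x, s <= x <= t \/ t <= x <= s -> `|h x| <= K) ->
  `|g t - g s| <= K * `|t - s|.
Proof.
move=> sA H hK.
case: (ltgtP s t) => [st|ts|->]; last by rewrite !subrr normr0 mulr0.
  have [|x sx|c sc ->] := @mvt_in A g h s t st; [by move=> x sx; apply: sA; left|by apply: H; left|].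
  by rewrite normrM ler_wpM2r// hK//; left.
have [|x sx|c sc] := @mvt_in A g h t s ts; [by move=> x sx; apply: sA; right|by apply: H; right|].
rewrite distrC [`|t - s|]distrC => ->.
by rewrite normrM ler_wpM2r// hK//; right.
Qed.

Lemma eq_prim_in (a b : R) g h G H : (forall x, a <= x <= b -> has_derivative_in `[a, b] g x (h x)) ->
  is_prim H G -> (forall x, a <= x <= b -> H x = h x) -> g a = G a ->
  forall x, a <= x <= b -> g x = G x.
Proof.
move=> dg HG Hh ga x /andP[ax xb].
move: ax; rewrite le_eqVlt => /orP[/eqP <-//|ax].
have sub y : a <= y <= x -> a <= y <= b by move=> /andP[-> yx]/=; exact: le_trans xb.
have dgG y : y \in `]a, x[ -> is_derive y 1 (fun z => g z - G z) 0.
  rewrite in_itv/= => /andP[ay yx]; rewrite -[0](subrr (h y)).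
  have yab : a <= y <= b by apply: sub; rewrite !ltW.
  apply: is_deriveB; last by rewrite -Hh//; exact: HG.
  apply: has_derivative_in_is_derive (dg _ yab).
  have yi : y \in `]a, b[ by rewrite in_itv/= ay (lt_le_trans yx).
  by apply: filterS (near_in_itvoo yi) => z; rewrite /= !in_itv/= => /andP[? ?]; rewrite !ltW.
have cgG : {within `[a, x], continuous (fun z => g z - G z)}.
  apply/subspace_continuousP => y /=; rewrite in_itv/= => /sub yab; apply: cvgB; last first.
    by apply: cvg_within_filter; exact: (is_prim_continuous HG).
  have := has_derivative_in_continuous (dg _ yab).
  apply: cvg_trans; apply: cvg_app; apply: within_subset => z /=; rewrite !in_itv; exact: sub.
have [c _] := MVT ax dgG cgG; rewrite mul0r ga subrr subr0 => /eqP.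
by rewrite subr_eq0 => /eqP.
Qed.

Lemma between_itv (a b s t x : R) : a <= s <= b -> a <= t <= b ->
  s <= x <= t \/ t <= x <= s -> a <= x <= b.
Proof.
by move=> /andP[? ?] /andP[? ?] [/andP[? ?]|/andP[? ?]]; apply/andP; split; lra.
Qed.

Lemma between_dist (a x z : R) : a - z <= x <= a \/ a <= x <= a - z -> `|x - a| <= `|z|.
Proof.
by move=> [/andP[? ?]|/andP[? ?]]; case: (ger0P (x - a)) => ?; case: (ger0P z) => ?; lra.
Qed.

End OneSided.

(** * Extension from [0, T] to the line *)

Section Clamp.
Variables (R : realType) (T : R).
Hypothesis T0 : 0 < T.
Implicit Types (v w g : R -> R) (x y : R).

(** The nearest-point map onto [0, T], written with absolute values so that continuity is
    immediate. *)
Definition clamp x : R := (T + `|x| - `|x - T|) / 2.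

Lemma cont_clamp : contR clamp.
Proof. by rewrite /clamp; cont. Qed.

Lemma clamp_itv x : 0 <= clamp x <= T.
Proof.
have := T0; rewrite /clamp; case: (ger0P x) => ? ?; case: (ger0P (x - T)) => ?; apply/andP; split; lra.
Qed.

Lemma clamp_id x : 0 <= x <= T -> clamp x = x.
Proof.
move=> /andP[x0 xT]; rewrite /clamp ger0_norm// ler0_norm ?subr_le0//; lra.
Qed.

Lemma contR_comp_in (X Y : topologicalType) (A : set X) (F : X -> Y) (g : R -> X) :
  {within A, continuous F} -> (forall x, A (g x)) -> (forall x, {for x, continuous g}) ->
  forall x, {for x, continuous (fun y => F (g y))}.
Proof.
move=> /subspace_continuousP cF gA cg x.
apply: (@cvg_comp _ _ _ g F (nbhs x) (within A (nbhs (g x)))); last exact: cF (gA x).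
move=> P; rewrite /within/= => H; have {H} := cg x _ H.
by apply: (@filterS _ (nbhs x)) => y; apply; exact: gA.
Qed.

Lemma contR_clamp g h : (forall x, 0 <= x <= T -> has_derivative_in `[0, T] g x (h x)) ->
  contR (fun x => g (clamp x)).
Proof.
move=> dg; apply: (@contR_comp_in _ _ `[0, T]%classic g clamp).
- apply/subspace_continuousP => x /=; rewrite in_itv/= => /dg.
  exact: has_derivative_in_continuous.
- by move=> x /=; rewrite in_itv; exact: clamp_itv.
- exact: cont_clamp.
Qed.

Lemma contR_clamp3 (F : R -> R -> R -> R) v w :
  {within `[0, T] `*` setT `*` setT, continuous (fun z : R * R * R => F z.1.1 z.1.2 z.2)} ->
  contR v -> contR w -> contR (fun x => F (clamp x) (v x) (w x)).
Proof.
move=> cF cv cw.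
apply: (@contR_comp_in _ _ _ (fun z : R * R * R => F z.1.1 z.1.2 z.2)
  (fun x => (clamp x, v x, w x)) cF).
- by move=> x /=; split => //; split => //; rewrite in_itv; exact: clamp_itv.
- move=> x.
  have c2 : (clamp y, v y) @[y --> x] --> (clamp x, v x).
    apply: (@cvg_pair _ _ _ (nbhs x) (nbhs (clamp x)) (nbhs (v x)) _ _ _ clamp v); [exact: cont_clamp|exact: cv].
  by apply: (@cvg_pair _ _ _ (nbhs x) (nbhs (clamp x, v x)) (nbhs (w x)) _ _ _ (fun y => (clamp y, v y)) w); [exact: c2|exact: cw].
Qed.

Lemma box_bounded (F : R -> R -> R -> R) (B : R) :
  {within `[0, T] `*` setT `*` setT, continuous (fun z : R * R * R => F z.1.1 z.1.2 z.2)} ->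
  exists2 K, 0 <= K & forall t x y, 0 <= t <= T -> `|x| <= B -> `|y| <= B -> `|F t x y| <= K.
Proof.
move=> cF; pose A : set (R * R * R) := `[0, T] `*` `[- B, B] `*` `[- B, B].
have cA : compact A by apply: compact_setX; [apply: compact_setX|]; exact: segment_compact.
have cFA : {within A, continuous (fun z : R * R * R => F z.1.1 z.1.2 z.2)}.
  by apply: continuous_subspaceW cF => z [[? _] _].
have [M [_ HM]] := compact_bounded (continuous_compact cFA cA).
exists (`|M| + 1) => [|t x y tT xB yB]; first by rewrite addr_ge0.
apply: (HM (`|M| + 1)); first by rewrite (le_lt_trans (ler_norm M))// ltrDl.
exists (t, x, y) => //; rewrite /A/=; do !split; rewrite ?in_itv//=.
- by rewrite -ler_norml.
- by rewrite -ler_norml.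
Qed.

End Clamp.

Lemma is_prim_addl (R : realType) (f F : R -> R) c : is_prim f F -> is_prim f (fun x => c + F x).
Proof.
by move=> H x; have := is_deriveD (is_derive_cst c x 1) (H x); rewrite add0r.
Qed.

(** * The exact solution and the linearisation of f along it *)

Section IVP.
Variables (R : realType) (T u0 u1 L : R) (f : R -> R -> R -> R) (u : R -> R).
Hypotheses (T0 : 0 < T) (L0 : 0 < L).
Hypothesis fL : forall t x1 y1 x2 y2, 0 <= t <= T ->
  `|f t x1 y1 - f t x2 y2| <= L * (`|x1 - x2| + `|y1 - y2|).
Hypothesis fC : class_C 2 T f.
Hypothesis uP : exact_solution T f u0 u1 u.

Definition ext_f (t : R) := f (clamp T t).

(* The data of the problem extended from [0, T] to the whole line, together
   with the constants entering the linearisation of [f] along the solution. *)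
Definition ivp_data (v v1 v2 bb : R -> R) (M Mb Lb K : R) : Prop :=
  [/\ is_prim v1 v /\ is_prim v2 v1, contR v2 /\ contR bb,
    [/\ 0 <= M, 0 <= Mb, 0 <= Lb & 0 <= K],
    [/\ forall x, 0 <= x <= T -> u x = v x, v 0 = u0, v1 0 = u1 &
      forall x, 0 <= x <= T -> v2 x = ext_f x (v x) (v1 x)] &
    [/\ forall x, 0 <= x <= T -> `|v2 x| <= M,
      forall x y z, 0 <= x <= T -> `|y| <= 2 * M -> `|z| <= 2 * M ->
        `|ext_f x (v x) (v1 x) - ext_f x (v x - y) (v1 x - z) - bb x * z| <=
        L * `|y| + K * (`|y| + `|z|) * `|z|,
      forall x, 0 <= x <= T -> `|bb x| <= Mb &
      forall x y, 0 <= x <= T -> 0 <= y <= T -> `|bb x - bb y| <= Lb * `|x - y|]].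

Lemma ext_f_cont v w : contR v -> contR w -> contR (fun x => ext_f x (v x) (w x)).
Proof.
case: fC => D [D0 Dc _] cv cw.
have -> : (fun x => ext_f x (v x) (w x)) = (fun x => D 0%N 0%N 0%N (clamp T x) (v x) (w x)).
  by apply/funext => x; rewrite D0// clamp_itv.
by apply: contR_clamp3 => //; exact: Dc.
Qed.

Lemma ivp_data_exists : exists v v1 v2 bb M Mb Lb K, ivp_data v v1 v2 bb M Mb Lb K.
Proof.
have [D [D0 Dc Dd]] := fC; have [du [du0 du1 uu0 uu1]] := uP.
have cu := contR_clamp T0 du0; have cdu := contR_clamp T0 du1.
(* Integrating the right side along the clamped solution defines [v1] and [v] on the whole line; on
   [0, T] they agree with u' and u, having the same derivatives and initial values. *)
pose v2 x := ext_f x (u (clamp T x)) (du (clamp T x)).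
have cv2 : contR v2 by exact: ext_f_cont.
pose v1 x := u1 + itg 0 x v2.
have v1P : is_prim v2 v1.
  by apply: is_prim_addl; exact: is_prim_itg.
have cv1 := is_prim_continuous v1P.
pose v x := u0 + itg 0 x v1.
have vP : is_prim v1 v.
  by apply: is_prim_addl; exact: is_prim_itg.
have cv := is_prim_continuous vP.
have duE x : 0 <= x <= T -> du x = v1 x.
  apply: (eq_prim_in (h := fun x => f x (u x) (du x))) => //.
    by move=> y y0T; rewrite /v2 /ext_f !clamp_id.
  by rewrite uu1 /v1 itgxx addr0.
have uE x : 0 <= x <= T -> u x = v x.
  apply: (eq_prim_in (h := du)) => //; first by move=> y /duE.
  by rewrite uu0 /v itgxx addr0.
pose bb x := D 0%N 0%N 1%N (clamp T x) (v x) (v1 x).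
have cbb : contR bb by apply: contR_clamp3 => //; exact: Dc.
have [M M0 HM] := contR_bounded T0 cv2; have [Mb Mb0 HMb] := contR_bounded T0 cbb.
have [M1 M10 HM1] := contR_bounded T0 cv1; have [M2 M20 HM2] := contR_bounded T0 cv.
(* [B] bounds v, v1 and also the perturbed derivative v1 - z for |z| <= 2 M, so that the derivatives
   of f are only needed on a compact box. *)
pose B := M1 + M2 + 2 * M.
have Dcont i j l : (i + j + l <= 2)%N -> exists2 K, 0 <= K & forall t x y,
    0 <= t <= T -> `|x| <= B -> `|y| <= B -> `|D i j l t x y| <= K.
  by move=> h; apply: box_bounded; exact: Dc.
have [K1 K10 HK1] := Dcont 1%N 0%N 1%N isT.
have [K2 K20 HK2] := Dcont 0%N 1%N 1%N isT.
have [K3 K30 HK3] := Dcont 0%N 0%N 2%N isT.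
have vB x : 0 <= x <= T -> `|v x| <= B by move=> /HM2; rewrite /B; lra.
have v1B x : 0 <= x <= T -> `|v1 x| <= B by move=> /HM1; rewrite /B; lra.
have between (s t x : R) : `|s| <= B -> `|t| <= B -> s <= x <= t \/ t <= x <= s -> `|x| <= B.
  by rewrite !ler_norml; exact: between_itv.
have betweenT (s t x : R) : 0 <= s <= T -> 0 <= t <= T -> s <= x <= t \/ t <= x <= s -> 0 <= x <= T.
  exact: between_itv.
have primL g G (Kg : R) : is_prim g G -> (forall x, 0 <= x <= T -> `|g x| <= Kg) ->
    forall x y, 0 <= x <= T -> 0 <= y <= T -> `|G x - G y| <= Kg * `|x - y|.
  move=> GP gK.
  have le y x : 0 <= x <= T -> 0 <= y <= T -> y <= x -> `|G x - G y| <= Kg * `|x - y|.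
    move=> /andP[x0 xT] /andP[y0 yT]; rewrite le_eqVlt => /orP[/eqP ->|yx].
      by rewrite !subrr normr0 mulr0.
    have [c] := MVT yx (fun z _ => GP z) (continuous_subspaceT (is_prim_continuous GP)).
    rewrite in_itv/= => /andP[yc cx] ->; rewrite normrM ler_wpM2r// gK//.
    by rewrite (le_trans y0 (ltW yc)) (le_trans (ltW cx) xT).
  move=> x y xT yT; case/orP: (le_total x y) => xy; last exact: le.
  by rewrite distrC [`|x - y|]distrC; exact: le.
(* The Lipschitz constant of [bb] comes from varying t, u and u' in turn: K1, K2, K3 bound the
   corresponding second derivatives of f, while M1 and M are the Lipschitz constants of v and v1. *)
exists v, v1, v2, bb, M, Mb, (K1 + K2 * M1 + K3 * M), K3; split => //.
- by split => //; rewrite !addr_ge0// mulr_ge0.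
- split => //; [by rewrite /v itgxx addr0|by rewrite /v1 itgxx addr0|].
  by move=> x xT; rewrite /v2 clamp_id// uE// duE.
split => //.
- move=> x y z xT yM zM; rewrite /ext_f clamp_id//.
  (* The change in u is estimated by the Lipschitz condition. Only the change in u' is expanded,
     with an error quadratic in z. *)
  have E : f x (v x) (v1 x) - f x (v x - y) (v1 x - z) - bb x * z =
      (f x (v x) (v1 x - z) - f x (v x - y) (v1 x - z)) +
      (f x (v x) (v1 x) - f x (v x) (v1 x - z) - bb x * z) by ring.
  rewrite E; apply: (le_trans (ler_normD _ _)); apply: lerD.
    apply: (le_trans (fL _ _ _ _ xT)).
    by rewrite subrr normr0 addr0 opprB addrC subrK.
  apply: (@le_trans _ _ (K3 * `|z| * `|z|)); last first.
    by rewrite ler_wpM2r// ler_wpM2l// lerDr.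
  have zB : `|v1 x - z| <= B.
    by apply: (le_trans (ler_normB _ _)); have := HM1 x xT; rewrite /B; lra.
  have dD a : has_derivative_in setT (fun a => f x (v x) a) a (D 0%N 0%N 1%N x (v x) a).
    have [_ _] := Dd 0%N 0%N 0%N isT x (v x) a xT.
    by rewrite (_ : (fun a => D 0%N 0%N 0%N x (v x) a) = (fun a => f x (v x) a))//; apply/funext => b; rewrite D0.
  have bbE a : v1 x - z <= a <= v1 x \/ v1 x <= a <= v1 x - z ->
      `|D 0%N 0%N 1%N x (v x) a - bb x| <= K3 * `|z|.
    move=> ha; rewrite /bb clamp_id//.
    have aB : `|a| <= B by apply: between ha => //; exact: v1B.
    have h1 : `|D 0%N 0%N 1%N x (v x) a - D 0%N 0%N 1%N x (v x) (v1 x)| <= K3 * `|a - v1 x|.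
      apply: (@increment_in_le _ setT _ (fun a => D 0%N 0%N 2%N x (v x) a)) => // c hc.
        by have [] := Dd 0%N 0%N 1%N isT x (v x) c xT.
      apply: HK3 => //; first exact: vB.
      by apply: between hc => //; exact: v1B.
    apply: (le_trans h1); rewrite ler_wpM2l//.
    exact: between_dist.
  have dB a : has_derivative_in setT (fun a => f x (v x) a - bb x * a) a (D 0%N 0%N 1%N x (v x) a - bb x).
    rewrite /has_derivative_in.
    have := dD a; rewrite /has_derivative_in => h.
    have h2 : ((f x (v x) y0 - f x (v x) a) / (y0 - a) - bb x) @[y0 --> within setT a^'] --> D 0%N 0%N 1%N x (v x) a - bb x.
      by apply: cvgB => //; exact: cvg_cst.
    apply: cvg_trans h2; apply: near_eq_cvg; rewrite withinET; near=> b.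
    have ba : b - a != 0 by rewrite subr_eq0; near: b; exact: nbhs_dnbhs_neq.
    by field.
  have := @increment_in_le _ setT _ _ (v1 x - z) (v1 x) (K3 * `|z|) (fun _ _ => I) (fun a _ => dB a) bbE.
  rewrite (_ : v1 x - (v1 x - z) = z); last by ring.
  congr (`|_| <= _); ring.
- move=> x y xT yT; rewrite /bb !clamp_id//.
  have E : D 0%N 0%N 1%N x (v x) (v1 x) - D 0%N 0%N 1%N y (v y) (v1 y) =
     (D 0%N 0%N 1%N x (v x) (v1 x) - D 0%N 0%N 1%N y (v x) (v1 x)) +
     (D 0%N 0%N 1%N y (v x) (v1 x) - D 0%N 0%N 1%N y (v y) (v1 x)) +
     (D 0%N 0%N 1%N y (v y) (v1 x) - D 0%N 0%N 1%N y (v y) (v1 y)) by ring.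
  rewrite E mulrDl mulrDl; apply: (le_trans (ler_normD _ _)); apply: lerD.
    apply: (le_trans (ler_normD _ _)); apply: lerD.
      apply: (@increment_in_le _ `[0, T] (fun a => D 0%N 0%N 1%N a (v x) (v1 x)) (fun a => D 1%N 0%N 1%N a (v x) (v1 x))) => c hc.
      - by rewrite /= in_itv; exact: betweenT hc.
      - by have [] := Dd 0%N 0%N 1%N isT c (v x) (v1 x) (betweenT _ _ _ yT xT hc).
      - by apply: HK1; [exact: betweenT hc|exact: vB|exact: v1B].
    apply: (@le_trans _ _ (K2 * `|v x - v y|)); last by rewrite -mulrA ler_wpM2l// (primL v1).
    apply: (@increment_in_le _ setT (fun a => D 0%N 0%N 1%N y a (v1 x)) (fun a => D 0%N 1%N 1%N y a (v1 x))) => // c hc.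
    - by have [] := Dd 0%N 0%N 1%N isT y c (v1 x) yT.
    - by apply: HK2 => //; [apply: between hc; exact: vB|exact: v1B].
  apply: (@le_trans _ _ (K3 * `|v1 x - v1 y|)); last by rewrite -mulrA ler_wpM2l// (primL v2).
  apply: (@increment_in_le _ setT (fun a => D 0%N 0%N 1%N y (v y) a) (fun a => D 0%N 0%N 2%N y (v y) a)) => // c hc.
  - by have [] := Dd 0%N 0%N 1%N isT y (v y) c yT.
  - by apply: HK3 => //; [exact: vB|apply: between hc; exact: v1B].
Unshelve. all: by end_near. Qed.

End IVP.

(** * The global error *)

Section Restriction.
Variables (R : realType) (a b : R).
Hypothesis ab : a < b.
Implicit Types (f v U : R -> R) (x : R) (p q : {poly R}).
Notation mu := (@lebesgue_measure R).

Lemma restrict_in_L2 (J : set R) f : contR f -> `]a, b[ `<=` J ->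
  in_Lp J 2%:E (f \_ `]a, b[).
Proof.
move=> cf JJ.
have E : (f \_ `]a, b[) \_ J = f \_ `]a, b[.
  apply/funext => x; rewrite !patchE; case: ifPn => // xJ; case: ifPn => // xab.
  by move: xJ; rewrite mem_set//; apply: JJ; rewrite inE in xab.
rewrite /in_Lp E; apply/andP; split; rewrite inE/=.
  have [h _] := measurable_restrictT f (measurable_itv `]a, b[).
  by apply: h; exact: contR_measurable.
rewrite /finite_norm unlock /Lnorm; apply: poweR_lty.
have /integrableP[_] : mu.-integrable `]a, b[ (EFin \o (fun x => f x ^+ 2)).
  have i2 := continuous_itv_integrable a b (@contX _ f 2 cf).
  by apply: (integrableS _ _ _ i2) => //; exact: subset_itv_oo_cc.
apply: le_lt_trans; rewrite [leRHS]integral_mkcond le_eqVlt; apply/orP; left; apply/eqP.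
apply: eq_integral => x _; rewrite /= !patchE; case: ifPn => xab.
  by rewrite powR_mulrn ?normr_ge0// normrX.
by rewrite normr0 powR0.
Qed.

Lemma derive1_horner_itv U p : (forall x, a < x < b -> U x = p.[x]) ->
  forall x, a < x < b -> derive1 U x = p^`().[x].
Proof.
move=> Up x xab; rewrite derive1E.
rewrite (@near_eq_derive _ _ _ U (horner p)).
  by case: (is_derive_poly p x).
have xi : x \in `]a, b[ by rewrite in_itv.
by apply: filterS (near_in_itvoo xi) => y; rewrite in_itv/= => /Up.
Qed.

Lemma derive1n2_horner_itv U p : (forall x, a < x < b -> U x = p.[x]) ->
  forall x, a < x < b -> derive1n 2 U x = p^`()^`().[x].
Proof.
by move=> Up; exact: (derive1_horner_itv (derive1_horner_itv Up)).
Qed.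

Lemma cvg_right_horner U p l : (forall x, a < x < b -> U x = p.[x]) ->
  U x @[x --> a^'+] --> l -> p.[a] = l.
Proof.
move=> Up Ul.
have pl : p.[x] @[x --> a^'+] --> l.
  apply: cvg_trans Ul; apply: near_eq_cvg; near=> x; rewrite Up//.
  by apply/andP; split; near: x; [exact: nbhs_right_gt|exact: nbhs_right_lt].
have pa : p.[x] @[x --> a^'+] --> p.[a].
  by apply: cvg_at_right_filter; exact: cont_horner.
exact: (cvg_unique (@Rhausdorff R) pa pl).
Unshelve. all: by end_near. Qed.

End Restriction.

(** * Partitions and degrees *)

Section Partition.
Variables (R : realType) (T : R) (N : nat) (t : nat -> R).
Hypotheses (T0 : 0 < T) (tP : is_partition T N t).

Lemma partition_le i j : (i <= j <= N)%N -> t i <= t j.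
Proof.
case: tP => _ _ tS; elim: j => [|j IH] /andP[ij jN]; first by move: ij; rewrite leqn0 => /eqP ->.
move: ij; rewrite leq_eqVlt => /orP[/eqP ->//|ij].
by apply: le_trans (IH _) (ltW (tS _ jN)); rewrite -ltnS ij ltnW.
Qed.

Lemma partition_itv i : (i <= N)%N -> 0 <= t i <= T.
Proof.
move=> iN; have [<- <- _] := tP.
by rewrite !partition_le ?iN ?leqnn.
Qed.

Lemma subinterval_sub n : (n < N)%N -> subinterval t n `<=` `]0, T[.
Proof.
move=> nN x; rewrite /subinterval/= !in_itv/= => /andP[tx xt].
have /andP[t0 _] := partition_itv (ltnW nN); have /andP[_ tT] := partition_itv nN.
by rewrite (le_lt_trans t0)//= (lt_le_trans xt).
Qed.

Lemma subinterval_trivI i j x : (i < N)%N -> (j < N)%N ->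
  subinterval t i x -> subinterval t j x -> i = j.
Proof.
wlog : i j / (i <= j)%N => [h iN jN|].
  case/orP: (leq_total i j) => ij xi xj; first exact: h.
  by apply/esym; exact: h.
rewrite leq_eqVlt => /orP[/eqP //|ij] iN jN; rewrite /subinterval/= !in_itv/=.
move=> /andP[_ xi] /andP[jx _]; have := lt_trans jx xi.
by rewrite ltNge partition_le// ij ltnW.
Qed.

Lemma partition_cover x : 0 < x < T -> (exists2 n, (n < N)%N & subinterval t n x) \/
  (exists2 n, (n <= N)%N & x = t n).
Proof.
have [t0 tN tS] := tP; move=> /andP[]; rewrite -t0 -tN.
elim: N => [|n IH] x0 xN.
  by have := lt_trans x0 xN; rewrite ltxx.
case: (ltgtP x (t n)) => [xn|nx|->]; last by right; exists n.
  have [[m mn xm]|[m mn xm]] := IH x0 xn; first by left; exists m => //; exact: ltnW.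
  by right; exists m => //; exact: leqW.
by left; exists n => //; rewrite /subinterval/= in_itv/= nx.
Qed.

Lemma partition_gt0 : (0 < N)%N.
Proof.
by case: tP => t0 tN _; rewrite lt0n; apply/eqP => N0; move: T0; rewrite -tN N0 t0 ltxx.
Qed.

Lemma Linf_norm_partition_le (v : R -> R) (B : R) : 0 <= B ->
  (forall n x, (n < N)%N -> subinterval t n x -> `|v x| <= B) ->
  (Linf_norm `]0%R, T[ v <= B%:E)%E.
Proof.
move=> B0 vB; rewrite /Linf_norm unlock /Lnorm muT_gt0; apply/ess_supP.
have cA : countable (t @` `I_N.+1).
  by apply: finite_set_countable; apply: finite_image; exact: finite_II.
exists (t @` `I_N.+1); split.
- by apply: countable_measurable => // ?; exact: measurable_set1.
- exact: countable_lebesgue_measure0.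
- move=> x /=; apply: contra_notP => Hx.
  rewrite lee_fin patchE; case: ifPn => [|_]; last by rewrite normr0.
  rewrite inE/= in_itv/= => /partition_cover[[n nN xn]|[n nN xn]]; first exact: vB xn.
  by exfalso; apply: Hx; exists n.
Qed.

Lemma step_le_max n : (n < N)%N -> step t n <= max_step N t.
Proof.
by move=> nN; rewrite /max_step; apply: (le_bigmax _ (fun i : 'I_N => step t i) (Ordinal nN)).
Qed.

Lemma step_gt0 n : (n < N)%N -> 0 < step t n.
Proof. by case: tP => _ _ tS nN; rewrite subr_gt0 tS. Qed.

End Partition.

Section Degrees.
Variables (N : nat) (r : nat -> nat).
Local Open Scope nat_scope.

Lemma min_degree_le n : n < N -> min_degree N r <= r n.
Proof.
move=> nN; rewrite /min_degree; have := mem_index_enum (Ordinal nN).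
elim: (index_enum _) => // i s IH; rewrite inE big_cons => /orP[/eqP <-|/IH h].
  exact: geq_minl.
exact: leq_trans (geq_minr _ _) h.
Qed.

Lemma min_degree_ge m : m <= max_degree N r -> (forall n, n < N -> m <= r n) ->
  m <= min_degree N r.
Proof.
move=> mM mr; rewrite /min_degree; elim/big_ind: _ => // [x y mx my|i _].
  by rewrite leq_min mx my.
exact: mr.
Qed.

Lemma le_max_degree n : n < N -> r n <= max_degree N r.
Proof. by move=> nN; exact: (leq_bigmax (Ordinal nN)). Qed.

End Degrees.

(** * From one interval to the whole partition *)

Section CPG.
Variables (R : realType) (T u0 u1 L : R) (f : R -> R -> R -> R) (u : R -> R).
Hypotheses (T0 : 0 < T) (L0 : 0 < L).
Hypothesis fL : forall t x1 y1 x2 y2, 0 <= t <= T ->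
  `|f t x1 y1 - f t x2 y2| <= L * (`|x1 - x2| + `|y1 - y2|).
Hypothesis fC : class_C 2 T f.
Variables (v v1 v2 bb : R -> R) (M Mb Lb K : R).
Hypothesis ivp : ivp_data T u0 u1 L f u v v1 v2 bb M Mb Lb K.
Variables (N : nat) (t : nat -> R) (r : nat -> nat) (U : R -> R).
Hypotheses (tP : is_partition T N t) (r3 : forall n, (n < N)%N -> (3 <= r n)%N).
Hypothesis UP : cpg_solution T N t r f u0 u1 U.
Notation mu := (@lebesgue_measure R).

Definition pieces (p : nat -> {poly R}) := forall n, (n < N)%N ->
  (size (p n) <= (r n).+1)%N /\ forall x, t n < x < t n.+1 -> U x = (p n).[x].

Lemma pieces_exist : exists p, pieces p.
Proof.
have [[_ pw] _ _ _] := UP.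
have H n : exists p : {poly R}, (n < N)%N ->
    (size p <= (r n).+1)%N /\ forall x, t n < x < t n.+1 -> U x = p.[x].
  have [nN|Nn] := ltnP n N; last by exists 0.
  case: (pw n nN) => p [sp Up]; exists p => _; split; first exact: sp.
  by move=> x xn; apply: Up; rewrite /subinterval/= in_itv.
by have [p Hp] := choice H; exists p.
Qed.

Let tS n : (n < N)%N -> t n < t n.+1. Proof. by case: tP => _ _; exact. Qed.

Lemma ext_f_id x y z : 0 <= x <= T -> ext_f T f x y z = f x y z.
Proof. by move=> xT; rewrite /ext_f clamp_id. Qed.

(** Test functions may jump at the nodes, so a polynomial on one subinterval extended by zero is
    admissible and the method decouples into local conditions. Degree r - 2 is size at most
    [(r n).-1]. *)
Lemma pieces_orth p n : pieces p -> (n < N)%N ->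
  orth (t n) (t n.+1) (r n).-1
    (fun x => ext_f T f x (p n).[x] (p n)^`().[x] - (p n)^`()^`().[x]).
Proof.
move=> pP nN q sq; have [_ pE] := pP n nN; have tn := tS nN.
have [_ _ _ HU] := UP.
pose phi := horner q \_ `]t n, t n.+1[.
have phi_in x : t n < x < t n.+1 -> phi x = q.[x].
  by move=> xn; rewrite /phi patchE mem_set// /= in_itv.
have phi_out m x : (m < N)%N -> m != n -> subinterval t m x -> phi x = 0.
  move=> mN mn xm; rewrite /phi patchE; case: ifPn => // xn; rewrite inE in xn.
  by case/eqP: mn; exact: (subinterval_trivI tP mN nN xm xn).
have phiT : test_space T N t r phi.
  split; first exact: restrict_in_L2 (cont_horner q) (subinterval_sub tP nN).
  move=> m mN; have [->|mn] := eqVneq m n.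
    exists q; split; last by move=> x; rewrite /subinterval/= in_itv => /phi_in.
    by apply: (leq_trans sq); have := r3 nN; case: (r n) => [|[|k]]//; rewrite subn2.
  exists 0; split; first by rewrite size_poly0.
  by move=> x /(phi_out _ _ mN mn) ->; rewrite horner0.
have sum1 (g : R -> R) :
    \sum_(m < N) (\int[mu]_(x in subinterval t m) (g x * phi x))%R =
    (\int[mu]_(x in `]t n, t n.+1[) (g x * q.[x]))%R.
  rewrite (bigD1 (Ordinal nN))//= big1 ?addr0 => [|m mn].
    by apply: eq_Rintegral => x; rewrite inE /subinterval/= in_itv => /phi_in ->.
  rewrite (_ : (\int[mu]_(x in _) _)%R = (\int[mu]_(x in subinterval t m) 0)%R).
    by rewrite Rintegral_cst ?mul0r//; exact: measurable_itv.
  apply: eq_Rintegral => x; rewrite inE => xm.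
  by rewrite (phi_out m)// ?mulr0// -(inj_eq val_inj).
have := HU phi phiT; rewrite !sum1.
have cE : contR (fun x => ext_f T f x (p n).[x] (p n)^`().[x]).
  by apply: (ext_f_cont T0 fC); exact: cont_horner.
have cq := cont_horner q; have cp2 := cont_horner (p n)^`()^`().
have -> : (\int[mu]_(x in `]t n, t n.+1[) (derive1n 2 U x * q.[x]))%R =
    (\int[mu]_(x in `]t n, t n.+1[) ((p n)^`()^`().[x] * q.[x]))%R.
  by apply: eq_Rintegral => x; rewrite inE => xn; rewrite (derive1n2_horner_itv pE).
have -> : (\int[mu]_(x in `]t n, t n.+1[) (f x (U x) (derive1 U x) * q.[x]))%R =
    (\int[mu]_(x in `]t n, t n.+1[) (ext_f T f x (p n).[x] (p n)^`().[x] * q.[x]))%R.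
  apply: eq_Rintegral => x; rewrite inE/= in_itv/= => xn.
  rewrite (derive1_horner_itv pE xn) (pE x xn) ext_f_id//.
  have : `]0, T[%classic x by apply: (subinterval_sub tP nN); rewrite /subinterval/= in_itv.
  by rewrite /= in_itv/= => /andP[x0 xT]; rewrite !ltW.
rewrite !Rintegral_itg ?(ltW tn)//; [|cont..].
move=> E; rewrite (_ : (fun x => _) = (fun x => ext_f T f x (p n).[x] (p n)^`().[x] * q.[x] -
   (p n)^`()^`().[x] * q.[x])); last by apply/funext => x; rewrite mulrBl.
by rewrite itgB ?E ?subrr//; cont.
Qed.

Lemma pieces_C1 p n : pieces p -> (n.+1 < N)%N ->
  (p n).[t n.+1] = (p n.+1).[t n.+1] /\ (p n)^`().[t n.+1] = (p n.+1)^`().[t n.+1].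
Proof.
move=> pP nN; have nN' := ltnW nN.
have [_ pE] := pP _ nN'; have [_ pE'] := pP _ nN.
have [[UW _] _ _ _] := UP.
apply: (in_W2_C1 (tS nN') (tS nN) _ UW pE pE') => x /=; rewrite !in_itv/= => /andP[ax xb].
have /andP[t0 _] := partition_itv tP (ltnW nN'); have /andP[_ tT] := partition_itv tP nN.
by rewrite (le_lt_trans t0)//= (lt_le_trans xb).
Qed.

Lemma pieces_init p : pieces p -> (p 0%N).[0] = u0 /\ (p 0%N)^`().[0] = u1.
Proof.
move=> pP; have N0 := partition_gt0 T0 tP; have [_ pE] := pP _ N0.
have [_ U0 U1 _] := UP; have [t0 _ _] := tP.
have t1 := tS N0; rewrite t0 in t1 pE.
split; first exact: (cvg_right_horner t1 pE U0).
exact: (cvg_right_horner t1 (derive1_horner_itv pE) U1).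
Qed.

Hypothesis k1 : forall n, (n < N)%N -> step t n <= 1.
Hypothesis kL : forall n, (n < N)%N -> step t n * (L + 1) <= 1 / 2.

(** The exponential is the Gronwall factor; 2 and 4 are the coefficients in the bound of
    [step_bound] inside an interval. *)
Definition cpg_factor := 2 * expR ((2 * L + 3) * T) + 4.

(* Gronwall over the nodes, from [y' <= (1 + c k) y + c k al] *)
Lemma cpg_error (q : nat -> {poly R}) (al : R) : 0 <= al ->
  (forall n, (n < N)%N -> (size (q n) <= (r n).-1)%N /\
     orth (t n) (t n.+1) (r n).-1 (fun x => v2 x - (q n).[x])) ->
  (forall n, (n < N)%N ->
     step_const L K M Mb Lb * step_alpha (t n) (t n.+1) v2 (q n) (r n).-1 <= al) ->
  forall n x, (n < N)%N -> subinterval t n x -> `|u x - U x| <= cpg_factor * al.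
Proof.
move=> al0 qP qal; have [p pP] := pieces_exist.
have [[vP v1P] [cv2 cbb] [M0 Mb0 Lb0 K0] [uv v0 v10 v2E] [v2M lin bbM bbL]] := ivp.
pose c := 2 * L + 3; have c0 : 0 <= c by rewrite /c; have := L0; lra.
pose y n := `|step_e v (p n) (t n)| + `|step_e1 v1 (p n) (t n)|.
have in0T n x : (n < N)%N -> t n <= x <= t n.+1 -> 0 <= x <= T.
  move=> nN /andP[ax xb].
  have /andP[t0 _] := partition_itv tP (ltnW nN); have /andP[_ tT] := partition_itv tP nN.
  by rewrite (le_trans t0)//= (le_trans xb).
have SB n : (n < N)%N ->
    `|step_e v (p n) (t n.+1)| + `|step_e1 v1 (p n) (t n.+1)| <=
      (1 + step t n * c) * y n + step t n * c * al /\
    forall x, t n <= x <= t n.+1 -> `|step_e v (p n) x| <= 2 * y n + 4 * al.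
  move=> nN; have [sp pE] := pP _ nN; have [sq qo] := qP _ nN.
  have r3n := r3 nN.
  have n1 : (1 < (r n).-1)%N by move: r3n; case: (r n).
  have sp2 : (size (p n)^`()^`() <= (r n).-1)%N.
    have sd (g : {poly R}) : (size g^`() <= (size g).-1)%N.
      have [->|g0] := eqVneq g 0; first by rewrite deriv0 size_poly0.
      by have := lt_size_deriv g0; case: (size g).
    apply: (leq_trans (sd _)); rewrite -!subn1 leq_sub2r// (leq_trans (sd _))//.
    by move: sp; case: (size (p n)).
  have [] := @step_bound _ (t n) (t n.+1) (ext_f T f) L K M Mb Lb v v1 v2 bb (p n) (q n) (r n).-1
    (tS nN) n1 (k1 nN) (kL nN) (ltW L0) K0 M0 Mb0 Lb0 vP v1P cv2 _ _ _ _ _ cbb _ _ sp2 (pieces_orth pP nN) sq qo.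
  - by move=> x /(in0T _ _ nN); exact: v2E.
  - by move=> x y1 z1 y2 z2 /(in0T _ _ nN) xT; apply: fL; exact: clamp_itv.
  - by move=> *; exact: ext_f_cont.
  - by move=> x /(in0T _ _ nN); exact: v2M.
  - by move=> x y0 z /(in0T _ _ nN); exact: lin.
  - by move=> x /(in0T _ _ nN); exact: bbM.
  - by move=> x x' /(in0T _ _ nN) xT /(in0T _ _ nN); exact: bbL.
  have kc : 0 <= step t n * c by rewrite mulr_ge0// ltW// (step_gt0 tP).
  have Dal := qal n nN.
  move=> H1 H2; split.
    apply: (le_trans H1); rewrite -/(y n) -/c -/(step t n) lerD2l.
    exact: ler_wpM2l.
  by move=> x /H2 h; apply: (le_trans h); rewrite -/(y n) lerD2l ler_wpM2l.
have y0 n : 0 <= y n by rewrite addr_ge0.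
(* Adding [al] makes the recursion homogeneous, with factor 1 + c k <= exp(c k); the exponents add
   up to c times the node, and [y 0] = 0 by the initial conditions. *)
have gron n : (n < N)%N -> y n + al <= expR (c * t n) * al.
  elim: n => [|n IH] nN.
    have [t0 _ _] := tP; have [p0 p1] := pieces_init pP.
    rewrite /y /step_e /step_e1 t0 p0 p1 v0 v10 !subrr normr0 !add0r mulr0 expR0.
    by rewrite mul1r.
  have [h _] := SB n (ltnW nN); have [e0 e1] := pieces_C1 pP nN.
  have yS : y n.+1 <= (1 + step t n * c) * y n + step t n * c * al.
    by rewrite /y /step_e /step_e1 -e0 -e1.
  have kc : 0 <= step t n * c by rewrite mulr_ge0// ltW// (step_gt0 tP) ?(ltnW nN).
  apply: (@le_trans _ _ ((1 + step t n * c) * (y n + al))); first by lra.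
  apply: (@le_trans _ _ (expR (step t n * c) * (expR (c * t n) * al))).
    apply: ler_pM => //; [by rewrite addr_ge0|by rewrite addr_ge0|exact: expR_ge1Dx|].
    exact: IH (ltnW nN).
  by rewrite mulrA -expRD /step (_ : (t n.+1 - t n) * c + c * t n = c * t n.+1)//; ring.
move=> n x nN; rewrite /subinterval/= in_itv/= => xn.
have [_ pE] := pP _ nN; have [_ h] := SB n nN.
have xn' : t n <= x <= t n.+1 by case/andP: xn => ? ?; rewrite !ltW.
rewrite pE// uv ?(in0T n)//; apply: (le_trans (h x xn')).
have := gron n nN; have := y0 n => yn0 g.
have /andP[_ tT] := partition_itv tP (ltnW nN).
have : expR (c * t n) <= expR (c * T) by rewrite ler_expR ler_wpM2l.
rewrite /cpg_factor -/c => eT.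
have := ler_wpM2r al0 eT; lra.
Qed.

End CPG.

(** * The contribution of one step in terms of the norm of u *)

Section Bounds.
Variable R : realType.
Implicit Types (v u : R -> R) (a b s W k : R) (J : set R) (q : {poly R}).

Lemma W_norm_ge0 J s v : (0 <= W_norm J s v)%E.
Proof.
rewrite /W_norm; case: ifP => _; first exact: Wint_norm_ge0.
have K0 : (0 <= K_functional J (Num.truncn s) v 1)%E.
  apply: le_ereal_inf_tmp => _ [v0 [v1 [_ ->]]].
  by rewrite adde_ge0 ?mule_ge0 ?Wint_norm_ge0// lee_fin.
apply: (le_trans K0); apply: ereal_sup_ubound; exists 1 => //=.
by rewrite powR1 mul1e.
Qed.

(** The power of sqrt(2) pays for replacing r - 1 by r in (k/(r - 1))^(3/2); the rest is the
    constant of [nrm_rho_le] at s + 1. *)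
Definition rho_const s : R :=
  let m := Num.truncn (s + 1) in
  Num.sqrt 2 ^+ 3 * (m%:R ^+ m * 2 `^ (s - 1) + m%:R `^ (s - 1)).

Lemma rho_const_ge0 s : 0 <= rho_const s.
Proof. by rewrite mulr_ge0 ?exprn_ge0 ?addr_ge0 ?mulr_ge0 ?powR_ge0 ?exprn_ge0. Qed.

(** Square root of the coefficient of the squared norm inside the maximum of the first estimate. *)
Definition rate k (r : nat) s : R := k `^ (Num.min r%:R s - 1) / r%:R `^ (s - 1).

Lemma rate_ge0 k r s : 0 <= rate k r s.
Proof. by rewrite divr_ge0 ?powR_ge0. Qed.

(** The supremum bound contributes (k/r)^(3/2) and the passage from uniform to L2 norms a factor
    sqrt(k): together k^2 r^(-3/2), up to constants. *)
Lemma step_alpha_le a b J u v v1 v2 q (r : nat) s W : a < b -> (3 <= r)%N -> 3 / 2 <= s ->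
  `]a, b[ `<=` J -> (forall x, a < x < b -> u x = v x) -> is_prim v1 v -> is_prim v2 v1 ->
  contR v2 -> (size q <= r.-1)%N -> orth a b r.-1 (fun x => v2 x - q.[x]) ->
  (W_norm J (s + 1) u <= W%:E)%E ->
  step_alpha a b v2 q r.-1 <=
  rho_const s * ((b - a) ^+ 2 / Num.sqrt r%:R ^+ 3 * (rate (b - a) r s * W)).
Proof.
move=> ab r3 s32 JJ uv vP v1P cv2 sq qo uW.
have rE : r = r.-1.+1 by rewrite prednK// (leq_trans _ r3).
have n0 : (0 < r.-1)%N by rewrite -ltnS -rE (leq_trans _ r3).
have k0 : 0 < b - a by rewrite subr_gt0.
have W0 : 0 <= W by have := le_trans (W_norm_ge0 J (s + 1) u) uW; rewrite lee_fin.
have m2 : (1 < Num.truncn (s + 1))%N by rewrite truncn_ge_nat; lra.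
have s11 : 1 <= s + 1 - 1 by lra.
have H := nrm_rho_le ab JJ uv vP v1P cv2 n0 sq qo m2 s11 erefl uW.
have e1 : s + 1 - 1 = s by ring.
have e2 : s + 1 - 2 = s - 1 by ring.
rewrite e1 e2 -rE in H.
have r0 : 0 < r%:R :> R by rewrite ltr0n (leq_trans _ r3).
have n0' : 0 < r.-1%:R :> R by rewrite ltr0n.
have kr : (b - a) / r.-1%:R <= 2 * (b - a) / r%:R.
  rewrite ler_pdivrMr// mulrAC ler_pdivlMr// [2 * (b - a)]mulrC -mulrA ler_pM2l//.
  rewrite -natrM ler_nat [in leqLHS]rE mul2n -addnn -addn1 leq_add2l//.
have sk : Num.sqrt ((b - a) / r.-1%:R) ^+ 3 <= Num.sqrt 2 ^+ 3 * Num.sqrt (b - a) ^+ 3 / Num.sqrt r%:R ^+ 3.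
  rewrite -exprMn -expr_div_n -sqrtrM// -sqrtrV ?(ltW r0)// -sqrtrM ?mulr_ge0 ?(ltW k0)//.
  by rewrite lerXn2r ?nnegrE ?sqrtr_ge0// ler_wsqrtr.
have rt0 := rate_ge0 (b - a) r s.
have sr0 : 0 < Num.sqrt r%:R ^+ 3 :> R by rewrite exprn_gt0// sqrtr_gt0.
have ks : Num.sqrt (b - a) ^+ 2 = b - a by rewrite sqr_sqrtr// ltW.
have kk0 : 0 <= Num.sqrt (b - a) by exact: sqrtr_ge0.
rewrite /step_alpha.
apply: (le_trans (ler_pM _ _ sk H)); [by rewrite exprn_ge0 ?sqrtr_ge0|exact: nrm_ge0|].
have kk : (b - a) ^+ 2 = Num.sqrt (b - a) ^+ 4 by rewrite -[in LHS]ks -exprM.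
rewrite /rho_const -/(rate (b - a) r s) kk.
set A := _ + _; set Q := Num.sqrt r%:R ^+ 3; set X := rate _ _ _; set Y := Num.sqrt (b - a).
by rewrite le_eqVlt; apply/orP; left; apply/eqP; ring.
Qed.

End Bounds.

(** * The global error bound *)

Section GlobalError.
Variables (R : realType) (T u0 u1 L : R) (f : R -> R -> R -> R) (u : R -> R) (s : R).
Hypotheses (T0 : 0 < T) (L0 : 0 < L).
Hypothesis fL : forall t x1 y1 x2 y2, 0 <= t <= T ->
  `|f t x1 y1 - f t x2 y2| <= L * (`|x1 - x2| + `|y1 - y2|).
Hypotheses (fC : class_C 2 T f) (s32 : 3 / 2 <= s).
Variables (v v1 v2 bb : R -> R) (M Mb Lb K : R).
Hypothesis ivp : ivp_data T u0 u1 L f u v v1 v2 bb M Mb Lb K.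

Definition error_const : R :=
  cpg_factor T L * (step_const L K M Mb Lb * rho_const s).

Lemma step_const_ge0 : 0 <= step_const L K M Mb Lb.
Proof.
have [_ _ [M0 Mb0 Lb0 K0] _ _] := ivp; rewrite /step_const.
by have := L0; have := mulr_ge0 K0 M0; lra.
Qed.

Lemma cpg_factor_ge0 : 0 <= cpg_factor T L.
Proof. by rewrite /cpg_factor addr_ge0// mulr_ge0// expR_ge0. Qed.

Lemma error_const_ge0 : 0 <= error_const.
Proof. by rewrite !mulr_ge0 ?cpg_factor_ge0 ?step_const_ge0 ?rho_const_ge0. Qed.

(** The sets [J n] are left free because the first estimate uses the norms of u on the subintervals
    and the second its norm on ]0, T[. *)
Lemma cpg_Linf_le (N : nat) (t : nat -> R) (r : nat -> nat) (U : R -> R)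
    (J : nat -> set R) (W : nat -> R) (al : R) :
  is_partition T N t -> (forall n, (n < N)%N -> (3 <= r n)%N) ->
  max_step N t <= Num.min 1 (1 / (2 * (L + 1))) ->
  cpg_solution T N t r f u0 u1 U ->
  (forall n, (n < N)%N -> subinterval t n `<=` J n /\ (W_norm (J n) (s + 1) u <= (W n)%:E)%E) ->
  0 <= al ->
  (forall n, (n < N)%N ->
    step t n ^+ 2 / Num.sqrt (r n)%:R ^+ 3 * (rate (step t n) (r n) s * W n) <= al) ->
  (Linf_norm `]0%R, T[ (fun x => u x - U x)%R <= (error_const * al)%:E)%E.
Proof.
move=> tP r3 mk UP JW al0 Wal.
have [[vP v1P] [cv2 _] _ [uv _ _ _] _] := ivp.
have L10 : 0 < 2 * (L + 1) by have := L0; lra.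
have k1 n : (n < N)%N -> step t n <= 1.
  by move=> nN; apply: (le_trans (step_le_max t nN)); move: mk; rewrite le_min => /andP[].
have kL n : (n < N)%N -> step t n * (L + 1) <= 1 / 2.
  move=> nN; have : step t n <= 1 / (2 * (L + 1)).
    by apply: (le_trans (step_le_max t nN)); move: mk; rewrite le_min => /andP[].
  by rewrite ler_pdivlMr//; lra.
have tS n : (n < N)%N -> t n < t n.+1 by case: tP => _ _; exact.
have qn n : exists q : {poly R}, (n < N)%N -> (size q <= (r n).-1)%N /\
    orth (t n) (t n.+1) (r n).-1 (fun x => v2 x - q.[x]).
  have [nN|Nn] := ltnP n N; last by exists 0.
  by have [q sq qo] := proj_exists (tS n nN) (r n).-1 cv2; exists q.
have [q qP] := choice qn.
set C := step_const L K M Mb Lb * rho_const s.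
have C0 : 0 <= C by rewrite mulr_ge0 ?step_const_ge0 ?rho_const_ge0.
apply: (Linf_norm_partition_le tP); first by rewrite mulr_ge0 ?error_const_ge0.
move=> n x nN xn; rewrite /error_const -/C -mulrA.
apply: (cpg_error T0 L0 fL fC ivp tP r3 UP k1 kL (mulr_ge0 C0 al0) qP _ nN xn).
move=> j jN; have [JJ uW] := JW j jN; have [sq qo] := qP j jN.
rewrite /C -[leRHS]mulrA ler_wpM2l ?step_const_ge0//.
have uvj x' : t j < x' < t j.+1 -> u x' = v x'.
  move=> xj; apply: uv; have : `]0, T[%classic x'.
    by apply: (subinterval_sub tP jN); rewrite /subinterval/= in_itv.
  by rewrite /= in_itv/= => /andP[? ?]; rewrite !ltW.
apply: (le_trans (step_alpha_le (tS j jN) (r3 j jN) s32 JJ uvj vP v1P cv2 sq qo uW)).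
by rewrite ler_wpM2l ?rho_const_ge0// Wal.
Qed.

End GlobalError.

(** * Comparison with the stated rates *)

Section Rates.
Variable R : realType.
Implicit Types (k s : R) (r : nat).

Lemma rate_sqr k r s : k `^ (2 * Num.min r%:R s - 2) / r%:R `^ (2 * s - 2) = rate k r s ^+ 2.
Proof.
rewrite /rate expr_div_n -!powR_mulrn ?powR_ge0// -!powRrM.
by rewrite !mulrBl !mul1r ![_ * 2]mulrC.
Qed.

Lemma ln3_gt0 : 0 < ln 3 :> R.
Proof. by rewrite ln_gt0// ltr1n. Qed.

Lemma ln3_le r : (3 <= r)%N -> ln 3 <= ln r%:R :> R.
Proof. by move=> r3; rewrite ler_ln ?posrE ?ltr0n ?ler_nat// (leq_trans _ r3). Qed.

Lemma rate_gt0 k r s : 0 < k -> (0 < r)%N -> 0 < rate k r s.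
Proof. by move=> k0 r0; rewrite divr_gt0// powR_gt0// ltr0n. Qed.

(** The exponents add up, 2 + (min - 1) for the step and 3/2 + (s - 1) for the degree; the local
    step is then replaced by the larger [h]. *)
Lemma rate_mul k h r s : 0 < k <= h -> (3 <= r)%N -> 3 / 2 <= s ->
  k ^+ 2 / Num.sqrt r%:R ^+ 3 * rate k r s <= h `^ (Num.min r%:R s + 1) / r%:R `^ (s + 1 / 2).
Proof.
move=> /andP[k0 kh] r3 s32; have h0 : 0 < h by exact: lt_le_trans kh.
have r0 : 0 < r%:R :> R by rewrite ltr0n (leq_trans _ r3).
have min0 : 0 <= Num.min r%:R s + 1.
  by rewrite addr_ge0// le_min (ltW r0)/=; lra.
have -> : r%:R `^ (s + 1 / 2) = Num.sqrt r%:R ^+ 3 * r%:R `^ (s - 1) :> R.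
  rewrite -powR12_sqrt ?(ltW r0)// -powR_mulrn ?powR_ge0// -powRrM -powRD.
    by congr powR; lra.
  by rewrite (gt_eqF r0) implybT.
have kE : k ^+ 2 * k `^ (Num.min r%:R s - 1) = k `^ (Num.min r%:R s + 1).
  rewrite -powR_mulrn ?(ltW k0)// -powRD; last by rewrite (gt_eqF k0) implybT.
  by congr powR; ring.
rewrite /rate mulf_div kE ler_pM2r.
  by rewrite ge0_ler_powR// nnegrE ltW.
by rewrite invr_gt0 mulr_gt0 ?powR_gt0// exprn_gt0// sqrtr_gt0.
Qed.

Lemma le_max_term (N : nat) (F : nat -> \bar R) n : (n < N)%N ->
  (F n <= \big[maxe/0]_(i < N) F i)%E.
Proof. by move=> nN; apply: (le_bigmax _ (fun i : 'I_N => F i) (Ordinal nN)). Qed.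

End Rates.

Theorem theorem4 (R : realType) :
  (* "f sufficiently smooth": of class C^m for some absolute order m *)
  exists m : nat,
  forall (T u0 u1 L : R) (f : R -> R -> R -> R) (u : R -> R) (s : R),
  0 < T -> 0 < L ->
  (forall x y, {within `[0, T], continuous (fun t => f t x y)}) ->
  (forall t x1 y1 x2 y2, 0 <= t <= T ->
     `|f t x1 y1 - f t x2 y2| <= L * (`|x1 - x2| + `|y1 - y2|)) ->
  class_C m T f ->
  exact_solution T f u0 u1 u ->
  3 / 2 <= s ->
  in_Winf `]0, T[ (s + 1) u ->
  exists2 k0 : R, 0 < k0 &
    (exists2 C : R, 0 < C &
      forall (N : nat) (t : nat -> R) (r : nat -> nat) (U : R -> R),
      is_partition T N t ->
      (forall n, (n < N)%N -> (3 <= r n)%N) ->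
      max_step N t <= k0 ->
      cpg_solution T N t r f u0 u1 U ->
      let k := max_step N t in
      (Linf_norm `]0%R, T[ (fun x => u x - U x)%R ^+ 2 <=
       (C * (k ^+ 4 * ln (max_degree N r)%:R / (min_degree N r)%:R ^+ 3))%:E *
       \big[maxe/0]_(n < N)
         ((step t n `^ (2 * Num.min (r n)%:R s - 2)
             / (r n)%:R `^ (2 * s - 2))%:E
          * W_norm (subinterval t n) (s + 1)%R u ^+ 2))%E)
    /\
    (forall Cq : R, 1 <= Cq ->
      exists2 C : R, 0 < C &
      forall (N : nat) (t : nat -> R) (r : nat) (U : R -> R),
      is_partition T N t ->
      (forall n, (n < N)%N ->
         1 <= max_step N t / step t n /\ max_step N t / step t n <= Cq) ->
      (3 <= r)%N ->
      max_step N t <= k0 ->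
      cpg_solution T N t (fun=> r) f u0 u1 U ->
      let k := max_step N t in
      (Linf_norm `]0%R, T[ (fun x => u x - U x)%R <=
       (C * (ln r%:R `^ (1 / 2)
             * (k `^ (Num.min r%:R s + 1) / r%:R `^ (s + 1 / 2))))%:E
       * W_norm `]0%R, T[ (s + 1)%R u)%E).
Proof.
(* Two derivatives of f suffice for df/du' to be Lipschitz along the solution. *)
exists 2%N => T u0 u1 L f u s T0 L0 _ fL fC uP s32 uW.
have [v [v1 [v2 [bb [M [Mb [Lb [K ivp]]]]]]]] := ivp_data_exists T0 fL fC uP.
(* The threshold ensures k <= 1 and k (L + 1) <= 1/2, the two smallness conditions of the local
   estimate. *)
exists (Num.min 1 (1 / (2 * (L + 1)))).
  by rewrite lt_min ltr01 divr_gt0// mulr_gt0// addr_gt0.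
set E := error_const T L s M Mb Lb K.
have E0 : 0 <= E := error_const_ge0 s L0 ivp.
have l3 := ln3_gt0 R.
split.
  (* The error bound carries no logarithm: division of the constant by ln 3 allows for the factor ln
     of the largest degree, which is at least ln 3. The 1 added below keeps the constant
     positive. *)
  have C0 : 0 <= E ^+ 2 / ln 3 by rewrite divr_ge0 ?sqr_ge0 ?ltW.
  exists (E ^+ 2 / ln 3 + 1); first by rewrite ltr_wpDl.
  move=> N t r U tP r3 mk UP; cbv zeta; set k := max_step N t.
  have N0 := partition_gt0 T0 tP.
  have rmin_le n : (n < N)%N -> (min_degree N r <= r n)%N by exact: min_degree_le.
  have rmax3 : (3 <= max_degree N r)%N := leq_trans (r3 _ N0) (le_max_degree r N0).
  have rmin3 : (3 <= min_degree N r)%N by exact: min_degree_ge.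
  have rm0 : 0 < (min_degree N r)%:R :> R by rewrite ltr0n (leq_trans _ rmin3).
  have k0 : 0 < k := lt_le_trans (step_gt0 tP N0) (step_le_max t N0).
  have lnr := ln3_le R rmax3.
  have coef0 : 0 < (E ^+ 2 / ln 3 + 1) *
      (k ^+ 4 * ln (max_degree N r)%:R / (min_degree N r)%:R ^+ 3).
    by rewrite mulr_gt0 ?ltr_wpDl// divr_gt0 ?exprn_gt0// mulr_gt0 ?exprn_gt0// (lt_le_trans l3).
  pose F n := ((step t n `^ (2 * Num.min (r n)%:R s - 2) / (r n)%:R `^ (2 * s - 2))%:E
          * W_norm (subinterval t n) (s + 1)%R u ^+ 2)%E.
  rewrite -/(F _); have S0 : (0 <= \big[maxe/0]_(n < N) F n)%E by exact: bigmax_ge_id.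
  have FS n nN := @le_max_term _ N F n nN.
  (* If the maximum is infinite, so is the right side, its coefficient being positive. Otherwise
     every local norm is finite because the rates are positive. *)
  case: (\big[maxe/0]_(n < N) F n)%E S0 FS => [sg||] // S0 FS; last first.
    by rewrite gt0_muley ?leey// lte_fin.
  rewrite lee_fin in S0.
  have Wfin n : (n < N)%N -> W_norm (subinterval t n) (s + 1) u \is a fin_num /\
      rate (step t n) (r n) s * fine (W_norm (subinterval t n) (s + 1) u) <= Num.sqrt sg.
    move=> nN; have := FS n nN; rewrite /F rate_sqr.
    have := W_norm_ge0 (subinterval t n) (s + 1) u.
    have rt := rate_gt0 s (step_gt0 tP nN) (leq_trans (isT : (0 < 3)%N) (r3 n nN)).
    case: (W_norm _ _ _) => [w||]//; last first.
      by move=> _; rewrite expe2 mulyy gt0_muley// lte_fin exprn_gt0.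
    rewrite lee_fin => w0; rewrite expe2 -!EFinM lee_fin -expr2 -exprMn => h; split => //=.
    by rewrite -(sqr_sqrtr S0) ler_sqr ?nnegrE ?sqrtr_ge0// mulr_ge0// ltW in h.
  pose al := k ^+ 2 / Num.sqrt (min_degree N r)%:R ^+ 3 * Num.sqrt sg.
  have al0 : 0 <= al by rewrite mulr_ge0 ?divr_ge0 ?exprn_ge0 ?sqrtr_ge0// ltW.
  have H : (Linf_norm `]0%R, T[ (fun x => u x - U x)%R <= (E * al)%:E)%E.
    apply: (cpg_Linf_le T0 L0 fL fC s32 ivp tP r3 mk UP
      (J := subinterval t) (W := fun n => fine (W_norm (subinterval t n) (s + 1) u)) _ al0) => n nN.
      by have [wf _] := Wfin n nN; split => //; rewrite fineK.
    have [_ h] := Wfin n nN; have sn := step_gt0 tP nN.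
    have rn0 : 0 < (r n)%:R :> R by rewrite ltr0n (leq_trans _ (r3 n nN)).
    apply: ler_pM => //.
    - by rewrite divr_ge0 ?exprn_ge0 ?sqrtr_ge0 ?(ltW sn).
    - by rewrite mulr_ge0 ?rate_ge0// fine_ge0// W_norm_ge0.
    - apply: ler_pM; rewrite ?invr_ge0 ?exprn_ge0 ?sqrtr_ge0 ?(ltW sn)//.
        by rewrite lerXn2r ?nnegrE ?(ltW sn) ?(ltW k0)// step_le_max.
      rewrite lef_pV2 ?posrE ?exprn_gt0 ?sqrtr_gt0// lerXn2r ?nnegrE ?sqrtr_ge0//.
      by rewrite ler_wsqrtr// ler_nat rmin_le.
  apply: (@le_trans _ _ ((E * al)%:E ^+ 2)%E).
    by rewrite lee_sqr ?Lnorm_ge0// lee_fin mulr_ge0.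
  have al2 : al ^+ 2 = k ^+ 4 / (min_degree N r)%:R ^+ 3 * sg.
    rewrite /al !exprMn exprVn sqr_sqrtr// -!exprM.
    by rewrite -[(3 * 2)%N]/(2 * 3)%N [Num.sqrt (min_degree N r)%:R ^+ _]exprM sqr_sqrtr ?(ltW rm0)// -exprD.
  rewrite expe2 -EFinM -EFinM lee_fin -expr2 [(E * al) ^+ 2]exprMn al2 [leLHS]mulrA ler_wpM2r//.
  have kr0 : 0 <= k ^+ 4 / (min_degree N r)%:R ^+ 3 by rewrite divr_ge0 ?exprn_ge0 ?ltW.
  have El : E ^+ 2 <= (E ^+ 2 / ln 3 + 1) * ln (max_degree N r)%:R.
    apply: (@le_trans _ _ (E ^+ 2 / ln 3 * ln 3)); first by rewrite divfK// gt_eqF.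
    rewrite mulrDl; have := ler_wpM2l C0 lnr; lra.
  by have := ler_wpM2r kr0 El; lra.
move=> Cq _.
have C0 : 0 <= E / ln 3 `^ (1 / 2) by rewrite divr_ge0 ?powR_ge0.
exists (E / ln 3 `^ (1 / 2) + 1); first by rewrite ltr_wpDl.
move=> N t r U tP _ r3 mk UP; cbv zeta; set k := max_step N t.
have N0 := partition_gt0 T0 tP.
have W0 := W_norm_ge0 `]0, T[ (s + 1) u.
have [w WE] : exists w, W_norm `]0, T[ (s + 1) u = w%:E.
  by exists (fine (W_norm `]0, T[ (s + 1) u)); rewrite fineK// ge0_fin_numE.
have w0 : 0 <= w by move: W0; rewrite WE lee_fin.
rewrite WE -EFinM.
pose rt := k `^ (Num.min r%:R s + 1) / r%:R `^ (s + 1 / 2).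
have rt0 : 0 <= rt by rewrite divr_ge0 ?powR_ge0.
have al0 : 0 <= rt * w by rewrite mulr_ge0.
apply: (@le_trans _ _ (E * (rt * w))%:E).
  apply: (cpg_Linf_le T0 L0 fL fC s32 ivp tP (fun _ _ => r3) mk UP
      (J := fun=> `]0, T[%classic) (W := fun=> w) _ al0) => n nN.
    by split; [exact: (subinterval_sub tP nN)|rewrite WE lexx].
  by rewrite mulrA ler_wpM2r// rate_mul// (step_gt0 tP nN) step_le_max.
rewrite lee_fin mulrA ler_wpM2r// -/rt mulrA ler_wpM2r//.
have p3 : 0 < ln 3 `^ (1 / 2) :> R by rewrite powR_gt0.
have lnr : ln 3 `^ (1 / 2) <= ln r%:R `^ (1 / 2) :> R.
  have h := ln3_le R r3.
  by rewrite ge0_ler_powR// nnegrE ?(ltW l3)// (le_trans (ltW l3)).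
apply: (@le_trans _ _ (E / ln 3 `^ (1 / 2) * ln 3 `^ (1 / 2))); first by rewrite divfK// gt_eqF.
apply: (le_trans (ler_wpM2l C0 lnr)); apply: ler_wpM2r; first exact: powR_ge0.
by rewrite lerDl.
Qed.
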